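(* Let $\Omega_+,\Omega_-\subset\mathbb{C}$ be compact domains with Lipschitz boundaries whose closed convex hulls satisfy $\operatorname{Co}(\Omega_+)\cap\operatorname{Co}(\Omega_-)=\varnothing$. Let $V=v_+\chi_{\Omega_+}-v_-\chi_{\Omega_-}$, where $v_\pm$ are bounded non-negative functions such that $\inf_{\Omega_\pm}v_\pm>0$. Then the singular values $s_n$ of the Bargmann-Toeplitz operator $T_V$ satisfy $$s_n=e^{-n\log n+O(n)},\quad n\to\infty .$$ Moreover, there exist constants $0<\delta_+\leq\Delta_+<1$ and $0<\delta_-\leq\Delta_-<1$ with $\delta_++\Delta_-=1$ and $\delta_-+\Delta_+=1$ such that, for both choices of sign $\pm$, $$\exp\Bigl(-\frac{n\log n}{\delta_\pm}+o(n\log n)\Bigr)\leq\lambda_n^\pm\leq\exp\Bigl(-\frac{n\log n}{\Delta_\pm}+o(n\log n)\Bigr),\quad n\to\infty .$$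
   Context: $dm$ is Lebesgue measure on $\mathbb{C}$. The Fock space $\mathcal{F}^2$ is the Hilbert space of entire functions $f$ with $\|f\|_{\mathcal{F}^2}^2=\int_{\mathbb{C}}|f(z)|^2e^{-|z|^2}\,dm(z)<\infty$, and $P_{\mathcal{F}^2}$ is the orthogonal projection in $L^2(\mathbb{C},e^{-|z|^2}dm(z))$ onto $\mathcal{F}^2$. For a bounded compactly supported function $V:\mathbb{C}\to\mathbb{R}$ the Bargmann-Toeplitz operator with symbol $V$ is $T_V:\mathcal{F}^2\to\mathcal{F}^2$, $T_Vf=P_{\mathcal{F}^2}(Vf)$; it is compact and self-adjoint. $\lambda_1^+\geq\lambda_2^+\geq\cdots$ is the sequence of positive eigenvalues of $T_V$ enumerated with multiplicities (if there are only $k$ of them, $\lambda_n^+=0$ for $n>k$); $\lambda_1^-\geq\lambda_2^-\geq\cdots$ is the corresponding sequence of positive eigenvalues of $-T_V=T_{-V}$, appended by zeros if necessary; $s_1\geq s_2\geq\cdots>0$ is the sequence of singular values of $T_V$ (the re-ordered union of the non-zero elements of the sequences $\{\lambda_n^+\}$ and $\{\lambda_n^-\}$). $\chi_\Omega$ is the characteristic function of $\Omega$. The relation $s_n=e^{-n\log n+O(n)}$ means $\log s_n=-n\log n+O(n)$. *)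

(* Defs.v *)
From mathcomp Require Import all_boot all_order all_algebra complex.
From mathcomp Require Import all_classical all_reals all_analysis.

Set Implicit Arguments.
Unset Strict Implicit.
Unset Printing Implicit Defensive.

Import Order.TTheory GRing.Theory Num.Theory numFieldNormedType.Exports.

Local Open Scope classical_set_scope.
Local Open Scope card_scope.
Local Open Scope complex_scope.
Local Open Scope ring_scope.

Notation normc := ComplexField.Normc.normc.

Section plane.
Variable R : realType.
Notation C := R[i].

(* The library has no measurable structure on R[i]; C is integrated over as
   R * R through this bijection. *)
Definition plane (p : R * R) : C := p.1 +i* p.2.

Definition dm : {measure set (measurableTypeR R * measurableTypeR R) -> \bar R} :=
  (lebesgue_measure \x lebesgue_measure)%E.

(* Measurability with respect to the completion of the Borel sigma-algebra:
   Borel measurable up to a set of Lebesgue measure zero. *)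
Definition lebesgue_measurable (v : C -> R) : Prop :=
  exists w : measurableTypeR R * measurableTypeR R -> R,
    measurable_fun setT w /\ {ae dm, forall p, v (plane p) = w p}.

Definition closed_convex_hull (Omega : set C) : set C :=
  smallest [set A : set C | @closed R[i]^o A /\
    @convex_set R (Rcomplex R) A] Omega.

(* Near the boundary point p, in the coordinates obtained by translating p to
   the origin and rotating by the unimodular number u, the set is the
   (closed) region above the graph of a Lipschitz function. *)
Definition lipschitz_boundary (Omega : set C) : Prop :=
  forall p : R[i]^o, (@closure R[i]^o Omega `\` @interior R[i]^o Omega) p ->
  exists (u : C) (phi : R^o -> R^o),
    [/\ normc u = 1, [lipschitz phi x | x in setT] &
      \forall z \near p, Omega z <->
        phi (complex.Re (u * (z - p))) <= complex.Im (u * (z - p))].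

Definition compact_domain (Omega : set C) : Prop :=
  [/\ @compact R[i]^o Omega,
      @interior R[i]^o Omega !=set0,
      @connected R[i]^o (@interior R[i]^o Omega) &
      @closure R[i]^o (@interior R[i]^o Omega) = Omega].

End plane.

Section fock.
Variable R : realType.
Notation C := R[i].

Definition gauss (z : C) : R := expR (- normc z ^+ 2).

Definition entire (f : C -> C) : Prop :=
  forall z : R[i]^o, derivable (f : R[i]^o -> R[i]^o) z 1.

Definition fock : set (C -> C) := [set f | entire f /\
  (\int[@dm R]_p (normc (f (plane p)) ^+ 2 * gauss (plane p))%:E < +oo)%E].

Definition integralC (h : C -> C) : C :=
  Rintegral (@dm R) setT (fun p => complex.Re (h (plane p))) +i*
  Rintegral (@dm R) setT (fun p => complex.Im (h (plane p))).

Definition inner (f g : C -> C) : C :=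
  integralC (fun z => f z * (g z)^* * (gauss z)%:C).

(* For h in L^2(C, e^{-|z|^2} dm) there is exactly one such g; the value 0 is
   irrelevant. *)
Definition fock_proj (h : C -> C) : C -> C :=
  xget (fun=> 0) [set g | fock g /\
    forall k, fock k -> inner (fun z => h z - g z) k = 0].

Definition toeplitz (V : C -> R) (f : C -> C) : C -> C :=
  fock_proj (fun z => (V z)%:C * f z).

Definition fock_eigenspace (T : (C -> C) -> (C -> C)) (mu : R) : set (C -> C) :=
  [set f | fock f /\ T f = (fun z => mu%:C * f z)].

Definition has_dim (E : set (C -> C)) (m : nat) : Prop :=
  exists b : 'I_m -> C -> C,
    [/\ forall i, E (b i),
        forall c : 'I_m -> C,
          (forall z, \sum_(i < m) c i * b i z = 0) -> forall i, c i = 0 &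
        forall f, E f -> exists c : 'I_m -> C,
          forall z, f z = \sum_(i < m) c i * b i z].

(* Non-increasing, every mu > 0 being repeated according to its multiplicity as
   an eigenvalue, remaining terms (if any) being 0. Indexing starts at 0. *)
Definition enumerates_pos_eigenvalues
    (T : (C -> C) -> (C -> C)) (lam : nat -> R) : Prop :=
  [/\ nonincreasing_seq lam,
      forall n, 0 <= lam n &
      forall mu, 0 < mu -> exists2 m,
        has_dim (fock_eigenspace T mu) m & [set n | lam n = mu] #= `I_m].

(* lambda_plus V n is the (n+1)-st eigenvalue, i.e. lambda_{n+1}^+. *)
Definition lambda_plus (V : C -> R) : nat -> R :=
  xget (fun=> 0) [set lam | enumerates_pos_eigenvalues (toeplitz V) lam].

Definition lambda_minus (V : C -> R) : nat -> R :=
  lambda_plus (fun z => - V z).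

(* Non-increasing rearrangement of the union (with multiplicities) of the
   non-zero terms of a and b, continued by 0 if that union is finite. *)
Definition rearranges_union (a b s : nat -> R) : Prop :=
  [/\ nonincreasing_seq s,
      forall n, 0 <= s n &
      forall mu, 0 < mu -> [set n | s n = mu] #=
        [set i : nat + nat |
          match i with inl n => a n | inr n => b n end = mu]].

(* singular_value V n is s_{n+1}. *)
Definition singular_value (V : C -> R) : nat -> R :=
  xget (fun=> 0) [set s |
    rearranges_union (lambda_plus V) (lambda_minus V) s].

End fock.

Section asymptotics.
Variable R : realType.

Definition nlogn (n : nat) : R := n%:R * ln n%:R.

(* a n stands for the term of index n+1 of the sequence, whence the shifts. *)
Definition eq_exp_nlogn (a : nat -> R) : Prop :=
  (fun n => ln (a n) + nlogn n.+1 : R^o) =O_\oo (fun n => n.+1%:R : R^o).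

Definition exp_nlogn_le (delta : R) (a : nat -> R) : Prop :=
  exists e : nat -> R,
    (e : nat -> R^o) =o_\oo (fun n => nlogn n.+1 : R^o) /\
    \forall n \near \oo, expR (- (nlogn n.+1 / delta) + e n) <= a n.

Definition le_exp_nlogn (Delta : R) (a : nat -> R) : Prop :=
  exists e : nat -> R,
    (e : nat -> R^o) =o_\oo (fun n => nlogn n.+1 : R^o) /\
    \forall n \near \oo, a n <= expR (- (nlogn n.+1 / Delta) + e n).

End asymptotics.

(* Main.v *)
Require Import Defs.
From HB Require Import structures.
From mathcomp Require Import all_boot all_order all_algebra complex finmap.
From mathcomp Require Import all_classical all_reals all_analysis.
From mathcomp Require Import measurable_realfun ring lra.

(** Write B(f, g) = <V f, g>, so that the eigenvalues of the Toeplitz operator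
    are given by minimax for the Hermitian form B.  The disjoint convex hulls
    are separated by a line, i.e. there is an affine function m with Re m >= eps
    on Omega_+ and Re m <= - eps on Omega_-; hence
    Re B(f, m f) >= c eps |f|^2 on Omega_+ U Omega_-.
    For a polynomial f of degree <= n orthogonal to the n leading eigenfunctions
    this is at most a multiple of s_n (|f|^2 + |m f|^2), and polynomials satisfy
    |f|^2 <= C^n n! |f|^2 on a disc, so s_n >= C^(-n) / n!.
    Conversely a combination f of n + 1 leading eigenfunctions can be chosen with
    T f orthogonal to the polynomials of degree < n; then B(f, m p) = 0 for the
    Taylor polynomial p of f, so by coercivity f is controlled on the support of
    V by its Taylor remainder, and T f is its own remainder: both are of size
    C^n / sqrt(n!), whence s_n <= C^n / n!.
    Testing with p ((m + x) / x)^(k n), which is negligible on Omega_-, gives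
    lambda_n^+ >= exp (- C n log n).  Thus a positive proportion of the first n
    singular values has either sign; delta_+ and delta_- are the lower densities
    of the two signs and Delta_+ = 1 - delta_-, Delta_- = 1 - delta_+. *)

Set Implicit Arguments.
Unset Strict Implicit.
Unset Printing Implicit Defensive.

Import Order.TTheory GRing.Theory Num.Theory numFieldNormedType.Exports.

Local Open Scope classical_set_scope.
Local Open Scope complex_scope.
Local Open Scope ring_scope.

Import ComplexField.Normc.


(** * Asymptotics of merged sequences *)

Section orders.
Variable R : realType.

(** The form B is indefinite, so <V f, f> alone does not control f. Putting m into one argument
    replaces the weight V by V Re m, which is bounded below on the support; the price is one
    polynomial degree, invisible at the scale e^(O(n)). The crossed relations between the constants
    come from positions. If the i-th positive eigenvalue stands at place N of the merged sequence,
    then its logarithm is -N log N + O(N). As i is comparable to N, log N = log i + O(1), so N log N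
    is i log i divided by the ratio i/N, and this ratio lies asymptotically between delta_+ and
    Delta_+. The two signs share the places, so the upper density of one is 1 minus the lower
    density of the other. [lambda_plus] and [singular_value] are chosen by [xget]: to identify them,
    a decreasing enumeration with prescribed multiplicities must be shown to be unique. The function
    theory starts from complex differentiability: Goursat's theorem gives circle means, these give
    the Gaussian mean value, and translating it gives the reproducing kernel and the monomial
    basis. *)

Lemma ln_nat_large (A : R) : \forall n \near \oo, A <= ln (n.+1%:R : R).
Proof.
exists (Num.bound (expR A)) => // n /= hn.
rewrite -[A]expRK ler_ln ?posrE ?expR_gt0 ?ltr0n//.
apply: ltW; apply: lt_le_trans (archi_boundP _) _; first exact: expR_ge0.
by rewrite ler_nat leqW.
Qed.

Definition ordered_like (s : nat -> R) : Prop :=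
  exists2 K, 0 < K & \forall n \near \oo, `|ln (s n) + nlogn R n.+1| <= K * n.+1%:R.

Lemma ordered_like_eq (s : nat -> R) : ordered_like s -> eq_exp_nlogn s.
Proof.
move=> [K K0 H]; apply/eqO_exP; exists K => //; apply: filterS H => n.
by rewrite [X in _ -> _ <= _ * X]ger0_norm.
Qed.

(** * Asymptotics of one sequence from its positions in the merged one *)

Section pullback.
Variables (s a : nat -> R) (I N : nat -> nat) (delta Delta : R).
Hypothesis sE : ordered_like s.
Hypothesis a_gt0 : forall i, 0 < a i.
Hypothesis NP : forall i, [/\ I (N i) = i, s (N i) = a i & (i <= N i)%N].
Hypothesis delta0 : 0 < delta.
Hypothesis Delta0 : 0 < Delta.
Hypothesis I_ge : forall e, 0 < e ->
  \forall n \near \oo, (delta - e) * n.+1%:R <= (I n).+1%:R :> R.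
Hypothesis I_le : forall e, 0 < e ->
  \forall n \near \oo, (I n).+1%:R <= (Delta + e) * n.+1%:R :> R.

Let N_large (P : nat -> Prop) : (\forall n \near \oo, P n) -> \forall i \near \oo, P (N i).
Proof.
move=> [k _ kP]; exists k => // i /= ki; apply: kP => /=; apply: leq_trans ki _.
by have [] := NP i.
Qed.

(** Write x = i + 1 and y = [N i] + 1. Up to K y, ln (a i) is -y ln y, and y <= c x for a [c]
    slightly above 1/delta, so ln (a i) >= -c x (ln x + ln c + K). Half of [e] pays for c - 1/delta,
    the other half for the linear terms once ln x is large. *)
Let ln_a_ge e : 0 < e -> \forall i \near \oo,
  - (e * nlogn R i.+1) <= ln (a i) + nlogn R i.+1 / delta.
Proof.
move=> e0; have [K K0 /N_large HK] := sE.
pose c := delta^-1 + e / 2.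
have c0 : 0 < c by rewrite addr_gt0 ?invr_gt0// divr_gt0.
have cd : 0 < delta - c^-1.
  by rewrite subr_gt0 -[ltRHS]invrK ltf_pV2 ?posrE ?invr_gt0// ltrDl divr_gt0.
near=> i.
have h1 : `|ln (s (N i)) + nlogn R (N i).+1| <= K * (N i).+1%:R.
  by near: i; exact: HK.
have h2 : (delta - (delta - c^-1)) * (N i).+1%:R <= (I (N i)).+1%:R.
  by near: i; exact: (N_large (I_ge cd)).
(* The first summand lets ln x absorb the linear terms; the second makes ln x + ln c + K
   nonnegative, so that y <= c x may be multiplied by it. *)
have h3 : (1 + `|c * (ln c + K)|) / (e / 2) + `|ln c + K| <= ln (i.+1%:R : R).
  by near: i; exact: ln_nat_large.
have [Ii si iN] := NP i; rewrite Ii in h2; rewrite si in h1.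
move: h1 h2; rewrite /nlogn; set x := i.+1%:R; set y := (N i).+1%:R => h1 h2.
have x0 : 0 < x by rewrite ltr0n.
have y0 : 0 < y by rewrite ltr0n.
have ycx : y <= c * x.
  by move: h2; rewrite opprB addrC subrK mulrC ler_pdivrMr// mulrC.
have lny : ln y <= ln c + ln x.
  by rewrite -lnM ?posrE// ler_ln ?posrE// mulr_gt0.
have e20 : 0 < e / 2 by rewrite divr_gt0.
have h4 : (1 + `|c * (ln c + K)|) <= e / 2 * ln x.
  by rewrite [e / 2 * _]mulrC -ler_pdivrMr//; apply: (le_trans _ h3); rewrite lerDl.
have h5 : 0 <= ln x + (ln c + K).
  have h6 : `|ln c + K| <= ln x by apply: (le_trans _ h3); rewrite lerDr divr_ge0 ?ltW// ltr_pwDl.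
  by move: h6; rewrite ler_norml => /andP[? _]; lra.
have h7 : y * (ln y + K) <= c * x * (ln x + (ln c + K)).
  apply: le_trans (_ : y * (ln x + (ln c + K)) <= _).
    by rewrite ler_pM2l//; lra.
  exact: ler_wpM2r.
have h8 : x * (c * (ln c + K)) <= x * (e / 2 * ln x).
  rewrite ler_pM2l//; apply: (le_trans _ h4); apply: le_trans (ler_norm _) _.
  by rewrite lerDr.
have h9 : - (K * y) <= ln (a i) + y * ln y by move: h1; rewrite ler_norml => /andP[].
have h10 : c * x * ln x = x * ln x / delta + e / 2 * (x * ln x) by rewrite /c; ring.
move: h7 h8; rewrite !mulrDr -!mulrA; lra.
Unshelve. all: by end_near. Qed.

Let ln_a_le e : 0 < e -> \forall i \near \oo,
  ln (a i) + nlogn R i.+1 / Delta <= e * nlogn R i.+1.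
Proof.
move=> e0; have [K K0 /N_large HK] := sE.
have e20 : 0 < e / 2 by rewrite divr_gt0.
pose c := Delta^-1 - e / 2.
have y_ge : \forall i \near \oo, c * i.+1%:R <= (N i).+1%:R.
  (* For large [e] the number [c] is nonpositive and the bound is void; otherwise [I_le] is applied
     with the error c^-1 - Delta. *)
  have [c0|c0] := leP c 0.
    by near=> i; apply: le_trans (_ : 0 <= _) => //; exact: mulr_le0_ge0.
  have cd : 0 < c^-1 - Delta.
    by rewrite subr_gt0 -[ltLHS]invrK ltf_pV2 ?posrE ?invr_gt0// ltrBlDr ltrDl.
  near=> i.
  have : (I (N i)).+1%:R <= (Delta + (c^-1 - Delta)) * (N i).+1%:R :> R.
    by near: i; exact: (N_large (I_le cd)).
  by have [-> _ _] := NP i; rewrite addrC subrK mulrC ler_pdivlMr// mulrC.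
near=> i.
have h1 : `|ln (s (N i)) + nlogn R (N i).+1| <= K * (N i).+1%:R.
  by near: i; exact: HK.
have h2 : c * i.+1%:R <= (N i).+1%:R by near: i.
have h3 : `|c * K| / (e / 2) + K <= ln (i.+1%:R : R).
  by near: i; exact: ln_nat_large.
have [Ii si iN] := NP i; rewrite si in h1.
move: h1 h2; rewrite /nlogn.
have : (i.+1%:R : R) <= (N i).+1%:R by rewrite ler_nat ltnS.
set x := i.+1%:R; set y := (N i).+1%:R => xy h1 h2.
have x0 : 0 < x by rewrite ltr0n.
have y0 : 0 < y by rewrite ltr0n.
have lny : ln x <= ln y by rewrite ler_ln ?posrE.
have h5 : 0 <= ln x - K.
  by rewrite subr_ge0; apply: (le_trans _ h3); rewrite lerDr divr_ge0 // ltW.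
have h4 : c * K <= e / 2 * ln x.
  rewrite [e / 2 * _]mulrC -ler_pdivrMr//.
  apply: (le_trans _ h3); rewrite -[leLHS]addr0 lerD ?(ltW K0)// ler_pM2r ?invr_gt0//.
  exact: ler_norm.
have h7 : c * x * (ln x - K) <= y * (ln y - K).
  apply: le_trans (_ : y * (ln x - K) <= _); first exact: ler_wpM2r.
  by rewrite ler_pM2l//; lra.
have h8 : x * (c * K) <= x * (e / 2 * ln x) by rewrite ler_pM2l.
have h9 : ln (a i) + y * ln y <= K * y by move: h1; rewrite ler_norml => /andP[].
have h10 : c * x * ln x = x * ln x / Delta - e / 2 * (x * ln x) by rewrite /c; ring.
move: h7 h8; rewrite !mulrBr -!mulrA; lra.
Unshelve. all: by end_near. Qed.

Let nlogn_ge0 i : 0 <= nlogn R i.+1.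
Proof. by rewrite mulr_ge0// ln_ge0// ler1n. Qed.

(** The error term is the negative part of the exact discrepancy: the inequality then holds by
    construction, and [ln_a_ge] says precisely that this negative part is o(n log n). *)
Lemma pullback_ge : exp_nlogn_le delta a.
Proof.
exists (fun i => Num.min 0 (ln (a i) + nlogn R i.+1 / delta)); split; last first.
  near=> i; rewrite -[leRHS]lnK ?posrE// ler_expR addrC -lerBrDr opprK.
  by rewrite ge_min lexx orbT.
apply/eqoP => e e0; apply: filterS (ln_a_ge e0) => i h.
rewrite (ger0_norm (nlogn_ge0 i)) ler0_norm ?ge_min ?lexx// oppr_min.
by rewrite oppr0 ge_max mulr_ge0 ?(ltW e0)//= lerNl.
Unshelve. all: by end_near. Qed.

Lemma pullback_le : le_exp_nlogn Delta a.
Proof.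
exists (fun i => Num.max 0 (ln (a i) + nlogn R i.+1 / Delta)); split; last first.
  near=> i; rewrite -[leLHS]lnK ?posrE// ler_expR addrC -lerBlDr opprK.
  by rewrite le_max lexx orbT.
apply/eqoP => e e0; apply: filterS (ln_a_le e0) => i h.
rewrite (ger0_norm (nlogn_ge0 i)) ger0_norm ?le_max ?lexx//.
by rewrite ge_max mulr_ge0 ?(ltW e0).
Unshelve. all: by end_near. Qed.

End pullback.

Section linear_growth.
Variables (s a : nat -> R) (I N : nat -> nat).
Hypothesis sE : ordered_like s.
Hypothesis I_mono : forall m n, (m <= n)%N -> (I m <= I n)%N.
Hypothesis NP : forall i, [/\ I (N i) = i, I (N i).+1 = i.+1 & s (N i) = a i].
Hypothesis Ile : forall m, (I m <= m)%N.
Variable C : R.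
Hypothesis C0 : 0 < C.
Hypothesis a_ge : \forall i \near \oo, - (C * nlogn R i.+1) <= ln (a i).

(** Let n' = [N (I n)] >= n be the place of the next term of [a]. There s n' = a (I n) is at most
    exp (-n' log n' + K n') and at least exp (-C (I n) log (I n)) up to the shift of indices, so n'
    log n' - K n' <= C (I n + 1) log n'. Once K is below half of log n', division by log n' gives n'
    / 2 <= C (I n + 1). *)
Lemma linear_growth : exists2 d : R, 0 < d & \forall n \near \oo, d * n.+1%:R <= (I n).+1%:R.
Proof.
have [K K0 [k0 _ sK]] := sE; have [m0 _ aC] := a_ge.
exists (2 * C)^-1; first by rewrite invr_gt0 mulr_gt0.
have [l0 _ lP] := ln_nat_large (2 * K + 1).
exists (N m0 + k0 + l0)%N => // n /= hn.
have [h1 h2 h3] := NP (I n).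
have nN : (n <= N (I n))%N.
  by rewrite leqNgt; apply/negP => /I_mono; rewrite h2 ltnn.
have m0I : (m0 <= I n)%N.
  have [<- _ _] := NP m0; apply: I_mono; apply: leq_trans hn.
  by rewrite -addnA leq_addr.
set n' := N (I n) in h1 h2 h3 nN *.
have k0n : (k0 <= n')%N by apply: leq_trans nN; apply: leq_trans hn; rewrite addnAC leq_addl.
have l0n : (l0 <= n')%N by apply: leq_trans nN; apply: leq_trans hn; rewrite leq_addl.
have In : (I n <= n')%N.
  by rewrite -[leqLHS]h1.
have := sK n' k0n; rewrite h3 ler_norml => /andP[_].
have := aC _ m0I; have := lP n' l0n; rewrite /nlogn /=.
have : ((I n).+1%:R : R) <= n'.+1%:R by rewrite ler_nat.
have : (n.+1%:R : R) <= n'.+1%:R by rewrite ler_nat ltnS.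
have : (0 : R) < (I n).+1%:R by rewrite ltr0n.
set x := (I n).+1%:R; set y := n'.+1%:R; set z := n.+1%:R => x0 zy xy hK ha hs.
have y0 : 0 < y by exact: lt_le_trans x0 xy.
have lnxy : ln x <= ln y by rewrite ler_ln ?posrE.
have ly0 : 0 < ln y by lra.
have h4 : y * ln y - K * y <= C * x * ln y.
  have : C * (x * ln x) <= C * (x * ln y) by rewrite !ler_pM2l.
  by rewrite mulrA [C * (x * ln y)]mulrA; lra.
have h5 : y * (ln y / 2) <= C * x * ln y.
  apply: (le_trans _ h4); have : 0 <= y * (ln y / 2 - K) by rewrite mulr_ge0 ?ltW//; lra.
  by rewrite mulrBr mulrA [K * y]mulrC; lra.
have h6 : y / 2 <= C * x.
  by rewrite -(ler_pM2r ly0) mulrAC -mulrA.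
by rewrite mulrC ler_pdivrMr ?mulr_gt0//; lra.
Qed.

End linear_growth.
End orders.

(** * Densities of two complementary counting functions *)

Section densities.
Variable R : realType.

(** The density is the supremum of the admissible slopes. The supremum itself need not be
    admissible, hence the loss of an arbitrary [e]. *)
Lemma lower_density (I : nat -> nat) (B : R) : 
  (exists2 d : R, 0 < d & \forall n \near \oo, d * n.+1%:R <= (I n).+1%:R) ->
  (forall d : R, (\forall n \near \oo, d * n.+1%:R <= (I n).+1%:R) -> d <= B) ->
  exists delta : R, [/\ 0 < delta, delta <= B &
    forall e, 0 < e -> \forall n \near \oo, (delta - e) * n.+1%:R <= (I n).+1%:R].
Proof.
move=> [d0 d00 Hd0] HB.
pose D := [set d : R | \forall n \near \oo, d * n.+1%:R <= (I n).+1%:R].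
have Dub : has_ubound D by exists B => d /HB.
exists (sup D); split.
- by apply: lt_le_trans d00 _; apply: ub_le_sup.
- by apply: ge_sup; [exists d0|move=> d /HB].
- move=> e e0; have [d Dd hd] : exists2 d, D d & sup D - e < d.
    by apply: sup_adherent => //; split=> //; exists d0.
  apply: filterS Dd => n; apply: le_trans.
  by rewrite ler_pM2r ?ltr0n// ltW.
Qed.

(** Admissible slopes for [I] and [J] add up to at most 1 because the counts add up to n, which
    bounds the second supremum by 1 - dp; the upper bounds are the lower bounds of the complementary
    count. The stray 1 in (I n + 1) + (J n + 1) = (n + 1) + 1 is absorbed by [e]. *)
Lemma densities (I J : nat -> nat) : (forall n, (I n + J n)%N = n) ->
  (exists2 d : R, 0 < d & \forall n \near \oo, d * n.+1%:R <= (I n).+1%:R) ->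
  (exists2 d : R, 0 < d & \forall n \near \oo, d * n.+1%:R <= (J n).+1%:R) ->
  exists dp dm : R, [/\ 0 < dp, 0 < dm, dp + dm <= 1,
   (forall e, 0 < e -> \forall n \near \oo, (dp - e) * n.+1%:R <= (I n).+1%:R :> R) /\
   (forall e, 0 < e -> \forall n \near \oo, (dm - e) * n.+1%:R <= (J n).+1%:R :> R) &
   (forall e, 0 < e -> \forall n \near \oo, (I n).+1%:R <= (1 - dm + e) * n.+1%:R :> R) /\
   (forall e, 0 < e -> \forall n \near \oo, (J n).+1%:R <= (1 - dp + e) * n.+1%:R :> R)].
Proof.
move=> IJ HI HJ.
have IJ1 n : (I n).+1%:R + (J n).+1%:R = n.+1%:R + 1 :> R.
  by rewrite -natrD addSn addnS IJ -natr1.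
have large e : 0 < e -> \forall n \near \oo, 1 <= e * (n.+1%:R : R).
  move=> e0; exists (Num.bound e^-1) => // n /= hn.
  rewrite mulrC -ler_pdivrMr// div1r; apply: ltW.
  apply: lt_le_trans (archi_boundP _) _; first by rewrite invr_ge0 ltW.
  by rewrite ler_nat leqW.
have sum_le1 (d d' : R) : (\forall n \near \oo, d * n.+1%:R <= (I n).+1%:R) ->
    (\forall n \near \oo, d' * n.+1%:R <= (J n).+1%:R) -> d + d' <= 1.
  move=> hd hd'; apply/ler_addgt0Pl => e e0.
  have [n [h1 h2 h3]] : exists n, [/\ d * n.+1%:R <= (I n).+1%:R,
      d' * n.+1%:R <= (J n).+1%:R & 1 <= e * (n.+1%:R : R)].
    have H : \forall n \near \oo, [/\ d * n.+1%:R <= (I n).+1%:R,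
      d' * n.+1%:R <= (J n).+1%:R & 1 <= e * (n.+1%:R : R)].
      by near=> n; split; near: n => //; exact: large.
    by have [N _ /(_ N (leqnn N))] := H; exists N.
  rewrite -(@ler_pM2r _ n.+1%:R) ?ltr0n// mulrDl; apply: le_trans (lerD h1 h2) _.
  by rewrite IJ1 mulrDl mul1r addrC lerD2r.
have [dp [dp0 dpl Hdp]] : exists delta : R, [/\ 0 < delta, delta <= 1 &
    forall e, 0 < e -> \forall n \near \oo, (delta - e) * n.+1%:R <= (I n).+1%:R].
  apply: lower_density => // d hd; rewrite -[d]addr0; apply: sum_le1 hd _.
  by near=> n; rewrite mul0r.
have [dm [dm0 dml Hdm]] : exists delta : R, [/\ 0 < delta, delta <= 1 - dp &
    forall e, 0 < e -> \forall n \near \oo, (delta - e) * n.+1%:R <= (J n).+1%:R].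
  apply: lower_density => // d hd; rewrite lerBrDr.
  apply/ler_addgt0Pl => e e0.
  by have := sum_le1 _ _ (Hdp e e0) hd; lra.
exists dp, dm; split => //; first by rewrite addrC -lerBrDr.
split=> e e0.
  have e20 : 0 < e / 2 by rewrite divr_gt0.
  near=> n.
  have h1 : 1 <= e / 2 * (n.+1%:R : R) by near: n; exact: large.
  have h2 : (dm - e / 2) * n.+1%:R <= (J n).+1%:R by near: n; exact: Hdm.
  by move: (IJ1 n) h1 h2; set x : R := (I n).+1%:R; set y : R := n.+1%:R; lra.
have e20 : 0 < e / 2 by rewrite divr_gt0.
near=> n.
have h1 : 1 <= e / 2 * (n.+1%:R : R) by near: n; exact: large.
have h2 : (dp - e / 2) * n.+1%:R <= (I n).+1%:R by near: n; exact: Hdp.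
by move: (IJ1 n) h1 h2; set x : R := (I n).+1%:R; set y : R := n.+1%:R; lra.
Unshelve. all: by end_near. Qed.

End densities.

(** * Decreasing sequences with given multiplicities, and merging two of them *)

Section multiplicities.
Variable R : realType.
Implicit Types u v a b s : nat -> R.

(** At a first index n with w n < t n, the value t n is attained by [w] only before n, where [w] and
    [t] agree, while [t] attains it at n as well. Finite level sets of equal cardinality exclude
    this. *)
Lemma multiplicities_inj u v : nonincreasing_seq u -> nonincreasing_seq v ->
  (forall n, 0 <= u n) -> (forall n, 0 <= v n) ->
  (forall mu, 0 < mu -> finite_set [set n | u n = mu] /\
     [set n | u n = mu] #= [set n | v n = mu])%card -> u = v.
Proof.
move=> ni_u ni_v u0 v0 uv.
have main (w t : nat -> R) n : nonincreasing_seq w -> 0 <= w n ->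
    finite_set [set k | w k = t n] -> finite_set [set k | t k = t n] ->
    ([set k | w k = t n] #= [set k | t k = t n])%card ->
    (forall k, (k < n)%N -> w k = t k) -> t n <= w n.
  move=> niw wn0 fw ft wt IH; rewrite leNgt; apply/negP => wtn.
  have sub k : w k = t n -> (k < n)%N.
    move=> wk; rewrite ltnNge; apply/negP => /niw; rewrite wk => h.
    by have := le_lt_trans h wtn; rewrite ltxx.
  have /(fcard_eq fw ft) h := wt.
  have AB : fset_set [set k | w k = t n] = fset_set [set k | t k = t n].
    apply/eqP; rewrite finmap.eqEfcard h leqnn andbT; apply/finmap.fsubsetP => k.
    rewrite !in_fset_set// !inE/= => wk.
    by rewrite -IH//; exact: sub.
  have : n \in fset_set [set k | t k = t n] by rewrite in_fset_set// inE.
  by rewrite -AB in_fset_set// inE/= => /sub; rewrite ltnn.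
apply/funext => n; elim/ltn_ind: n => n IH.
apply/eqP; rewrite eq_le; apply/andP; split; rewrite leNgt; apply/negP => h.
- have un0 : 0 < u n by exact: le_lt_trans (v0 n) h.
  have [fu cuv] := uv _ un0.
  have fv : finite_set [set k | v k = u n] by rewrite -(eq_finite_set cuv).
  have := main v u n ni_v (v0 n) fv fu; rewrite card_eq_sym => /(_ cuv).
  by rewrite leNgt h => /(_ (fun k kn => esym (IH k kn))).
- have vn0 : 0 < v n by exact: le_lt_trans (u0 n) h.
  have [fu cuv] := uv _ vn0.
  have fv : finite_set [set k | v k = v n] by rewrite -(eq_finite_set cuv).
  have := main u v n ni_u (u0 n) fu fv cuv IH.
  by rewrite leNgt h.
Qed.

Section merge.
Variables a b : nat -> R.
Hypothesis nia : nonincreasing_seq a.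
Hypothesis nib : nonincreasing_seq b.
Hypothesis a0 : forall n, 0 < a n.
Hypothesis b0 : forall n, 0 < b n.
Hypothesis a_small : forall e, 0 < e -> exists n, a n < e.
Hypothesis b_small : forall e, 0 < e -> exists n, b n < e.

(** The state counts the terms already taken from [a] and from [b]. Its two components are the
    counting functions whose densities become delta and, through complements, Delta. *)
Fixpoint merge_pos n : nat * nat :=
  if n is m.+1 then
    let: (i, j) := merge_pos m in if b j <= a i then (i.+1, j) else (i, j.+1)
  else (0, 0)%N.

Local Notation I n := (merge_pos n).1.
Local Notation J n := (merge_pos n).2.

Definition merge_seq n := Num.max (a (I n)) (b (J n)).

Lemma merge_posS n : (b (J n) <= a (I n) /\ (I n.+1 = (I n).+1 /\ J n.+1 = J n) /\
     merge_seq n = a (I n)) \/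
  (a (I n) < b (J n) /\ (I n.+1 = I n /\ J n.+1 = (J n).+1) /\ merge_seq n = b (J n)).
Proof.
rewrite /merge_seq /=; case: (merge_pos n) => i j /=; case: ifPn => h; [left|right].
  by split=> //; split=> //; rewrite max_l.
by move: h; rewrite -ltNge => h; split=> //; split=> //; rewrite max_r// ltW.
Qed.

Lemma merge_pos_add n : (I n + J n = n)%N.
Proof.
elim: n => // n IH.
by have [[_ [[-> ->] _]]|[_ [[-> ->] _]]] := merge_posS n; rewrite ?addSn ?addnS IH.
Qed.

Lemma merge_pos_mono m n : (m <= n)%N -> (I m <= I n)%N /\ (J m <= J n)%N.
Proof.
move=> /subnKC <-; elim: (n - m)%N => [|k [h1 h2]]; first by rewrite addn0.
rewrite addnS.
by have [[_ [[-> ->] _]]|[_ [[-> ->] _]]] := merge_posS (m + k)%N; split=> //; exact: leqW.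
Qed.

Lemma merge_seqS n : merge_seq n.+1 <= merge_seq n.
Proof.
rewrite {1}/merge_seq.
have [[h [[-> ->] ->]]|[h [[-> ->] ->]]] := merge_posS n; rewrite ge_max.
  by rewrite h andbT nia.
by rewrite (ltW h) nib.
Qed.

Lemma merge_seq_noninc : nonincreasing_seq merge_seq.
Proof. by apply/nonincreasing_seqP => n; exact: merge_seqS. Qed.

Lemma merge_seq_gt0 n : 0 < merge_seq n.
Proof. by rewrite lt_max a0. Qed.

Lemma merge_seq_le n : (forall k, (k < I n)%N -> merge_seq n <= a k) /\
  (forall k, (k < J n)%N -> merge_seq n <= b k).
Proof.
elim: n => // n [IHa IHb].
have hS := merge_seqS n.
have [[h [[-> ->] sE]]|[h [[-> ->] sE]]] := merge_posS n.
  split=> k; last by move=> /IHb; exact: le_trans.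
  by rewrite ltnS leq_eqVlt => /predU1P[->|/IHa]; [rewrite -sE|exact: le_trans].
split=> k; first by move=> /IHa; exact: le_trans.
by rewrite ltnS leq_eqVlt => /predU1P[->|/IHb]; [rewrite -sE|exact: le_trans].
Qed.

(** Choose k with b k < a i. If the counter of [a] never passed i, then at step i + k the counter of
    [b] would have reached k, and every later step would take from [a]. The witness is the step just
    before the counter first exceeds i. *)
Lemma merge_hit_l i : exists n, [/\ I n = i, I n.+1 = i.+1, J n.+1 = J n & merge_seq n = a i].
Proof.
have [k bk] := b_small (a0 i).
have Ik : exists n, (i < I n)%N.
  apply: contrapT => /forallNP H.
  have Ii n : (I n <= i)%N by rewrite leqNgt; apply/negP/H.
  have Jk : (k <= J (i + k)%N)%N.
    by rewrite -(leq_add2l i) -{1}(merge_pos_add (i + k)%N) leq_add2r.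
  have := Ii (i + k).+1.
  have : forall m, (i + k <= m)%N -> I m.+1 = (I m).+1.
    move=> m /merge_pos_mono[_ hJ].
    have [[_ [[-> _] _]]//|[h _]] := merge_posS m.
    have := lt_le_trans h (nib (leq_trans Jk hJ)) => h'.
    by have := lt_trans (lt_le_trans bk (nia (Ii m))) h'; rewrite ltxx.
  move=> Hm _.
  have Im m : (m <= I (i + k + m)%N)%N.
    by elim: m => // m IHm; rewrite addnS Hm ?leq_addr.
  by have := leq_trans (Im i.+1) (Ii _); rewrite ltnn.
pose n := ex_minn Ik.
have : (i < I n)%N /\ forall m, (i < I m)%N -> (n <= m)%N by rewrite /n; case: ex_minnP.
case: n => [|n] [] // h1 h2; exists n.
have Ini : (I n <= i)%N by rewrite leqNgt; apply/negP => /h2; rewrite ltnn.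
have [[h [[E1 E2] E3]]|[h [[E1 E2] E3]]] := merge_posS n; move: h1; rewrite E1.
  rewrite ltnS => h1; have Ii : I n = i by apply/eqP; rewrite eqn_leq Ini h1.
  by rewrite E2 E3 Ii.
by move=> h1; have := leq_trans h1 Ini; rewrite ltnn.
Qed.

Lemma merge_hit_r j : exists n, [/\ J n = j, J n.+1 = j.+1, I n.+1 = I n & merge_seq n = b j].
Proof.
have [k ak] := a_small (b0 j).
have Jk : exists n, (j < J n)%N.
  apply: contrapT => /forallNP H.
  have Jj n : (J n <= j)%N by rewrite leqNgt; apply/negP/H.
  have Ik : (k <= I (j + k)%N)%N.
    by rewrite -(leq_add2r j) addnC -{1}(merge_pos_add (j + k)%N) leq_add2l.
  have Hm : forall m, (j + k <= m)%N -> J m.+1 = (J m).+1.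
    move=> m /merge_pos_mono[hI _].
    have [[h _]|[_ [[_ ->] _]]//] := merge_posS m.
    have := le_trans h (nia (leq_trans Ik hI)) => h'.
    by have := lt_le_trans (lt_le_trans ak (nib (Jj m))) h'; rewrite ltxx.
  have Im m : (m <= J (j + k + m)%N)%N.
    by elim: m => // m IHm; rewrite addnS Hm ?leq_addr.
  by have := leq_trans (Im j.+1) (Jj _); rewrite ltnn.
pose n := ex_minn Jk.
have : (j < J n)%N /\ forall m, (j < J m)%N -> (n <= m)%N by rewrite /n; case: ex_minnP.
case: n => [|n] [] // h1 h2; exists n.
have Jnj : (J n <= j)%N by rewrite leqNgt; apply/negP => /h2; rewrite ltnn.
have [[h [[E1 E2] E3]]|[h [[E1 E2] E3]]] := merge_posS n; move: h1; rewrite E2.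
  by move=> h1; have := leq_trans h1 Jnj; rewrite ltnn.
rewrite ltnS => h1; have Jj : J n = j by apply/eqP; rewrite eqn_leq Jnj h1.
by rewrite E1 E3 Jj.
Qed.

(** The term consumed at step n, as an element of the disjoint union. It is injective because the
    counter of the consumed side moves past it, and onto by the two [merge_hit] lemmas: this is the
    bijection required on each level set by [rearranges_union]. *)
Let origin n : nat + nat := if b (J n) <= a (I n) then inl (I n) else inr (J n).

Let origin_inj : injective origin.
Proof.
have main m n : (m < n)%N -> origin m <> origin n.
  move=> mn; have [hI hJ] := merge_pos_mono mn; rewrite /origin.
  have [[h [[E1 E2] E3]]|[h [[E1 E2] E3]]] := merge_posS m.
    rewrite h; case: ifP => // _ [E]; move: hI; rewrite E1 E ltnn//.
  rewrite leNgt h/=; case: ifP => // _ [E]; move: hJ; rewrite E2 E ltnn//.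
move=> m n mn; apply/eqP; rewrite eqn_leq; apply/andP; split; rewrite leqNgt.
  by apply/negP => /main; rewrite mn.
by apply/negP => /main; rewrite mn.
Qed.

Lemma merge_rearranges : rearranges_union a b merge_seq.
Proof.
split; [exact: merge_seq_noninc|by move=> n; exact/ltW/merge_seq_gt0|].
move=> mu mu0.
have -> : [set i : nat + nat | match i with inl n => a n | inr n => b n end = mu] =
    origin @` [set n | merge_seq n = mu].
  apply/seteqP; split => [[i|j]/= E|_ [n /= E <-]].
  - have [n [h1 h2 h3 h4]] := merge_hit_l i; exists n; first by rewrite h4.
    rewrite /origin; have [[-> _]|[_ [[E1 _] _]]] := merge_posS n; first by rewrite h1.
    by move: h2; rewrite E1 h1 => /n_Sn.
  - have [n [h1 h2 h3 h4]] := merge_hit_r j; exists n; first by rewrite h4.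
    rewrite /origin; have [[_ [[_ E1] _]]|[E1 _]] := merge_posS n.
      by move: h2; rewrite E1 h1 => /n_Sn.
    by rewrite leNgt E1/= h1.
  - rewrite /origin; have [[h [_ E3]]|[h [_ E3]]] := merge_posS n.
      by rewrite h -E3.
    by rewrite leNgt h/= -E3.
by rewrite card_eq_sym; apply: inj_card_eq => x y _ _; exact: origin_inj.
Qed.

(** With a k < mu and b l < mu, any step n >= k + l has passed k in [a], or passed l in [b], or
    stands exactly at (k, l); in each case the value there is below [mu]. *)
Lemma merge_seq_finite mu : 0 < mu -> finite_set [set n | merge_seq n = mu].
Proof.
move=> mu0; have [k ak] := a_small mu0; have [l bl] := b_small mu0.
apply: (@sub_finite_set _ _ `I_(k + l)%N); last exact: finite_II.
move=> n /= E; rewrite ltnNge; apply/negP => kln.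
have [hI|hI] := ltnP k (I n); have [h1 h2] := merge_seq_le n.
  by have := h1 _ hI; rewrite E leNgt ak.
have [hJ|hJ] := ltnP l (J n).
  by have := h2 _ hJ; rewrite E leNgt bl.
have : (n <= k + l)%N by rewrite -(merge_pos_add n) leq_add.
move=> nkl; have nE : n = (k + l)%N by apply/eqP; rewrite eqn_leq nkl.
have IE : I n = k.
  apply/eqP; rewrite eqn_leq hI/= -(leq_add2r l) -nE -{1}(merge_pos_add n).
  by rewrite leq_add2l.
have JE : J n = l by apply/eqP; rewrite -(eqn_add2l k) -{1}IE merge_pos_add nE.
by move: E; rewrite /merge_seq IE JE => E; have := ltxx mu; rewrite -{1}E gt_max ak bl.
Qed.

End merge.

Lemma rearranges_union_unique a b s s' : (forall mu, 0 < mu -> finite_set [set n | s n = mu]) ->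
  rearranges_union a b s -> rearranges_union a b s' -> s = s'.
Proof.
move=> fs [n1 p1 c1] [n2 p2 c2]; apply: multiplicities_inj => // mu mu0.
split; first exact: fs.
by apply: card_eq_trans (c1 _ mu0) _; rewrite card_eq_sym; exact: c2.
Qed.

End multiplicities.

(** * Goursat's theorem and entire functions *)

Section segment_integral.
Variable R : realType.
Implicit Types g : R -> R.
Notation mu := (@lebesgue_measure R).

Definition itg g (a b : R) : R := \int[mu]_(x in `[a, b]) g x.

Lemma integrable_segment g a b : continuous g -> mu.-integrable `[a, b] (EFin \o g).
Proof.
move=> cg; apply: continuous_compact_integrable; first exact: segment_compact.
by apply: continuous_subspaceT.
Qed.

Lemma itg_split g a m b : continuous g -> a <= m -> m <= b ->
  itg g a b = itg g a m + itg g m b.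
Proof.
move=> cg am mb; apply/eqP; rewrite addrC -subr_eq; apply/eqP.
rewrite /itg Rintegral_itvB ?bnd_simp//; last exact: integrable_segment.
rewrite Rintegral_itv_obnd_cbnd//.
apply: integrableS (integrable_segment m b cg) => //.
by move=> x /=; rewrite !in_itv/= => /andP[/ltW -> ->].
Qed.

Lemma itg_approx g a b K e : continuous g -> a <= b ->
  (forall x, a <= x <= b -> `|g x - K| <= e) ->
  `|itg g a b - K * (b - a)| <= e * (b - a).
Proof.
move=> cg ab ge.
have fab : fine (mu `[a, b]) = b - a.
  by rewrite lebesgue_measure_itv/= lte_fin; case: ltgtP ab => // -> _; rewrite subrr.
have ci (c : R) : mu.-integrable `[a, b] (EFin \o cst c).
  by apply: integrable_segment; exact: cst_continuous.
have cst_int c : \int[mu]_(x in `[a, b]) c = c * (b - a).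
  by rewrite Rintegral_cst// fab.
rewrite -cst_int -RintegralB//; [|exact: integrable_segment|exact: ci].
have cgK : continuous (fun x => g x - K).
  by move=> x; apply: cvgB; [exact: cg|exact: cvg_cst].
apply: (le_trans (le_normr_Rintegral _ _)) => //.
  exact: integrable_segment.
rewrite -cst_int; apply: le_Rintegral => //.
- apply: integrable_segment => x; apply: cvg_norm; exact: cgK.
- exact: ci.
Qed.

End segment_integral.

(** * Goursat's theorem on rectangles *)

Section goursat.
Variable R : realType.
Implicit Types P Q : R -> R -> R.

(** For f = P + iQ the same number [A] serves as P_x and as Q_y. This is the Cauchy-Riemann equation
    that makes the form Im (f dz) = P dy + Q dx closed. *)
Definition cr_differentiable P Q := forall x0 y0, exists A B C, forall e, 0 < e ->
  exists2 d, 0 < d & forall x y, `|x - x0| <= d -> `|y - y0| <= d ->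
    `|P x y - P x0 y0 - A * (x - x0) - B * (y - y0)| <= e * (`|x - x0| + `|y - y0|) /\
    `|Q x y - Q x0 y0 - C * (x - x0) - A * (y - y0)| <= e * (`|x - x0| + `|y - y0|).

Variables P Q : R -> R -> R.
Hypothesis PQ : cr_differentiable P Q.

Lemma cr_continuous_r x0 : continuous (P x0).
Proof.
move=> y0; have [A [B [C H]]] := PQ x0 y0; apply/cvgrPdist_le => e e0.
have [d d0 Hd] := H 1 ltr01.
near=> y.
have y0d : `|y - y0| <= d by rewrite distrC; near: y; apply: cvgr_dist_le d0.
have ye : `|y - y0| <= e / (1 + `|B|).
  rewrite distrC; near: y.
  by apply: cvgr_dist_le => //; rewrite divr_gt0// ltr_pwDl.
have [] := Hd x0 y; rewrite ?subrr ?normr0 ?(ltW d0)// add0r mulr0 subr0 mul1r => h _.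
rewrite distrC; have -> : P x0 y - P x0 y0 =
  (P x0 y - P x0 y0 - B * (y - y0)) + B * (y - y0) by ring.
apply: le_trans (ler_normD _ _) _; rewrite normrM.
move: ye; rewrite ler_pdivlMr ?ltr_pwDl// mulrDr mulr1 => ye.
by apply: le_trans ye; rewrite lerD// mulrC.
Unshelve. all: by end_near. Qed.

Let cQx y0 : continuous (Q^~ y0).
Proof.
move=> x0; have [A [B [C H]]] := PQ x0 y0; apply/cvgrPdist_le => e e0.
have [d d0 Hd] := H 1 ltr01.
near=> x.
have x0d : `|x - x0| <= d by rewrite distrC; near: x; apply: cvgr_dist_le d0.
have xe : `|x - x0| <= e / (1 + `|C|).
  rewrite distrC; near: x.
  by apply: cvgr_dist_le => //; rewrite divr_gt0// ltr_pwDl.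
have [] := Hd x y0; rewrite ?subrr ?normr0 ?(ltW d0)// => _.
rewrite addr0 mulr0 subr0 mul1r => h.
rewrite distrC; have -> : Q x y0 - Q x0 y0 =
  (Q x y0 - Q x0 y0 - C * (x - x0)) + C * (x - x0) by ring.
apply: le_trans (ler_normD _ _) _; rewrite normrM.
move: xe; rewrite ler_pdivlMr ?ltr_pwDl// mulrDr mulr1 => xe.
by apply: le_trans xe; rewrite lerD// mulrC.
Unshelve. all: by end_near. Qed.

(** The integral of P dy + Q dx counterclockwise around the rectangle; it is additive when the
    rectangle is cut. *)
Let Phi a b c d : R :=
  itg (P b) c d - itg (P a) c d - (itg (Q^~ d) a b - itg (Q^~ c) a b).

Let PhiDx a x b c d : a <= x -> x <= b ->
  Phi a b c d = Phi a x c d + Phi x b c d.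
Proof.
move=> ax xb; rewrite /Phi (itg_split (@cQx d) ax xb) (itg_split (@cQx c) ax xb).
by ring.
Qed.

Let PhiDy a b c y d : c <= y -> y <= d ->
  Phi a b c d = Phi a b c y + Phi a b y d.
Proof.
move=> cy yd; rewrite /Phi (itg_split (@cr_continuous_r a) cy yd) (itg_split (@cr_continuous_r b) cy yd).
by ring.
Qed.

(** The affine parts of P and Q contribute A times the area to each of the two differences of
    integrals, so they cancel; what remains is e times a side length, integrated over a side. *)
Let Phi_small x0 y0 e : 0 < e -> exists2 d, 0 < d & forall a b c d',
  a <= x0 <= b -> c <= y0 <= d' -> b - a <= d -> d' - c <= d ->
  `|Phi a b c d'| <= e * ((b - a) + (d' - c)) ^+ 2.
Proof.
move=> e0; have [A [B [C H]]] := PQ x0 y0.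
have e20 : 0 < e / 2 by rewrite divr_gt0.
have [d d0 Hd] := H _ e20.
exists d => // a b c d' /andP[ax xb] /andP[cy yd] bad dcd.
have ab := le_trans ax xb; have cd := le_trans cy yd.
set s := b - a + (d' - c).
have near_x x : a <= x <= b -> `|x - x0| <= b - a.
  by move=> /andP[ax' xb']; rewrite ler_norml; apply/andP; split; lra.
have near_y y : c <= y <= d' -> `|y - y0| <= d' - c.
  by move=> /andP[ax' xb']; rewrite ler_norml; apply/andP; split; lra.
have Hxy x y : a <= x <= b -> c <= y <= d' ->
    `|P x y - P x0 y0 - A * (x - x0) - B * (y - y0)| <= e / 2 * s /\
    `|Q x y - Q x0 y0 - C * (x - x0) - A * (y - y0)| <= e / 2 * s.
  move=> hx hy; have /near_x nx := hx; have /near_y ny := hy.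
  have [h1 h2] := Hd x y (le_trans nx bad) (le_trans ny dcd).
  have es : e / 2 * (`|x - x0| + `|y - y0|) <= e / 2 * s.
    by rewrite ler_pM2l ?divr_gt0// lerD.
  by split; [exact: le_trans h1 es|exact: le_trans h2 es].
have aI : a <= a <= b by rewrite lexx.
have bI : a <= b <= b by rewrite lexx andbT.
have cI : c <= c <= d' by rewrite lexx.
have dI : c <= d' <= d' by rewrite lexx andbT.
have sub2 (u v w : R) : `|u| <= e / 2 * s -> `|v| <= e / 2 * s -> w = u - v -> `|w| <= e * s.
  move=> hu hv ->; apply: le_trans (ler_normB _ _) _.
  by apply: le_trans (lerD hu hv) _; rewrite -mulrDl -splitr.
have E1 : `|itg (fun y => P b y - P a y) c d' - A * (b - a) * (d' - c)| <= e * s * (d' - c).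
  apply: itg_approx => //.
    by move=> y; apply: cvgB; exact: cr_continuous_r.
  move=> y hy; apply: sub2 (Hxy b y bI hy).1 (Hxy a y aI hy).1 _; ring.
have E2 : `|itg (fun x => Q x d' - Q x c) a b - A * (d' - c) * (b - a)| <= e * s * (b - a).
  apply: itg_approx => //.
    by move=> y; apply: cvgB; exact: cQx.
  move=> x hx; apply: sub2 (Hxy x d' hx dI).2 (Hxy x c hx cI).2 _; ring.
move: E1 E2; rewrite /itg RintegralB//; [|exact: (integrable_segment _ _ (@cr_continuous_r _))..].
rewrite RintegralB//; [|exact: (integrable_segment _ _ (@cQx _))..].
rewrite -!/(itg _ _ _) => E1 E2.
set i1 := itg (P b) c d' - itg (P a) c d' in E1; set i2 := itg (Q^~ d') a b - itg (Q^~ c) a b in E2.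
have -> : Phi a b c d' = (i1 - A * (b - a) * (d' - c)) - (i2 - A * (d' - c) * (b - a)).
  by rewrite /Phi -/i1 -/i2; ring.
apply: le_trans (ler_normB _ _) _; apply: le_trans (lerD E1 E2) _.
by rewrite -mulrDr -mulrA ler_pM2l// [d' - c + _]addrC -expr2.
Qed.

(** Bisection: some quarter of each rectangle carries at least a quarter of its |Phi|, and the
    nested rectangles shrink to a point where [Phi_small] contradicts this. *)
Lemma goursat a b c d : a <= b -> c <= d ->
  itg (P b) c d - itg (P a) c d = itg (Q^~ d) a b - itg (Q^~ c) a b.
Proof.
move=> ab cd; apply/eqP; rewrite -subr_eq0 -/(Phi a b c d); apply/negPn/negP => Phi0.
pose l n := (b - a) / 2 ^+ n; pose m n := (d - c) / 2 ^+ n.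
have lS n : l n = l n.+1 + l n.+1.
  by rewrite /l exprS invfM [2^-1 * _]mulrC mulrA -splitr.
have mS n : m n = m n.+1 + m n.+1.
  by rewrite /m exprS invfM [2^-1 * _]mulrC mulrA -splitr.
have l0 n : 0 <= l n by rewrite divr_ge0// ?subr_ge0// exprn_ge0.
have m0 n : 0 <= m n by rewrite divr_ge0// ?subr_ge0// exprn_ge0.
pose F n (s : R * R) := `|Phi s.1 (s.1 + l n) s.2 (s.2 + m n)|.
pose bad (t : nat * (R * R)) := `|Phi a b c d| / 4 ^+ t.1 <= F t.1 t.2.
(* Four small quarters would make the whole small by additivity. The conclusion is conditional on
   [bad t], so that the relation is total, as dependent choice requires. *)
have step (t : nat * (R * R)) : {t' | bad t ->
  [/\ bad t', t'.1 = t.1.+1, t.2.1 <= t'.2.1 <= t.2.1 + l t.1.+1 &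
     t.2.2 <= t'.2.2 <= t.2.2 + m t.1.+1]}.
  apply: cid; case: t => n [x y] /=; apply/not_existsP => H.
  have small i j : i <= l n.+1 -> j <= m n.+1 -> 0 <= i -> 0 <= j ->
      bad (n, (x, y)) /\ F n.+1 (x + i, y + j) < `|Phi a b c d| / 4 ^+ n.+1.
    move=> il jm i0 j0; have := H (n.+1, (x + i, y + j)) => /not_implyP [bn /=].
    rewrite !lerD2l !lerDl il jm i0 j0 /bad/= => h; split => //.
    by rewrite ltNge; apply/negP => hl; apply: h; split.
  have [bn h1] := small _ _ (l0 _) (m0 _) (lexx _) (lexx _).
  have [_ h2] := small _ _ (lexx _) (m0 _) (l0 _) (lexx _).
  have [_ h3] := small _ _ (l0 _) (lexx _) (lexx _) (m0 _).
  have [_ h4] := small _ _ (lexx _) (lexx _) (l0 _) (m0 _).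
  move: bn; rewrite /bad /= leNgt => /negP; apply.
  move: h1 h2 h3 h4; rewrite /F /= !addr0 => h1 h2 h3 h4.
  rewrite (@PhiDx x (x + l n.+1)); [|by rewrite lerDl|by rewrite (lS n) lerD2l lerDl].
  rewrite (@PhiDy x _ y (y + m n.+1)); [|by rewrite lerDl|by rewrite (mS n) lerD2l lerDl].
  rewrite (@PhiDy (x + l n.+1) _ y (y + m n.+1)); [|by rewrite lerDl|by rewrite (mS n) lerD2l lerDl].
  have norm4 (t u1 u2 u3 u4 : R) : `|u1| < t -> `|u2| < t -> `|u3| < t -> `|u4| < t ->
      `|u1 + u2 + (u3 + u4)| < t + t + (t + t).
    move=> k1 k2 k3 k4; apply: le_lt_trans (ler_normD _ _) _.
    by apply: ltrD; apply: le_lt_trans (ler_normD _ _) _; exact: ltrD.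
  have -> : `|Phi a b c d| / 4 ^+ n = `|Phi a b c d| / 4 ^+ n.+1 + `|Phi a b c d| / 4 ^+ n.+1
      + (`|Phi a b c d| / 4 ^+ n.+1 + `|Phi a b c d| / 4 ^+ n.+1).
    by rewrite exprS invfM; field; rewrite expf_neq0.
  by rewrite (lS n) (mS n) (addrA x) (addrA y); exact: norm4 h1 h3 h2 h4.
pose Rel (t t' : nat * (R * R)) := bad t ->
  [/\ bad t', t'.1 = t.1.+1, t.2.1 <= t'.2.1 <= t.2.1 + l t.1.+1 &
     t.2.2 <= t'.2.2 <= t.2.2 + m t.1.+1].
have [f [f0 fS]] := @dependent_choice _ Rel step (0%N, (a, c)).
have fbad n : bad (f n) /\ (f n).1 = n.
  elim: n => [|n [bn fn]].
    rewrite f0; split => //; rewrite /bad /F /= expr0 divr1 /l /m expr0 !divr1.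
    by rewrite [a + _]addrC subrK [c + _]addrC subrK.
  by have [-> -> _ _] := fS n bn; rewrite fn.
have fx n : (f n).2.1 <= (f n.+1).2.1 <= (f n).2.1 + l n.+1.
  by have [bn fn] := fbad n; have [_ _] := fS n bn; rewrite fn.
have fy n : (f n).2.2 <= (f n.+1).2.2 <= (f n).2.2 + m n.+1.
  by have [bn fn] := fbad n; have [_ _] := fS n bn; rewrite fn.
have nested (u : nat -> R) (w : nat -> R) :
    (forall n, u n <= u n.+1 <= u n + w n.+1) -> (forall n, w n = w n.+1 + w n.+1) ->
    (forall n, 0 <= w n) -> exists z, forall n, u n <= z <= u n + w n.
  move=> hu hw w0.
  have u1 n k : u n <= u (n + k)%N.
    elim: k => [|k IH]; rewrite ?addn0// addnS; apply: le_trans IH _.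
    by have /andP[] := hu (n + k)%N.
  have u2 n k : u (n + k)%N + w (n + k)%N <= u n + w n.
    elim: k => [|k IH]; rewrite ?addn0// addnS; apply: le_trans IH.
    have /andP[_ h] := hu (n + k)%N; rewrite (hw (n + k)%N) addrA lerD2r//.
  have ub n k : u k <= u n + w n.
    have [nk|/ltnW kn] := leqP n k.
      by rewrite -(subnKC nk); apply: le_trans (u2 n (k - n)%N); rewrite lerDl.
    by rewrite -(subnKC kn); apply: le_trans (u1 k (n - k)%N) _; rewrite lerDl.
  exists (sup (range u)) => n; apply/andP; split.
    apply: ub_le_sup; last by exists n.
    by exists (u 0%N + w 0%N) => _ [k _ <-].
  apply: ge_sup; first by exists (u 0%N), 0%N.
  by move=> _ [k _ <-].
have [x0 hx0] := nested (fun n => (f n).2.1) l fx lS l0.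
have [y0 hy0] := nested (fun n => (f n).2.2) m fy mS m0.
pose s := (b - a) + (d - c).
have s0 : 0 <= s by rewrite addr_ge0// subr_ge0.
(* For this value, e times the square s^2 / 4^n of the n-th half-perimeter stays strictly below
   |Phi| / 4^n. *)
have e0 : 0 < `|Phi a b c d| / (2 * (1 + s ^+ 2)).
  by rewrite divr_gt0 ?normr_gt0// mulr_gt0// ltr_pwDl// exprn_ge0.
have [dl dl0 Hd] := Phi_small x0 y0 e0.
have small_n : \forall n \near \oo, s / 2 ^+ n <= dl.
  have : (fun n => s / 2 ^+ n) @ \oo --> 0.
    under eq_fun do rewrite -exprVn.
    rewrite -(mulr0 s); apply: cvgMr; apply: cvg_expr.
    by rewrite ger0_norm ?invf_lt1 ?ltr1n ?invr_ge0.
  move=> /cvgrPdist_le /(_ _ dl0); apply: filterS => n; rewrite sub0r normrN.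
  by apply: le_trans; rewrite ler_norm.
have [n _ /(_ n (leqnn n)) /= sn] := small_n.
have [bn fn] := fbad n.
have := bn; rewrite /bad /F fn leNgt => /negP; apply.
have ln_s : l n <= dl.
  by apply: le_trans sn; rewrite /l ler_pM2r ?invr_gt0 ?exprn_gt0// lerDl subr_ge0.
have mn_s : m n <= dl.
  by apply: le_trans sn; rewrite /m ler_pM2r ?invr_gt0 ?exprn_gt0// lerDr subr_ge0.
have aKl (u w : R) : u + w - u = w by ring.
have := Hd _ _ _ _ (hx0 n) (hy0 n); rewrite !aKl => /(_ ln_s mn_s) Hn.
apply: le_lt_trans Hn _.
have -> : l n + m n = s / 2 ^+ n by rewrite /l /m /s -mulrDl.
rewrite expr_div_n -exprM mulnC exprM -[2 ^+ 2]natrX.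
rewrite mulrA ltr_pM2r ?invr_gt0 ?exprn_gt0// -mulrA gtr_pMr ?normr_gt0//.
rewrite mulrC ltr_pdivrMr ?mul1r; first by have := sqr_ge0 s; lra.
by rewrite mulr_gt0// ltr_pwDl// sqr_ge0.
Qed.

End goursat.

(** * Moduli, components and limits of complex numbers *)

Section complex_basics.
Variable R : realType.
Notation C := R[i].
Implicit Types z w : C.

Lemma normc_ge0 z : 0 <= normc z.
Proof. by case: z => a b; exact: sqrtr_ge0. Qed.

Lemma sqr_normc_ReIm z : normc z ^+ 2 = complex.Re z ^+ 2 + complex.Im z ^+ 2.
Proof. by case: z => a b /=; rewrite sqr_sqrtr// addr_ge0 ?sqr_ge0. Qed.

Lemma normrE_normc z : `|z| = (normc z)%:C.
Proof. by []. Qed.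

Lemma normc_real (x : R) : normc x%:C = `|x|.
Proof. by rewrite /= expr0n addr0 sqrtr_sqr. Qed.

Lemma normc_conj z : normc z^* = normc z.
Proof. by case: z => a b /=; rewrite sqrrN. Qed.

Lemma normcX z n : normc (z ^+ n) = normc z ^+ n.
Proof.
elim: n => [|n IH]; first by rewrite !expr0; exact: normc1.
by rewrite !exprS normcM IH.
Qed.

Lemma Re_le_normc z : `|complex.Re z| <= normc z.
Proof.
rewrite -ler_sqr ?nnegrE ?normc_ge0// sqr_normc_ReIm real_normK ?num_real//.
by rewrite lerDl sqr_ge0.
Qed.

Lemma Im_le_normc z : `|complex.Im z| <= normc z.
Proof.
rewrite -ler_sqr ?nnegrE ?normc_ge0// sqr_normc_ReIm real_normK ?num_real//.
by rewrite lerDr sqr_ge0.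
Qed.

Lemma normc_le_ReIm z : normc z <= `|complex.Re z| + `|complex.Im z|.
Proof.
rewrite -ler_sqr ?nnegrE ?normc_ge0 ?addr_ge0// sqr_normc_ReIm sqrrD !real_normK ?num_real//.
by rewrite addrAC lerDl mulrn_wge0// mulr_ge0.
Qed.

Lemma mulc_conj z : z * z^* = (normc z ^+ 2)%:C.
Proof. by rewrite -sqr_normc rmorphXn. Qed.

Lemma normc_sum (I : Type) (r : seq I) (P : pred I) (F : I -> C) :
  normc (\sum_(i <- r | P i) F i) <= \sum_(i <- r | P i) normc (F i).
Proof.
elim/big_ind2 : _ => [|x y x' y' h1 h2|//]; first by rewrite normc0.
by apply: le_trans (le_normcD _ _) _; exact: lerD.
Qed.

Lemma le_normcB z w : normc (z - w) <= normc z + normc w.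
Proof. by rewrite -(normcN w); exact: le_normcD. Qed.

Lemma normc_distC z w : normc (z - w) = normc (w - z).
Proof. by rewrite -normcN opprB. Qed.

Lemma ReD z w : complex.Re (z + w) = complex.Re z + complex.Re w.
Proof. by case: z; case: w. Qed.
Lemma ImD z w : complex.Im (z + w) = complex.Im z + complex.Im w.
Proof. by case: z; case: w. Qed.
Lemma ReN z : complex.Re (- z) = - complex.Re z. Proof. by case: z. Qed.
Lemma ImN z : complex.Im (- z) = - complex.Im z. Proof. by case: z. Qed.
Lemma ReM z w : complex.Re (z * w) = complex.Re z * complex.Re w - complex.Im z * complex.Im w.
Proof. by case: z; case: w. Qed.
Lemma ImM z w : complex.Im (z * w) = complex.Re z * complex.Im w + complex.Im z * complex.Re w.
Proof. by case: z => a b; case: w => c d /=; rewrite addrC. Qed.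
Lemma Re_conj z : complex.Re z^* = complex.Re z. Proof. by case: z. Qed.
Lemma Im_conj z : complex.Im z^* = - complex.Im z. Proof. by case: z. Qed.

Definition ReImE := (ReD, ImD, ReN, ImN, ReM, ImM, Re_conj, Im_conj).

Lemma complex_eq z w : complex.Re z = complex.Re w -> complex.Im z = complex.Im w -> z = w.
Proof. by case: z => a b; case: w => c d /= -> ->. Qed.

(** Convergence measured by the real number [normc], so that epsilons and bounds stay in [R] rather
    than in the partial order of [R[i]]. *)
Definition ctends (u : nat -> C) (l : C) :=
  forall e, 0 < e -> \forall n \near \oo, normc (u n - l) <= e.

Lemma ctends_ReIm (u : nat -> C) l : 
  ((fun n => complex.Re (u n)) @ \oo --> complex.Re l) ->
  ((fun n => complex.Im (u n)) @ \oo --> complex.Im l) -> ctends u l.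
Proof.
move=> h1 h2 e e0; have e20 : 0 < e / 2 by rewrite divr_gt0.
near=> n; apply: le_trans (normc_le_ReIm _) _.
rewrite [e]splitr !ReImE; apply: lerD; rewrite distrC; near: n; exact: cvgr_dist_le.
Unshelve. all: by end_near. Qed.

Lemma ctends_Re (u : nat -> C) l : ctends u l -> (fun n => complex.Re (u n)) @ \oo --> complex.Re l.
Proof.
move=> h; apply/cvgrPdist_le => e /h; apply: filterS => n.
by apply: le_trans; rewrite distrC -ReN -ReD; exact: Re_le_normc.
Qed.

Lemma ctends_Im (u : nat -> C) l : ctends u l -> (fun n => complex.Im (u n)) @ \oo --> complex.Im l.
Proof.
move=> h; apply/cvgrPdist_le => e /h; apply: filterS => n.
by apply: le_trans; rewrite distrC -ImN -ImD; exact: Im_le_normc.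
Qed.

Lemma ctends_cauchy (u : nat -> C) :
  (forall e, 0 < e -> \forall N \near \oo, forall m n, (N <= m <= n)%N -> normc (u n - u m) <= e) ->
  exists l, ctends u l.
Proof.
move=> H.
have cau (f : C -> R) : (forall z w, `|f z - f w| <= normc (z - w)) -> cvgn (f \o u).
  move=> hf; apply/cauchy_cvgP/cauchy_exP => e e0.
  have e20 : 0 < e / 2 by rewrite divr_gt0.
  have [N _ /(_ N (leqnn N)) HN] := H _ e20.
  exists (f (u N)); exists N => // n /= Nn; rewrite /ball/= distrC.
  apply: le_lt_trans (hf _ _) _; apply: le_lt_trans (HN N n _) _; first by rewrite leqnn.
  by rewrite ltr_pdivrMr// ltr_pMr// ltr1n.
exists (limn (fun n => complex.Re (u n)) +i* limn (fun n => complex.Im (u n))).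
apply: ctends_ReIm.
  by apply: (cau (@complex.Re R)) => z w; rewrite -ReN -ReD; exact: Re_le_normc.
by apply: (cau (@complex.Im R)) => z w; rewrite -ImN -ImD; exact: Im_le_normc.
Qed.

Lemma ctends_unique u (l l' : C) : ctends u l -> ctends u l' -> l = l'.
Proof.
move=> h h'; apply: complex_eq.
  exact: (cvg_unique _ (ctends_Re h) (ctends_Re h')).
exact: (cvg_unique _ (ctends_Im h) (ctends_Im h')).
Qed.

Lemma ctends_le u (l : C) (B : R) : ctends u l -> (\forall n \near \oo, normc (u n) <= B) -> normc l <= B.
Proof.
move=> h hB; apply/ler_addgt0Pl => e e0.
have [n [h1 h2]] : exists n, normc (u n - l) <= e /\ normc (u n) <= B.
  have [N _ /(_ N (leqnn N))] : \forall n \near \oo, normc (u n - l) <= e /\ normc (u n) <= B.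
    by near=> n; split; near: n => //; exact: h.
  by exists N.
have -> : l = (l - u n) + u n by rewrite subrK.
by apply: le_trans (le_normcD _ _) _; rewrite normc_distC lerD.
Unshelve. all: by end_near. Qed.

Lemma ctendsD u v (l k : C) : ctends u l -> ctends v k -> ctends (fun n => u n + v n) (l + k).
Proof.
move=> hu hv e e0; have e20 : 0 < e / 2 by rewrite divr_gt0.
near=> n; rewrite opprD addrACA; apply: le_trans (le_normcD _ _) _.
by rewrite [e]splitr lerD//; near: n; [exact: hu|exact: hv].
Unshelve. all: by end_near. Qed.

Lemma ctendsMl u (c l : C) : ctends u l -> ctends (fun n => c * u n) (c * l).
Proof.
move=> hu e e0; have d0 : 0 < e / (1 + normc c) by rewrite divr_gt0// ltr_pwDl// normc_ge0.
apply: filterS (hu _ d0) => n h; rewrite -mulrBr normcM.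
apply: le_trans (ler_wpM2l (normc_ge0 c) h) _.
rewrite mulrCA ler_piMr ?(ltW e0)// ler_pdivrMr ?mul1r ?lerDr//.
by rewrite ltr_pwDl// normc_ge0.
Qed.

Lemma ctends_cst (c : C) : ctends (fun=> c) c.
Proof. by move=> e e0; near=> n; rewrite subrr normc0 ltW. Unshelve. all: by end_near. Qed.

Lemma ctends_sub u v (l k : C) : ctends u l -> ctends v k -> ctends (fun n => u n - v n) (l - k).
Proof.
move=> hu hv; rewrite (_ : (fun n => u n - v n) = (fun n => u n + -1 * v n)).
  by have := ctendsD hu (ctendsMl (-1) hv); rewrite [-1 * k]mulN1r.
by apply/funext => n; rewrite mulN1r.
Qed.

End complex_basics.

(** * Entire functions in epsilon-delta form *)

Section entire.
Variable R : realType.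
Notation C := R[i].
Implicit Types f g : C -> C.

(** The topology of [R[i]] quantifies over positive elements of [R[i]]. Such an element has
    imaginary part 0, so its real part serves as an ordinary epsilon or delta. *)
Lemma entireP f : entire f <-> forall z, exists A : C, forall e, 0 < e ->
  exists2 d, 0 < d & forall h, normc h <= d -> normc (f (z + h) - f z - A * h) <= e * normc h.
Proof.
split=> [ef z|H z].
  have /cvg_ex[A /cvgrPdist_le hA] := ef z; exists A => e e0.
  have ec : (0 : R[i]^o) < (e%:C : R[i]^o) by rewrite ltcR.
  have := hA _ ec; rewrite near_withinE => /nbhs_ballP[d' /= d'0 Hd].
  have d'E : d' = (complex.Re d')%:C by move: d'0; case: (d') => a b; rewrite ltcE/= => /andP[/eqP-> _].
  have d0 : 0 < complex.Re d' by move: d'0; rewrite d'E ltcR.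
  exists (complex.Re d' / 2); first by rewrite divr_gt0.
  move=> h hd; have [->|h0] := eqVneq h 0.
    by rewrite addr0 subrr mulr0 subr0 normc0 mulr0.
  have := Hd h; rewrite /ball/= sub0r normrN => /(_ _ h0).
  have hlt : `|h| < d'.
    by rewrite d'E normrE_normc ltcR; apply: le_lt_trans hd _; rewrite ltr_pdivrMr// ltr_pMr// ltr1n.
  move=> /(_ hlt); rewrite normrE_normc lecR => h1.
  have n0 : normc h != 0 by apply: contra h0 => /eqP/eq0_normc ->.
  rewrite -ler_pdivrMr ?lt0r ?n0 ?normc_ge0// -normcV -normcM.
  apply: le_trans h1; rewrite normc_distC le_eqVlt; apply/orP; left; apply/eqP; congr normc.
  rewrite mulrBl mulfK// [h *: 1]mulr1 [h + z]addrC.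
  by rewrite [_ *: _]mulrC.
have [A HA] := H z; apply/cvg_ex; exists A; apply/cvgrPdist_le => e' e'0.
have e'E : e' = (complex.Re e')%:C by move: e'0; case: (e') => a b; rewrite ltcE/= => /andP[/eqP-> _].
have e0 : 0 < complex.Re e' by move: e'0; rewrite e'E ltcR.
have [d d0 Hd] := HA _ e0.
rewrite near_withinE; apply/nbhs_ballP; exists (d%:C); first by rewrite /= ltcR.
move=> h /=; rewrite /ball/= sub0r normrN normrE_normc ltcR => /ltW hd h0.
have n0 : normc h != 0 by apply: contra h0 => /eqP/eq0_normc ->.
rewrite e'E normrE_normc lecR.
have := Hd _ hd; rewrite -ler_pdivrMr ?lt0r ?n0 ?normc_ge0// -normcV -normcM.
apply: le_trans; rewrite normc_distC le_eqVlt; apply/orP; left; apply/eqP; congr normc.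
rewrite mulrBl mulfK// [h *: 1]mulr1 [h + z]addrC.
by rewrite [_ *: _]mulrC.
Qed.

Lemma entire_comp f g : entire f -> entire g -> entire (f \o g).
Proof.
move=> ef eg z; apply/(@derivable1_diffP _ R[i]^o).
apply: (@differentiable_comp _ R[i]^o R[i]^o R[i]^o).
  by apply/(@derivable1_diffP _ R[i]^o); exact: eg.
by apply/(@derivable1_diffP _ R[i]^o); exact: ef.
Qed.

Lemma entireM f g : entire f -> entire g -> entire (fun z => f z * g z).
Proof. by move=> ef eg z; apply: (@derivableM _ R[i]^o). Qed.

Lemma entireD f g : entire f -> entire g -> entire (fun z => f z + g z).
Proof. by move=> ef eg z; apply: (@derivableD _ R[i]^o R[i]^o). Qed.

Lemma entire_cst (c : C) : entire (fun=> c).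
Proof. by move=> z; exact: (@derivable_cst _ R[i]^o R[i]^o). Qed.

Lemma entire_id : entire (fun z : C => z).
Proof. by move=> z; exact: (@derivable_id _ R[i]^o). Qed.

Lemma entireX f n : entire f -> entire (fun z => f z ^+ n).
Proof.
move=> ef; elim: n => [|n IH]; first exact: entire_cst.
rewrite (_ : (fun _ => _) = fun z => f z * f z ^+ n); first exact: entireM.
by apply/funext => z; rewrite exprS.
Qed.

Lemma entire_sum (I : Type) (r : seq I) (F : I -> C -> C) :
  (forall i, entire (F i)) -> entire (fun z => \sum_(i <- r) F i z).
Proof.
move=> eF; elim: r => [|i r IH].
  by rewrite (_ : (fun _ => _) = cst 0); [exact: entire_cst|apply/funext => z; rewrite big_nil].
rewrite (_ : (fun _ => _) = fun z => F i z + \sum_(j <- r) F j z); first exact: (entireD (eF i) IH).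
by apply/funext => z; rewrite big_cons.
Qed.

Lemma entire_continuous f z : entire f -> forall e, 0 < e ->
  exists2 d, 0 < d & forall h, normc h <= d -> normc (f (z + h) - f z) <= e.
Proof.
move=> /entireP/(_ z)[A HA] e e0; have [d d0 Hd] := HA 1 ltr01.
have k0 : 0 < 1 + normc A by rewrite ltr_pwDl// normc_ge0.
exists (Num.min d (e / (1 + normc A))); first by rewrite lt_min d0 divr_gt0.
move=> h; rewrite le_min => /andP[hd he].
have -> : f (z + h) - f z = (f (z + h) - f z - A * h) + A * h by rewrite subrK.
apply: le_trans (le_normcD _ _) _; apply: le_trans (lerD (Hd h hd) (lexx _)) _.
rewrite normcM -mulrDl -ler_pdivlMl// mulrC//.
Qed.

End entire.

(** * The complex exponential and its Taylor remainders *)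

Section cexp.
Variable R : realType.
Notation C := R[i].
Implicit Types z w : C.

Definition cexp z : C :=
  (expR (complex.Re z) * cos (complex.Im z)) +i* (expR (complex.Re z) * sin (complex.Im z)).

Lemma cexpD z w : cexp (z + w) = cexp z * cexp w.
Proof.
case: z => a b; case: w => c d; apply: complex_eq => /=; rewrite expRD ?cosD ?sinD; ring.
Qed.

Lemma cexp0 : cexp 0 = 1.
Proof. by apply: complex_eq => /=; rewrite ?expR0 ?cos0 ?sin0 ?mul1r ?mulr0. Qed.

Lemma normc_cexp z : normc (cexp z) = expR (complex.Re z).
Proof.
apply/eqP; rewrite -(@eqrXn2 _ 2) ?normc_ge0 ?expR_ge0//; apply/eqP.
by rewrite sqr_normc_ReIm /= !exprMn -mulrDr cos2Dsin2 mulr1.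
Qed.

Lemma normc_cexp_le z : normc (cexp z) <= expR (normc z).
Proof.
by rewrite normc_cexp ler_expR; apply: le_trans (Re_le_normc z); exact: ler_norm.
Qed.

Definition cder (r r' : R -> C) := forall t : R,
  is_derive t (1 : R) (fun s : R => complex.Re (r s) : R) (complex.Re (r' t)) /\
  is_derive t (1 : R) (fun s : R => complex.Im (r s) : R) (complex.Im (r' t)).

Lemma cder_cst (c : C) : cder (fun=> c) (fun=> 0).
Proof. by move=> t; split; exact: is_derive_cst. Qed.

Lemma cderD f f' g g' : cder f f' -> cder g g' ->
  cder (fun t => f t + g t) (fun t => f' t + g' t).
Proof.
move=> hf hg t; have [f1 f2] := hf t; have [g1 g2] := hg t; rewrite !ReImE.
split.
  by under eq_fun do rewrite ReD; exact: is_deriveD.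
by under eq_fun do rewrite ImD; exact: is_deriveD.
Qed.

Lemma cderN f f' : cder f f' -> cder (fun t => - f t) (fun t => - f' t).
Proof.
move=> hf t; have [f1 f2] := hf t; rewrite !ReImE.
split.
  by under eq_fun do rewrite ReN; exact: is_deriveN.
by under eq_fun do rewrite ImN; exact: is_deriveN.
Qed.

Lemma cderMl f f' (c : C) : cder f f' -> cder (fun t => c * f t) (fun t => c * f' t).
Proof.
move=> hf t; have [f1 f2] := hf t; rewrite !ReImE.
split.
  under eq_fun do rewrite ReM.
  by apply: is_deriveB; apply: is_deriveZ.
under eq_fun do rewrite ImM.
by apply: is_deriveD; apply: is_deriveZ.
Qed.

Lemma cder_monomial (c : C) n : cder (fun t => c * (t ^+ n)%:C) (fun t => c * (n%:R * t ^+ n.-1)%:C).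
Proof.
apply: cderMl => t; split; last exact: is_derive_cst.
have := @is_deriveX R R (fun x => x) n t 1 1 (is_derive_id _ _).
rewrite [_ *: 1]mulr1 /=; congr (is_derive _ _ _ _).
by apply/funext => s; elim: n => //= n IH; rewrite !exprS -IH.
Qed.

Lemma cder_cexp (z : C) : cder (fun t => cexp (t%:C * z)) (fun t => z * cexp (t%:C * z)).
Proof.
case: z => a b t; rewrite !ReImE /=.
have lin (c : R) : is_derive t (1 : R) (fun s : R => c * s : R) c.
  by rewrite -[X in is_derive _ _ _ X]mulr1; apply: is_deriveZ.
have dE : is_derive t (1 : R) (fun s : R => expR (a * s) : R) (expR (a * t) * a).
  exact: (@is_derive1_comp _ expR (fun s => a * s)).
have dC : is_derive t (1 : R) (fun s : R => cos (b * s) : R) (- sin (b * t) * b).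
  exact: (@is_derive1_comp _ cos (fun s => b * s)).
have dS : is_derive t (1 : R) (fun s : R => sin (b * s) : R) (cos (b * t) * b).
  exact: (@is_derive1_comp _ sin (fun s => b * s)).
have -> : (fun s : R => expR (s * a - 0 * b) * cos (s * b + 0 * a)) =
    (fun s => expR (a * s)) * (fun s => cos (b * s)).
  by apply/funext => s; rewrite !mul0r subr0 addr0 ![s * _]mulrC.
have -> : (fun s : R => expR (s * a - 0 * b) * sin (s * b + 0 * a)) =
    (fun s => expR (a * s)) * (fun s => sin (b * s)).
  by apply/funext => s; rewrite !mul0r subr0 addr0 ![s * _]mulrC.
rewrite !mul0r subr0 addr0 ![t * _]mulrC.
by split; apply: is_derive_eq; rewrite /GRing.scale/=; ring.
Qed.

Lemma derive_le_01 (f g f' g' : R -> R) :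
  (forall t : R, is_derive t (1 : R) f (f' t)) -> (forall t : R, is_derive t (1 : R) g (g' t)) ->
  (forall t, 0 <= t <= 1 -> f' t <= g' t) -> f 0 <= g 0 -> forall t, 0 <= t <= 1 -> f t <= g t.
Proof.
move=> df dg fg fg0 t /andP[t0 t1].
have dh s : is_derive (s : R) (1 : R) (g - f) (g' s - f' s) by exact: is_deriveB.
have : (g - f) 0 <= (g - f) t.
  apply: (@ger0_derive1_le_cc _ _ 0 1) => //.
  - move=> s; rewrite in_itv/= => /andP[s0 s1]; rewrite derive1E.
    by have [_ ->] := dh s; rewrite subr_ge0 fg// !ltW.
  - apply: continuous_subspaceT => s; apply: differentiable_continuous.
    by apply/derivable1_diffP; have [] := dh s.
  - by rewrite in_itv/= lexx ler01.
  - by rewrite in_itv/= t0.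
by rewrite /= /GRing.add /GRing.opp /=; lra.
Qed.

(** Real and imaginary parts are each compared with B and -B by monotonicity; the factor 2 is the
    price of recombining them. *)
Lemma cder_bound (r r' : R -> C) (B B' : R -> R) : cder r r' ->
  (forall t : R, is_derive t (1 : R) B (B' t)) ->
  r 0 = 0 -> 0 <= B 0 -> (forall t, 0 <= t <= 1 -> normc (r' t) <= B' t) ->
  forall t, 0 <= t <= 1 -> normc (r t) <= 2 * B t.
Proof.
move=> dr dB r0 B0 H t ht.
apply: le_trans (normc_le_ReIm _) _; rewrite mulr_natl mulr2n.
have dNB s : is_derive (s : R) (1 : R) (fun t => - B t) (- B' s) by exact: is_deriveN.
have Re0 : complex.Re (r 0) = 0 by rewrite r0.
have Im0 : complex.Im (r 0) = 0 by rewrite r0.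
by apply: lerD; rewrite ler_norml; apply/andP; split;
  [apply: (@derive_le_01 (fun t => - B t) (fun t => complex.Re (r t)) (fun t => - B' t) (fun t => complex.Re (r' t)) _ _ _ _ t)
  |apply: (@derive_le_01 (fun t => complex.Re (r t)) B (fun t => complex.Re (r' t)) B' _ _ _ _ t)
  |apply: (@derive_le_01 (fun t => - B t) (fun t => complex.Im (r t)) (fun t => - B' t) (fun t => complex.Im (r' t)) _ _ _ _ t)
  |apply: (@derive_le_01 (fun t => complex.Im (r t)) B (fun t => complex.Im (r' t)) B' _ _ _ _ t)] => //;
  rewrite ?Re0 ?Im0 ?oppr_le0//;
  try (by move=> s; have [] := dr s);
  move=> s /H; have := Re_le_normc (r' s); have := Im_le_normc (r' s);
  rewrite !ler_norml => /andP[? ?] /andP[? ?] ?; lra.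
Qed.

Definition cexp_sum n z : C := \sum_(k < n) z ^+ k / k`!%:R.

Lemma cexp_sumS_der n (z : C) :
  cder (fun t => cexp_sum n.+1 (t%:C * z)) (fun t => z * cexp_sum n (t%:C * z)).
Proof.
rewrite /cexp_sum; elim: n => [|n IH].
  rewrite (_ : (fun _ => _) = (fun=> 1)); last first.
    by apply/funext => t; rewrite big_ord1 expr0 fact0 divr1.
  rewrite (_ : (fun t => z * _) = (fun=> 0)); first exact: cder_cst.
  by apply/funext => t; rewrite big_ord0 mulr0.
rewrite (_ : (fun _ => _) = (fun t : R => \sum_(k < n.+1) (t%:C * z) ^+ k / k`!%:R +
    z ^+ n.+1 / (n.+1)`!%:R * (t ^+ n.+1)%:C)); last first.
  by apply/funext => t; rewrite big_ord_recr/= exprMn -rmorphXn; congr (_ + _); ring.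
rewrite (_ : (fun t => z * _) = (fun t : R => z * (\sum_(k < n) (t%:C * z) ^+ k / k`!%:R) +
    z ^+ n.+1 / (n.+1)`!%:R * (n.+1%:R * t ^+ n.+1.-1)%:C)); last first.
  apply/funext => t; rewrite big_ord_recr/= mulrDr exprMn -rmorphXn; congr (_ + _).
  rewrite factS natrM rmorphM/= rmorph_nat exprS.
  have n0 : (n.+1%:R : C) != 0 by rewrite pnatr_eq0.
  have f0 : (n`!%:R : C) != 0 by rewrite pnatr_eq0 -lt0n fact_gt0.
  by field; rewrite f0 nat1r n0.
by apply: cderD => //; exact: cder_monomial.
Qed.

(** Along the segment t z the derivative of the remainder of order n + 1 is z times the remainder of
    order n. Each integration through [cder_bound] costs a factor 2, whence 2 |z| in place of
    |z|. *)
Lemma cexp_remainder_t n z (t : R) : 0 <= t <= 1 ->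
  normc (cexp (t%:C * z) - cexp_sum n (t%:C * z)) <=
  (2 * normc z) ^+ n * expR (normc z) / n`!%:R * t ^+ n.
Proof.
elim: n t => [|n IH] t t01.
  rewrite /cexp_sum big_ord0 subr0 expr0 fact0 divr1 mulr1 mul1r.
  apply: le_trans (normc_cexp_le _) _; rewrite ler_expR normcM normc_real.
  by case/andP: t01 => t0 t1; rewrite ger0_norm// ler_piMl// normc_ge0.
set M := (2 * normc z) ^+ n * expR (normc z).
have -> : (2 * normc z) ^+ n.+1 * expR (normc z) / (n.+1)`!%:R * t ^+ n.+1 =
   2 * (normc z * M / (n.+1)`!%:R * t ^+ n.+1) by rewrite /M exprS; ring.
apply: (@cder_bound (fun t => cexp (t%:C * z) - cexp_sum n.+1 (t%:C * z))
  (fun t => z * cexp (t%:C * z) - z * cexp_sum n (t%:C * z))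
  (fun t => normc z * M / (n.+1)`!%:R * t ^+ n.+1)
  (fun t => normc z * (M / n`!%:R * t ^+ n))).
- by apply: cderD; [exact: cder_cexp|apply: cderN; exact: cexp_sumS_der].
- move=> s; have [+ _] := cder_monomial (normc z * M / (n.+1)`!%:R)%:C n.+1 s.
  under eq_fun do rewrite ReM mul0r subr0.
  rewrite ReM mul0r subr0 /= => /is_derive_eq; apply.
  have n0 : (n.+1%:R : R) != 0 by rewrite pnatr_eq0.
  have f0 : (n`!%:R : R) != 0 by rewrite pnatr_eq0 -lt0n fact_gt0.
  by rewrite factS natrM; field; rewrite f0 nat1r n0.
- rewrite mul0r cexp0 /cexp_sum big_ord_recl expr0 fact0 divr1 big1 ?addr0 ?subrr// => i _.
  by rewrite expr0n mul0r.
- by rewrite expr0n mulr0.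
- by move=> s s01; rewrite -mulrBr normcM ler_wpM2l ?normc_ge0// IH.
- exact: t01.
Qed.

Lemma cexp_remainder n z :
  normc (cexp z - cexp_sum n z) <= (2 * normc z) ^+ n / n`!%:R * expR (normc z).
Proof.
have := @cexp_remainder_t n z 1; rewrite mul1r expr1n mulr1 lexx ler01 => /(_ isT).
by rewrite mulrAC.
Qed.

Lemma cexp_sum_tends z : ctends (cexp_sum^~ z) (cexp z).
Proof.
move=> e e0.
have h : (fun n => (2 * normc z) ^+ n / n`!%:R * expR (normc z)) @ \oo --> (0 : R).
  by rewrite -(mul0r (expR (normc z))); apply: cvgMr_tmp; exact: cvg_exp_coeff.
move/cvgrPdist_le : h => /(_ _ e0); apply: filterS => n.
rewrite sub0r normrN => h; rewrite normc_distC.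
by apply: le_trans (cexp_remainder n z) _; apply: le_trans h; exact: ler_norm.
Qed.

Lemma cexp_sum_le n z : normc (cexp_sum n z) <= expR (normc z).
Proof.
apply: le_trans (normc_sum _ _ _) _.
have -> : \sum_(k < n) normc (z ^+ k / k`!%:R) = series (exp_coeff (normc z)) n.
  rewrite /series/= big_mkord; apply: eq_bigr => k _.
  rewrite normcM normcX normcV /exp_coeff/=; congr (_ / _).
  by rewrite -(rmorph_nat (real_complex R)) normc_real normr_nat.
apply: nondecreasing_cvgn_le (is_cvg_series_exp_coeff _) _.
apply/nondecreasing_seqP => k; rewrite /series/= big_nat_recr//= lerDl.
by rewrite exp_coeff_ge0// normc_ge0.
Qed.

Lemma cexp_entire : entire cexp.
Proof.
apply/entireP => z; exists (cexp z) => e e0.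
have k0 : 0 < normc (cexp z) * (2 * expR 1) by rewrite normc_cexp !mulr_gt0 ?expR_gt0.
exists (Num.min 1 (e / (normc (cexp z) * (2 * expR 1)))).
  by rewrite lt_min ltr01 divr_gt0.
move=> h; rewrite le_min => /andP[h1 he].
rewrite cexpD.
have -> : cexp z * cexp h - cexp z - cexp z * h = cexp z * (cexp h - cexp_sum 2 h).
  by rewrite /cexp_sum big_ord_recl big_ord1/= expr0 expr1 fact0 !divr1; ring.
rewrite normcM.
have := cexp_remainder 2 h; rewrite [2`!]/= => hr.
apply: le_trans (ler_wpM2l (normc_ge0 _) hr) _.
have : (2 * normc h) ^+ 2 / 2 * expR (normc h) <= normc h * (normc h * (2 * expR 1)).
  have -> : (2 * normc h) ^+ 2 / 2 * expR (normc h) = normc h * (normc h * (2 * expR (normc h))) by field.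
  by rewrite !ler_wpM2l ?normc_ge0// ler_expR.
move=> h3; apply: le_trans (ler_wpM2l (normc_ge0 _) h3) _.
rewrite mulrCA [e * _]mulrC ler_wpM2l ?normc_ge0//.
by move: he; rewrite ler_pdivlMr// => he; rewrite mulrCA.
Qed.

End cexp.

(** * Power series with infinite radius of convergence *)

Section power_series.
Variable R : realType.
Notation C := R[i].

Lemma ctends_geometric (u : nat -> C) (M : R) : (forall k, normc (u k) <= M / 2 ^+ k) ->
  exists l, ctends (fun n => \sum_(k < n) u k) l.
Proof.
move=> H; apply: ctends_cauchy => e e0.
have M0 : 0 <= M by have := H 0%N; rewrite expr0 divr1; apply: le_trans (normc_ge0 _).
have tail m n : (m <= n)%N ->
    normc (\sum_(k < n) u k - \sum_(k < m) u k) <= 2 * M / 2 ^+ m - 2 * M / 2 ^+ n.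
  move=> /subnKC <-; elim: (n - m)%N => [|k IH]; first by rewrite addn0 !subrr normc0.
  rewrite addnS big_ord_recr/= addrAC; apply: le_trans (le_normcD _ _) _.
  apply: le_trans (lerD IH (H _)) _; rewrite exprS.
  have x0 : (2 ^+ (m + k) : R) != 0 by rewrite expf_neq0.
  by rewrite -subr_ge0 le_eqVlt; apply/orP; left; apply/eqP; field; rewrite x0 expf_neq0.
have h : (fun n => 2 * M / 2 ^+ n) @ \oo --> (0 : R).
  under eq_fun do rewrite -exprVn.
  rewrite -(mulr0 (2 * M)); apply: cvgMr; apply: cvg_expr.
  by rewrite ger0_norm ?invf_lt1 ?ltr1n ?invr_ge0.
move/cvgrPdist_le : h => /(_ _ e0); apply: filterS => N; rewrite sub0r normrN => hN m n /andP[Nm mn].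
apply: le_trans (tail _ _ mn) _.
apply: le_trans (_ : 2 * M / 2 ^+ m <= _).
  by rewrite lerBlDr lerDl divr_ge0 ?mulr_ge0 ?exprn_ge0.
apply: (le_trans _ hN); rewrite ger0_norm ?divr_ge0 ?mulr_ge0 ?exprn_ge0//.
by rewrite ler_wpM2l ?mulr_ge0// lef_pV2 ?posrE ?exprn_gt0// ler_eXn2l ?ltr1n.
Qed.

(** Equivalent to an infinite radius of convergence. *)
Definition rapid (a : nat -> C) := forall rho : R, 0 < rho ->
  exists M : R, forall n, normc (a n) * rho ^+ n <= M.

Definition psum (a : nat -> C) (n : nat) (z : C) : C := \sum_(k < n) a k * z ^+ k.

Definition pseriesC (a : nat -> C) (z : C) : C := xget 0 [set l | ctends ((psum a)^~ z) l].

Lemma pseriesCP a z : rapid a -> ctends ((psum a)^~ z) (pseriesC a z).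
Proof.
move=> ra; rewrite /pseriesC; case: xgetP => // /(_ _) H.
have r0 : 0 < 2 * (1 + normc z) by rewrite mulr_gt0// ltr_pwDl// normc_ge0.
have [M HM] := ra _ r0.
have [|l hl] := @ctends_geometric (fun k => a k * z ^+ k) M; last by case: (H l).
move=> k; rewrite normcM normcX ler_pdivlMr ?exprn_gt0//.
apply: le_trans (HM k); rewrite -mulrA ler_wpM2l ?normc_ge0// exprMn mulrC ler_wpM2l ?exprn_ge0//.
by rewrite lerXn2r ?nnegrE ?normc_ge0 ?addr_ge0 ?normc_ge0// lerDr.
Qed.

(** Induction through (z + h)^(k+1) = (z + h) (z + h)^k. The crude factor 2^k swallows the
    multiplier k, and r >= 1 allows powers of r to be raised freely. *)
Lemma taylor1_monomial (z h : C) (r : R) k : 1 <= r -> normc z + normc h <= r ->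
  normc ((z + h) ^+ k - z ^+ k - k%:R * z ^+ k.-1 * h) <= (2 * r) ^+ k * normc h ^+ 2.
Proof.
move=> r1 zhr; have r0 : 0 <= r by exact: le_trans r1.
have zr : normc z <= r by apply: le_trans zhr; rewrite lerDl normc_ge0.
elim: k => [|k IH].
  by rewrite !expr0 !mul0r subr0 subrr normc0 mul1r exprn_ge0// normc_ge0.
have -> : (z + h) ^+ k.+1 - z ^+ k.+1 - k.+1%:R * z ^+ k.+1.-1 * h =
  (z + h) * ((z + h) ^+ k - z ^+ k - k%:R * z ^+ k.-1 * h) + k%:R * z ^+ k.-1 * h ^+ 2.
  case: k {IH} => [|k]; first by rewrite !expr0 !expr1; ring.
  by rewrite /= !exprS -natr1; ring.
apply: le_trans (le_normcD _ _) _; rewrite !normcM !normcX.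
have zh : normc (z + h) <= r by apply: le_trans (le_normcD _ _) _.
have h1 : normc (z + h) * normc ((z + h) ^+ k - z ^+ k - k%:R * z ^+ k.-1 * h) <=
    r * ((2 * r) ^+ k * normc h ^+ 2) by apply: ler_pM; rewrite ?normc_ge0.
have h2 : normc k%:R * normc z ^+ k.-1 <= 2 ^+ k * r ^+ k.+1.
  apply: ler_pM; rewrite ?normc_ge0 ?exprn_ge0 ?normc_ge0//.
    rewrite -(rmorph_nat (real_complex R)) normc_real normr_nat -natrX ler_nat.
    exact/ltnW/ltn_expl.
  apply: le_trans (_ : r ^+ k.-1 <= _).
    by rewrite lerXn2r ?nnegrE ?normc_ge0.
  by rewrite ler_weXn2l// (leq_trans (leq_pred k)) ?leqnSn.
apply: le_trans (lerD h1 (ler_wpM2r (exprn_ge0 2 (normc_ge0 h)) h2)) _.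
rewrite mulrA -mulrDl ler_wpM2r ?exprn_ge0 ?normc_ge0//.
by rewrite !exprMn !exprS -subr_ge0 le_eqVlt; apply/orP; left; apply/eqP; ring.
Qed.

Lemma pseriesC_entire a : rapid a -> entire (pseriesC a).
Proof.
move=> ra; apply/entireP => z.
pose r := 1 + normc z.
have r1 : 1 <= r by rewrite lerDl normc_ge0.
(* Radius 4 r: one factor 2 is spent by [taylor1_monomial], the other leaves a geometric series of
   sum at most 2 M. *)
have r0 : 0 < 2 * (2 * r) by rewrite !mulr_gt0// (lt_le_trans ltr01 r1).
have [M HM] := ra _ r0.
have HM' k : normc (a k) * (2 * r) ^+ k <= M / 2 ^+ k.
  by rewrite ler_pdivlMr ?exprn_gt0// -mulrA [_ ^+ k * _]mulrC -exprMn.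
have M0 : 0 <= M by have := HM 0%N; rewrite expr0 mulr1; apply: le_trans (normc_ge0 _).
have [|A HA] := @ctends_geometric (fun k => a k * (k%:R * z ^+ k.-1)) M.
  move=> k; apply: le_trans (HM' k); rewrite normcM ler_wpM2l ?normc_ge0// normcM exprMn normcX.
  apply: ler_pM; rewrite ?normc_ge0 ?exprn_ge0 ?normc_ge0//.
    rewrite -(rmorph_nat (real_complex R)) normc_real normr_nat -natrX ler_nat.
    exact/ltnW/ltn_expl.
  apply: le_trans (_ : r ^+ k.-1 <= _).
    by rewrite lerXn2r ?nnegrE ?normc_ge0 ?addr_ge0 ?normc_ge0// lerDr.
  by rewrite ler_weXn2l// leq_pred.
exists A => e e0.
exists (Num.min 1 (e / (1 + 2 * M))).
  by rewrite lt_min ltr01 divr_gt0// ltr_pwDl// mulr_ge0.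
move=> h; rewrite le_min => /andP[h1 he].
apply: le_trans (_ : 2 * M * normc h ^+ 2 <= _); last first.
  rewrite expr2 mulrA ler_wpM2r ?normc_ge0//.
  move: he; rewrite ler_pdivlMr; last by rewrite ltr_pwDl// mulr_ge0.
  by rewrite mulrC mulrDl mul1r; apply: le_trans; rewrite lerDr normc_ge0.
have zhr : normc z + normc h <= r by rewrite addrC lerD2r.
(* The quadratic remainder is bounded uniformly for the partial sums, and the bound passes to the
   limit. *)
apply: (@ctends_le _ (fun n => psum a n (z + h) - psum a n z -
    (\sum_(k < n) a k * (k%:R * z ^+ k.-1)) * h)).
  apply: ctends_sub; first by apply: ctends_sub; exact: pseriesCP.
  rewrite mulrC (_ : (fun n => _ * h) = (fun n => h * \sum_(k < n) a k * (k%:R * z ^+ k.-1))).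
    exact: ctendsMl.
  by apply/funext => n; rewrite mulrC.
apply: nearW => n; rewrite /psum -sumrB mulr_suml -sumrB.
apply: le_trans (normc_sum _ _ _) _.
have : \sum_(k < n) normc (a k * (z + h) ^+ k - a k * z ^+ k - a k * (k%:R * z ^+ k.-1) * h)
    <= \sum_(k < n) (M * normc h ^+ 2 / 2 ^+ k).
  apply: ler_sum => k _.
  rewrite -mulrA -!mulrBr normcM.
  apply: le_trans (ler_wpM2l (normc_ge0 _) (taylor1_monomial k r1 zhr)) _.
  by rewrite mulrA [leRHS]mulrAC ler_wpM2r ?exprn_ge0 ?normc_ge0.
move/le_trans; apply; rewrite -mulr_sumr (_ : 2 * M * normc h ^+ 2 = M * normc h ^+ 2 * 2); last by ring.
have : \sum_(k < n) 2 ^- k <= (2 : R).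
  have -> : \sum_(k < n) 2 ^- k = 2 - 2 / 2 ^+ n :> R.
    elim: n => [|n IH]; first by rewrite big_ord0 expr0 divr1 subrr.
    rewrite big_ord_recr/= IH exprS; field.
    by rewrite expf_neq0.
  by rewrite lerBlDr lerDl divr_ge0// exprn_ge0.
move=> hs.
by apply: ler_wpM2l => //; rewrite mulr_ge0// exprn_ge0// normc_ge0.
Qed.

End power_series.

(** * Lebesgue measure on the plane *)

Section plane_measurability.
Variable R : realType.
Notation C := R[i].
Notation mR := (measurableTypeR R).
Notation RR := (mR * mR)%type.

Definition openC (U : set C) := forall z, U z ->
  exists2 d : R, 0 < d & forall h, normc h <= d -> U (z + h).

Lemma plane_sub (p q : RR) : plane p - plane q = plane (p.1 - q.1, p.2 - q.2).
Proof. by case: p; case: q. Qed.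

(** Each point lies in a square with rational centre and half-side 1/(n+1) contained in [U]; [Q]
    enumerates these squares and [G] keeps those inside [U]. *)
Lemma openC_measurable (U : set C) : openC U -> measurable ((@plane R : RR -> C) @^-1` U).
Proof.
move=> oU.
pose Q (t : rat * rat * nat) : set RR :=
  `]ratr t.1.1 - t.2.+1%:R^-1, ratr t.1.1 + t.2.+1%:R^-1[%classic `*`
  `]ratr t.1.2 - t.2.+1%:R^-1, ratr t.1.2 + t.2.+1%:R^-1[%classic.
pose G (k : nat) : set RR := if (choice.unpickle k : option (rat * rat * nat)) is Some t then
   if `[< Q t `<=` (@plane R : RR -> C) @^-1` U >] then Q t else set0 else set0.
have -> : (@plane R : RR -> C) @^-1` U = \bigcup_k G k.
  apply/seteqP; split => [p /= Up|p [k _]]; last first.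
    rewrite /G; case: choice.unpickle => // t; case: ifPn => // /asboolP; exact.
  have [d d0 Hd] := oU _ Up.
  have [n n4] : exists n : nat, n.+1%:R^-1 < d / 4.
    exists (Num.bound (d / 4)^-1); rewrite -[ltRHS]invrK ltf_pV2 ?posrE ?invr_gt0 ?divr_gt0//.
    apply: lt_trans (archi_boundP _) _; first by rewrite invr_ge0 divr_ge0// ltW.
    by rewrite ltr_nat.
  have ni : (0 : R) < n.+1%:R^-1 by rewrite invr_gt0.
  have close (x x' q : R) : x - n.+1%:R^-1 < q -> q < x + n.+1%:R^-1 ->
      q - n.+1%:R^-1 < x' -> x' < q + n.+1%:R^-1 -> `|x' - x| <= d / 2.
    move: n4; set i : R := n.+1%:R^-1 => n4 h1 h2 h3 h4.
    by rewrite ler_norml; apply/andP; split; lra.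
  have near_rat (x : R) : exists q : rat, x - n.+1%:R^-1 < ratr q < x + n.+1%:R^-1.
    have := @rat_in_itvoo R (x - n.+1%:R^-1) (x + n.+1%:R^-1).
    case=> [|q]; first by rewrite ltrBlDr -addrA ltrDl addr_gt0.
    by rewrite in_itv/= => hq; exists q.
  have [q1 /andP[q1a q1b]] := near_rat p.1; have [q2 /andP[q2a q2b]] := near_rat p.2.
  exists (choice.pickle (q1, q2, n)); first exact: I.
  rewrite /G choice.pickleK asboolT; last first.
    move=> p' [] /=; rewrite !in_itv/= => /andP[a1 a2] /andP[a3 a4].
    have -> : plane p' = plane p + (plane p' - plane p) by rewrite addrC subrK.
    apply: Hd; rewrite plane_sub; apply: le_trans (normc_le_ReIm _) _ => /=.
    by rewrite [d]splitr; apply: lerD; [exact: close q1a q1b a1 a2|exact: close q2a q2b a3 a4].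
  by split; rewrite /= in_itv/=; apply/andP; split;
    rewrite ?ltrBlDr// -ltrBlDr.
apply: bigcupT_measurable => k; rewrite /G; case: choice.unpickle => [t|]; last exact: measurable0.
case: ifP => _; last exact: measurable0.
by apply: measurableX; exact: measurable_itv.
Qed.

Definition contC (f : C -> R) := forall z e, 0 < e ->
  exists2 d : R, 0 < d & forall h, normc h <= d -> `|f (z + h) - f z| <= e.

Lemma contC_measurable (f : C -> R) : contC f ->
  measurable_fun setT (fun p : RR => f (plane p)).
Proof.
move=> cf.
apply: (measurability _ (measurable_realfun.RGenOInfty.measurableE R)).
move=> _ [_ [a ->] <-]; rewrite setTI.
rewrite (_ : _ @^-1` _ = (@plane R : RR -> C) @^-1` [set z | a < f z]); last first.
  by apply/seteqP; split => p /=; rewrite in_itv/= andbT.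
apply: openC_measurable => z /= az.
have e0 : 0 < (f z - a) / 2 by rewrite divr_gt0// subr_gt0.
have [d d0 Hd] := cf z _ e0; exists d => // h /Hd.
by rewrite ler_norml => /andP[]; lra.
Qed.

End plane_measurability.

(** * Invariance of planar Lebesgue measure under translations and rotations *)

Section dm_invariance.
Variable R : realType.
Notation C := R[i].
Notation mR := (measurableTypeR R).
Notation RR := (mR * mR)%type.
Notation mu := (@lebesgue_measure R).

Lemma lebesgue_measure_shift (t : R) (A : set mR) : measurable A ->
  mu ((fun x : mR => (x + t : mR)) @^-1` A) = mu A.
Proof.
move=> mA; pose f : mR -> mR := fun x => x + t.
have mf : measurable_fun setT f by apply: measurable_funD.
pose mixin := isMeasurableFun.Build _ _ _ _ _ mf.
pose f_pack : {mfun _ >-> _} := HB.pack f mixin.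
have H : (forall X, ocitv X -> mu X = mu (f @^-1` X)) -> mu A = mu (f @^-1` A).
  by move=> h; exact: (@lebesgue_measure_unique R (pushforward mu f_pack) h A mA).
apply/esym/H => _ [[a b]] _ <-.
have -> : f @^-1` [set` `]a, b]] = [set` `]a - t, b - t]].
  by apply/seteqP; split => x; rewrite /= !in_itv/= /f ltrBlDr lerBrDr.
rewrite !lebesgue_measure_itv/= !lte_fin ltrD2r; case: ifP => // _.
by rewrite -!EFinB; congr (_%:E); ring.
Qed.

Definition dm_preserving (T : RR -> RR) := measurable_fun setT T /\
  forall A, measurable A -> @dm R (T @^-1` A) = @dm R A.

Lemma dm_preserving_rect (T : RR -> RR) : measurable_fun setT T ->
  (forall A B : set mR, measurable A -> measurable B ->
     @dm R (T @^-1` (A `*` B)) = (mu A * mu B)%E) -> dm_preserving T.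
Proof.
move=> mT H; split; first exact: mT.
move=> A mA.
pose mixin := isMeasurableFun.Build _ _ _ _ _ mT.
pose T_pack : {mfun _ >-> _} := HB.pack T mixin.
by apply/esym/(@product_measure_unique _ _ _ _ _ mu mu (pushforward (@dm R) T_pack)).
Qed.

Lemma dm_preserving_comp S T : dm_preserving S -> dm_preserving T -> dm_preserving (S \o T).
Proof.
move=> [mS HS] [mT HT]; split; first exact: measurableT_comp.
move=> A mA; rewrite comp_preimage HT ?HS//.
by rewrite -[X in measurable X]setTI; exact: mS.
Qed.

Lemma dm_preserving_swap : dm_preserving (fun p : RR => (p.2, p.1) : RR).
Proof.
apply: dm_preserving_rect.
  by apply/measurable_fun_pairP; split; [exact: measurable_snd|exact: measurable_fst].
move=> A B mA mB; rewrite (_ : _ @^-1` _ = B `*` A); last first.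
  by apply/seteqP; split => p /= [].
by rewrite muleC; exact: product_measure1E.
Qed.

(** The section of the preimage of A x B over a point x of A is B translated by -g x, which has the
    measure of B; it is empty over other points. *)
Lemma dm_preserving_shear (g : mR -> mR) : measurable_fun setT g ->
  dm_preserving (fun p : RR => (p.1, p.2 + g p.1) : RR).
Proof.
move=> mg; pose T (p : RR) : RR := (p.1, p.2 + g p.1).
have mT : measurable_fun setT T.
  apply/measurable_fun_pairP; split; first exact: measurable_fst.
  apply: measurable_funD; first exact: measurable_snd.
  by apply: measurableT_comp => //; exact: measurable_fst.
apply: dm_preserving_rect => // A B mA mB.
have mAB : measurable (T @^-1` (A `*` B)).
  by rewrite -[X in measurable X]setTI; apply: mT => //; exact: measurableX.
rewrite /dm /= /product_measure1.
transitivity (\int[mu]_x ((\1_A x)%:E * mu B))%E.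
  apply: eq_integral => x _ /=.
  have [xA|xA] := boolP (x \in A).
    rewrite indicE xA mul1e -(lebesgue_measure_shift (g x) mB); congr (mu _).
    apply/seteqP; split => y; rewrite /xsection/= inE/=; first by case.
    by move=> By; split=> //; rewrite inE in xA.
  rewrite indicE (negbTE xA) mul0e (_ : xsection _ _ = set0) ?measure0//.
  apply/seteqP; split => y //; rewrite /xsection/= inE/= => -[+ _].
  by move=> /mem_set; rewrite (negbTE xA).
have A0 x : setT x -> (0 <= (\1_A x : R)%:E)%E by move=> _; rewrite lee_fin.
have mA1 : measurable_fun setT (fun x : mR => (\1_A x : R)%:E) by exact/measurable_EFinP.
apply: etrans (ge0_integralZr mu measurableT mA1 A0 (measure_ge0 mu B)) _.
congr (_ * _)%E; apply: etrans (integral_indic mu measurableT mA) _.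
by rewrite setIT.
Qed.

Lemma dm_preserving_shear' (g : mR -> mR) : measurable_fun setT g ->
  dm_preserving (fun p : RR => (p.1 + g p.2, p.2) : RR).
Proof.
move=> mg; have h := dm_preserving_comp dm_preserving_swap
   (dm_preserving_comp (dm_preserving_shear mg) dm_preserving_swap).
exact: h.
Qed.

Definition dm_preservingC (T : C -> C) := dm_preserving (fun p : RR =>
  (complex.Re (T (plane p)), complex.Im (T (plane p))) : RR).

Lemma dm_preservingC_comp S T : dm_preservingC S -> dm_preservingC T -> dm_preservingC (S \o T).
Proof.
move=> hS hT; have := dm_preserving_comp hS hT; rewrite /dm_preservingC.
congr dm_preserving; apply/funext => p /=.
by rewrite (_ : plane (_, _) = T (plane p)); [|apply: complex_eq].
Qed.

Lemma dm_preserving_translation (w : C) : dm_preservingC (fun z => z + w).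
Proof.
have := dm_preserving_comp (dm_preserving_shear (measurable_cst (complex.Im w : mR)))
   (dm_preserving_shear' (measurable_cst (complex.Re w : mR))).
congr dm_preserving; apply/funext => p /=; by rewrite !ReImE.
Qed.

(* A rotation by an angle other than pi is a product of three shears. *)
Lemma dm_preserving_rotation (u : C) : normc u = 1 -> dm_preservingC (fun z => u * z).
Proof.
have main (v : C) : normc v = 1 -> complex.Re v <> -1 -> dm_preservingC (fun z => v * z).
  case: v => c s v1 /= c1.
  have cs : c ^+ 2 + s ^+ 2 = 1 by have := sqr_normc_ReIm (c +i* s); rewrite v1 expr1n.
  have c10 : 1 + c != 0 by apply/eqP => h; apply: c1; lra.
  pose t := s / (1 + c).
  have mlin k : measurable_fun setT (fun x : mR => (k * x : mR)) by exact: measurable_funM.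
  have := dm_preserving_comp (dm_preserving_shear' (mlin (- t)))
   (dm_preserving_comp (dm_preserving_shear (mlin s)) (dm_preserving_shear' (mlin (- t)))).
  have eqI (p q : R) : (1 + c) * p - (1 + c) * q = 0 -> p = q.
    by move=> /eqP; rewrite subr_eq0 => /eqP/(mulfI c10).
  congr dm_preserving; apply/funext => -[x y] /=; congr pair; apply: eqI.
    transitivity ((x - s / (1 + c) * y) * (1 - (c ^+ 2 + s ^+ 2))).
      by rewrite /t; field.
    by rewrite cs subrr mulr0.
  transitivity (y * (1 - (c ^+ 2 + s ^+ 2))); first by rewrite /t; field.
  by rewrite cs subrr mulr0.
move=> u1; have [hu|] := eqVneq (complex.Re u) (-1); last by move/eqP; exact: main.
have uE : u = 'i * 'i.
  have : complex.Im u ^+ 2 = 0.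
    have := sqr_normc_ReIm u; rewrite u1 hu; lra.
  move=> /eqP; rewrite sqrf_eq0 => /eqP hi.
  by apply: complex_eq; rewrite ?hu ?hi /=; ring.
have hi : dm_preservingC (fun z => 'i%C * z).
  apply: main => /=; first by rewrite expr0n expr1n add0r sqrtr1.
  lra.
have := dm_preservingC_comp hi hi; rewrite uE; congr dm_preservingC.
by apply/funext => z /=; rewrite mulrA.
Qed.

(** The pushforward formula holds for nonnegative integrands; applied to positive and negative parts
    it covers every measurable real integrand. *)
Lemma integral_dm_preserving (T : C -> C) (f : C -> R) : dm_preservingC T ->
  measurable_fun setT (fun p : RR => f (plane p)) ->
  (\int[@dm R]_p (f (T (plane p)))%:E = \int[@dm R]_p (f (plane p))%:E)%E.
Proof.
move=> [mT HT] mf.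
pose T' (p : RR) : RR := (complex.Re (T (plane p)), complex.Im (T (plane p))).
have fE p : f (T (plane p)) = f (plane (T' p)).
  by congr f; apply: complex_eq.
have ge0 (g : RR -> \bar R) : measurable_fun setT g -> (forall p, 0 <= g p)%E ->
    (\int[@dm R]_p g (T' p) = \int[@dm R]_p g p)%E.
  move=> mg g0.
  have h := @ge0_integral_pushforward _ _ _ _ R T' mT (@dm R) setT g measurableT mg (fun p _ => g0 p).
  apply: etrans (esym h) _.
  by apply: eq_measure_integral => A mA _; exact: HT.
pose F : RR -> \bar R := fun p => (f (plane p))%:E.
have mF : measurable_fun setT F by exact/measurable_EFinP.
have FE : (fun p : RR => (f (T (plane p)))%:E) = F \o T'.
  by apply/funext => p; rewrite fE.
rewrite FE integralE [RHS]integralE; congr (_ - _)%E.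
  apply: etrans (etrans _ (ge0 _ (measurable_funepos mF) (fun p => funepos_ge0 _ p))) _.
  - by apply: eq_integral => p _; rewrite unlock.
  - by apply: eq_integral => p _; rewrite unlock.
apply: etrans (etrans _ (ge0 _ (measurable_funeneg mF) (fun p => funeneg_ge0 _ p))) _.
- by apply: eq_integral => p _; rewrite unlock.
- by apply: eq_integral => p _; rewrite unlock.
Qed.

End dm_invariance.

(** * Integrals of real and complex functions on the plane *)

Section complex_integrals.
Variable R : realType.
Notation C := R[i].
Notation mR := (measurableTypeR R).
Notation RR := (mR * mR)%type.
Notation dm := (@dm R).
Implicit Types (f g h : C -> C) (u v : C -> R).

Definition measR u := measurable_fun setT (fun p : RR => u (plane p)).
Definition integ u := dm.-integrable setT (fun p : RR => (u (plane p))%:E).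
Definition intR u : R := Rintegral dm setT (fun p : RR => u (plane p)).

Lemma integ_meas u : integ u -> measR u.
Proof. by move=> /integrableP[/measurable_EFinP]. Qed.

Lemma integ_le u v : measR u -> (forall z, `|u z| <= v z) -> integ v -> integ u.
Proof.
move=> mu uv; apply: le_integrable => //; first exact/measurable_EFinP.
by move=> p _ /=; rewrite lee_fin; apply: le_trans (uv _) _; exact: ler_norm.
Qed.

Lemma integD u v : integ u -> integ v -> integ (fun z => u z + v z).
Proof. by move=> hu hv; exact: (integrableD measurableT hu hv). Qed.

Lemma integZ (c : R) u : integ u -> integ (fun z => c * u z).
Proof. by move=> hu; exact: (integrableZl measurableT c hu). Qed.

Lemma intRD u v : integ u -> integ v -> intR (fun z => u z + v z) = intR u + intR v.
Proof. by move=> hu hv; exact: (RintegralD measurableT hu hv). Qed.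

Lemma intRZ (c : R) u : integ u -> intR (fun z => c * u z) = c * intR u.
Proof. by move=> hu; rewrite /intR; exact: (RintegralZl c measurableT hu). Qed.

Lemma integB u v : integ u -> integ v -> integ (fun z => u z - v z).
Proof. by move=> hu hv; exact: (integrableB measurableT hu hv). Qed.

Lemma intRB u v : integ u -> integ v -> intR (fun z => u z - v z) = intR u - intR v.
Proof. by move=> hu hv; exact: (RintegralB measurableT hu hv). Qed.

Lemma intR_ge0 u : (forall z, 0 <= u z) -> 0 <= intR u.
Proof. by move=> u0; apply: Rintegral_ge0 => p _; exact: u0. Qed.

Lemma intR_le u v : integ u -> integ v -> (forall z, u z <= v z) -> intR u <= intR v.
Proof. by move=> hu hv uv; apply: le_Rintegral. Qed.

Lemma intR_norm u : integ u -> `|intR u| <= intR (fun z => `|u z|).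
Proof. by move=> hu; exact: (le_normr_Rintegral measurableT hu). Qed.

Lemma integ_norm u : integ u -> integ (fun z => `|u z|).
Proof.
by move=> hu; exact: (integrable_abse hu).
Qed.

Lemma intR_EFin u : integ u -> (\int[dm]_p (u (plane p))%:E = (intR u)%:E)%E.
Proof. by move=> hu; rewrite /intR /Rintegral fineK//; exact: integrable_fin_num. Qed.

Lemma integ_lty u : measR u -> (forall z, 0 <= u z) ->
  (\int[dm]_p (u (plane p))%:E < +oo)%E <-> integ u.
Proof.
move=> mu u0; split => [h|/integrableP[_]]; last first.
  by under eq_integral do rewrite gee0_abs ?lee_fin//.
apply/integrableP; split; first exact/measurable_EFinP.
by under eq_integral do rewrite gee0_abs ?lee_fin//.
Qed.

Lemma intR_cvg (U : nat -> C -> R) u v : (forall n, measR (U n)) -> measR u ->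
  (forall z, U ^~ z @ \oo --> u z) -> integ v -> (forall n z, `|U n z| <= v z) ->
  (fun n => intR (U n)) @ \oo --> intR u.
Proof.
move=> mU mu Uu iv Uv.
have iU n : integ (U n) by exact: integ_le (mU n) (Uv n) iv.
have mUE n : measurable_fun setT (fun p : RR => (U n (plane p))%:E).
  by apply/measurable_EFinP; exact: mU.
have muE : measurable_fun setT (fun p : RR => (u (plane p))%:E).
  by apply/measurable_EFinP; exact: mu.
have [iu _ H] : [/\ dm.-integrable setT (fun p : RR => (u (plane p))%:E),
    (fun n => \int[dm]_p `|(U n (plane p))%:E - (u (plane p))%:E|)%E @ \oo --> (0%E : \bar R)
  & (fun n => \int[dm]_p (U n (plane p))%:E)%E @ \oo --> (\int[dm]_p (u (plane p))%:E)%E].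
  apply: (dominated_convergence measurableT mUE muE _ iv).
    by apply: aeW => p _; apply: cvg_EFin; [exact: nearW|exact: Uu].
  by apply: aeW => p n _; rewrite lee_fin; exact: Uv.
by move: H; rewrite (intR_EFin iu); exact: fine_cvg.
Qed.

Definition measC h := measR (fun z => complex.Re (h z)) /\ measR (fun z => complex.Im (h z)).

Lemma measRD u v : measR u -> measR v -> measR (fun z => u z + v z).
Proof. exact: measurable_funD. Qed.
Lemma measRB u v : measR u -> measR v -> measR (fun z => u z - v z).
Proof. exact: measurable_funB. Qed.
Lemma measRM u v : measR u -> measR v -> measR (fun z => u z * v z).
Proof. exact: measurable_funM. Qed.
Lemma measR_cst (c : R) : measR (fun=> c).
Proof. exact: measurable_cst. Qed.
Lemma measRN u : measR u -> measR (fun z => - u z).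
Proof. by move=> mu; exact: measurableT_comp. Qed.

Lemma measC_add f g : measC f -> measC g -> measC (fun z => f z + g z).
Proof.
move=> [f1 f2] [g1 g2]; split.
  by under eq_fun do rewrite ReD; exact: (measRD f1 g1).
by under eq_fun do rewrite ImD; exact: (measRD f2 g2).
Qed.

Lemma measC_mul f g : measC f -> measC g -> measC (fun z => f z * g z).
Proof.
move=> [f1 f2] [g1 g2]; split.
  by under eq_fun do rewrite ReM; exact: (measRB (measRM f1 g1) (measRM f2 g2)).
by under eq_fun do rewrite ImM; exact: (measRD (measRM f1 g2) (measRM f2 g1)).
Qed.

Lemma measC_conj f : measC f -> measC (fun z => (f z)^*).
Proof.
move=> [f1 f2]; split.
  by under eq_fun do rewrite Re_conj.
by under eq_fun do rewrite Im_conj; exact: (measRN f2).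
Qed.

Lemma measC_real u : measR u -> measC (fun z => (u z)%:C).
Proof. by move=> mu; split=> //; exact: measR_cst. Qed.

Lemma measC_cst (c : C) : measC (fun=> c).
Proof. by split; exact: measR_cst. Qed.

Lemma measC_normsqr f : measC f -> measR (fun z => normc (f z) ^+ 2).
Proof.
move=> [f1 f2]; under eq_fun do rewrite sqr_normc_ReIm !expr2.
exact: (measRD (measRM f1 f1) (measRM f2 f2)).
Qed.

Lemma measC_norm f : measC f -> measR (fun z => normc (f z)).
Proof.
move=> mf; rewrite (_ : (fun z => normc (f z)) = (fun z => Num.sqrt (normc (f z) ^+ 2))).
  have h : measurable_fun setT (@Num.sqrt R).
    by apply: continuous_measurable_fun; exact: sqrt_continuous.
  by apply: (measurableT_comp h); exact: measC_normsqr.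
by apply/funext => z; rewrite sqrtr_sqr ger0_norm ?normc_ge0.
Qed.

Lemma entire_measC f : entire f -> measC f.
Proof.
move=> ef; split; apply: contC_measurable => z e e0;
  have [d d0 Hd] := entire_continuous z ef e0; exists d => // h hd;
  apply: le_trans (Hd h hd).
  by rewrite -ReN -ReD; exact: Re_le_normc.
by rewrite -ImN -ImD; exact: Im_le_normc.
Qed.

Definition cinteg h := integ (fun z => complex.Re (h z)) /\ integ (fun z => complex.Im (h z)).

Lemma cinteg_le h v : measC h -> (forall z, normc (h z) <= v z) -> integ v -> cinteg h.
Proof.
move=> [h1 h2] hv iv; split.
  by apply: integ_le h1 _ iv => z; apply: le_trans (hv z); exact: Re_le_normc.
by apply: integ_le h2 _ iv => z; apply: le_trans (hv z); exact: Im_le_normc.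
Qed.

Lemma integralC_ReIm h : integralC h =
  intR (fun z => complex.Re (h z)) +i* intR (fun z => complex.Im (h z)).
Proof. by []. Qed.

Lemma integralCD f g : cinteg f -> cinteg g ->
  integralC (fun z => f z + g z) = integralC f + integralC g.
Proof.
move=> [f1 f2] [g1 g2]; rewrite !integralC_ReIm; apply: complex_eq => /=.
  by rewrite -intRD//; congr intR; apply/funext => z; rewrite ReD.
by rewrite -intRD//; congr intR; apply/funext => z; rewrite ImD.
Qed.

Lemma integralCZ (c : C) f : cinteg f -> integralC (fun z => c * f z) = c * integralC f.
Proof.
move=> [f1 f2]; rewrite !integralC_ReIm; apply: complex_eq; rewrite !ReImE /=.
  rewrite -!intRZ// -intRB; [|exact: integZ..].
  by congr intR; apply/funext => z; rewrite ReM.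
rewrite -!intRZ// -intRD; [|exact: integZ..].
by congr intR; apply/funext => z; rewrite ImM.
Qed.

Lemma integralC_conj f : cinteg f -> integralC (fun z => (f z)^*) = (integralC f)^*.
Proof.
move=> [f1 f2]; rewrite !integralC_ReIm; apply: complex_eq; rewrite /=.
  by congr intR; apply/funext => z; rewrite Re_conj.
rewrite -mulN1r -intRZ//; congr intR; apply/funext => z; by rewrite Im_conj mulN1r.
Qed.

Lemma integralC_le h v : measC h -> (forall z, normc (h z) <= v z) -> integ v ->
  normc (integralC h) <= 2 * intR v.
Proof.
move=> mh hv iv; have [h1 h2] := cinteg_le mh hv iv.
apply: le_trans (normc_le_ReIm _) _; rewrite mulr_natl mulr2n /=.
apply: lerD.
  apply: (le_trans (intR_norm h1)); apply: (intR_le (integ_norm h1) iv) => z.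
  by apply: le_trans (hv z); exact: Re_le_normc.
apply: (le_trans (intR_norm h2)); apply: (intR_le (integ_norm h2) iv) => z.
by apply: le_trans (hv z); exact: Im_le_normc.
Qed.

Lemma integralC_cvg (U : nat -> C -> C) h v : (forall n, measC (U n)) -> measC h ->
  (forall z, ctends (U ^~ z) (h z)) -> integ v -> (forall n z, normc (U n z) <= v z) ->
  ctends (fun n => integralC (U n)) (integralC h).
Proof.
move=> mU [h1 h2] Uh iv Uv; apply: ctends_ReIm => /=.
  apply: (@intR_cvg (fun n z => complex.Re (U n z)) (fun z => complex.Re (h z)) v _ h1 _ iv).
  - by move=> n; have [] := mU n.
  - by move=> z; exact: ctends_Re.
  - by move=> n z; apply: le_trans (Uv n z); exact: Re_le_normc.
apply: (@intR_cvg (fun n z => complex.Im (U n z)) (fun z => complex.Im (h z)) v _ h2 _ iv).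
- by move=> n; have [] := mU n.
- by move=> z; exact: ctends_Im.
- by move=> n z; apply: le_trans (Uv n z); exact: Im_le_normc.
Qed.

Lemma integ_preserving (T : C -> C) u : dm_preservingC T -> integ u -> integ (fun z => u (T z)).
Proof.
move=> pT iu; have mu := integ_meas iu.
have [mT _] := pT.
have mTu : measR (fun z => u (T z)).
  have := measurableT_comp mu mT; congr (measurable_fun _ _); apply/funext => p /=.
  by congr u; apply: complex_eq.
have mnu : measR (fun z => `|u z|) by exact: (integ_meas (integ_norm iu)).
apply/integrableP; split; first exact/measurable_EFinP.
have := integral_dm_preserving pT mnu.
by move/integrableP : iu => [_ +] E; rewrite -E.
Qed.

Lemma intR_preserving (T : C -> C) u : dm_preservingC T -> measR u ->
  intR (fun z => u (T z)) = intR u.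
Proof. by move=> pT mu; rewrite /intR /Rintegral (integral_dm_preserving pT mu). Qed.

Lemma integralC_preserving (T : C -> C) h : dm_preservingC T -> measC h ->
  integralC (fun z => h (T z)) = integralC h.
Proof.
move=> pT [h1 h2]; rewrite !integralC_ReIm.
by rewrite (intR_preserving pT h1) (intR_preserving pT h2).
Qed.

End complex_integrals.

(** * Gaussian integrability and the weighted space of square-integrable functions *)

Section gaussian_weight.
Variable R : realType.
Notation C := R[i].
Notation mR := (measurableTypeR R).
Notation RR := (mR * mR)%type.
Notation dm := (@dm R).
Notation gauss := (@gauss R).
Implicit Types (f g h : C -> C) (u v : C -> R).

Lemma gauss_ge0 z : 0 <= gauss z. Proof. exact: expR_ge0. Qed.
Lemma gauss_le1 z : gauss z <= 1.
Proof. by rewrite -expR0 ler_expR oppr_le0 sqr_ge0. Qed.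

Lemma measC_id : measC (fun z : C => z).
Proof. by apply: entire_measC; exact: entire_id. Qed.

Lemma measR_expR u : measR u -> measR (fun z => expR (u z)).
Proof. by move=> mu; apply: measurableT_comp; [exact: measurable_expR|exact: mu]. Qed.

Lemma measR_gauss : measR gauss.
Proof. by apply: measR_expR; exact: (measRN (measC_normsqr measC_id)). Qed.

Lemma measR_norm : measR (@normc R).
Proof. exact: (measC_norm measC_id). Qed.

(** Up to a constant the function is a product of two standard normal densities, so Tonelli's
    theorem applies. Half of the exponent is kept to dominate exp (c |z|) times [gauss] by
    completing the square. *)
Lemma integ_half_gauss : integ (fun z : C => expR (- (normc z ^+ 2 / 2))).
Proof.
have mh : measR (fun z : C => expR (- (normc z ^+ 2 / 2))).
  apply: measR_expR; exact: (measRN (measRM (measC_normsqr measC_id) (measR_cst _))).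
pose n (x : mR) : R := normal_pdf 0 1 x.
pose K : R := (normal_peak (1 : R))^-1.
have K0 : 0 < K by rewrite invr_gt0 normal_peak_gt0// oner_neq0.
have nE x : expR (- (x ^+ 2 / 2)) = K * n x.
  rewrite /n normal_pdfE ?oner_neq0// /K mulrA mulVf ?mul1r; last first.
    by rewrite gt_eqF// normal_peak_gt0// oner_neq0.
  by rewrite /normal_fun subr0 expr1n mulNr.
have fE x y : expR (- (normc (plane (x, y)) ^+ 2 / 2)) = K * n x * (K * n y).
  by rewrite -!nE -expRD sqr_normc_ReIm /=; congr expR; ring.
have n0 x : 0 <= n x by exact: normal_pdf_ge0.
have mn : measurable_fun setT (fun x : mR => (n x)%:E).
  by apply/measurable_EFinP; exact: measurable_normal_pdf.
have intn : (\int[lebesgue_measure]_x (n x)%:E = 1)%E by exact: integral_normal_pdf.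
have intn' (c : R) : 0 <= c -> (\int[lebesgue_measure]_x (c * n x)%:E = c%:E)%E.
  move=> c0; under eq_integral do rewrite EFinM.
  rewrite ge0_integralZl//; [|by move=> x _; rewrite lee_fin n0].
  by rewrite intn mule1.
have mhE : measurable_fun setT (fun p : RR => (expR (- (normc (plane p) ^+ 2 / 2)))%:E).
  exact/measurable_EFinP.
apply/(@integrable12ltyP _ _ _ _ _ lebesgue_measure lebesgue_measure _ mhE).
rewrite [X in (X < _)%E](_ : _ = (\int[lebesgue_measure]_x (K * K * n x)%:E)%E); last first.
  apply: eq_integral => x _.
  rewrite -(intn' (K * K * n x)) ?mulr_ge0 ?(ltW K0)//; apply: eq_integral => y _.
  rewrite fE gee0_abs ?lee_fin ?mulr_ge0 ?(ltW K0)//; congr (_%:E); ring.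
by rewrite intn' ?mulr_ge0 ?(ltW K0)// ltry.
Qed.

Lemma integ_exp_gauss (c : R) : integ (fun z : C => expR (c * normc z) * gauss z).
Proof.
apply: (integ_le _ _ (integZ (expR (c ^+ 2 / 2)) integ_half_gauss)).
  by apply: (measRM _ measR_gauss); apply: measR_expR; exact: (measRM (measR_cst _) measR_norm).
move=> z; rewrite -!expRD ger0_norm ?expR_ge0// ler_expR -subr_ge0.
have -> : c ^+ 2 / 2 + - (normc z ^+ 2 / 2) - (c * normc z + - normc z ^+ 2) = (c - normc z) ^+ 2 / 2.
  by field.
by rewrite divr_ge0// sqr_ge0.
Qed.

Lemma integ_gauss : integ gauss.
Proof.
have := integ_exp_gauss 0; congr integ; apply/funext => z.
by rewrite mul0r expR0 mul1r.
Qed.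

Lemma exp_bound_pow (x : R) k : 0 <= x -> x ^+ k <= k`!%:R * expR x.
Proof.
case: k => [|k] x0; first by rewrite expr0 fact0 mul1r -expR0 ler_expR.
have := expR_ge1Dxn k x0 => h.
rewrite mulrC -ler_pdivrMr ?ltr0n ?fact_gt0//; apply: le_trans h.
by rewrite lerDr.
Qed.

Lemma integ_pow_gauss k : integ (fun z : C => normc z ^+ k * gauss z).
Proof.
apply: (integ_le _ _ (integZ k`!%:R (integ_exp_gauss 1))).
  apply: (measRM _ measR_gauss); rewrite (_ : (fun z => _) = (fun z => normc (z ^+ k))).
    by apply: measC_norm; apply: entire_measC; apply: entireX; exact: entire_id.
  by apply/funext => z; rewrite normcX.
move=> z; rewrite ger0_norm ?mulr_ge0 ?exprn_ge0 ?normc_ge0 ?gauss_ge0//.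
by rewrite mulrA ler_wpM2r ?gauss_ge0// mul1r exp_bound_pow// normc_ge0.
Qed.

Definition disc (a : C) (r : R) : set C := [set z | normc (z - a) < r].

Definition measSet (A : set C) := measurable ((@plane R : RR -> C) @^-1` A).

Lemma measSet_disc a r : measSet (disc a r).
Proof.
apply: openC_measurable => z zr; exists ((r - normc (z - a)) / 2).
  by rewrite divr_gt0// subr_gt0.
move=> h hd; rewrite /disc/= addrAC; apply: le_lt_trans (le_normcD _ _) _.
move: zr hd; rewrite /disc/=; lra.
Qed.

Lemma measR_indic A : measSet A -> measR (fun z => \1_A z).
Proof.
move=> mA; have : measurable_fun setT (\1_((@plane R : RR -> C) @^-1` A) : RR -> R) by [].
by congr (measurable_fun _ _); apply/funext => p; rewrite /indic.
Qed.

Lemma indic_ge0 (A : set C) z : 0 <= (\1_A z : R).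
Proof. by rewrite indicE. Qed.

Lemma indic_le1 (A : set C) z : (\1_A z : R) <= 1.
Proof. by rewrite indicE; case: (_ \in _). Qed.

Lemma disc_norm_lt a r z : disc a r z -> normc z < r + normc a.
Proof.
move=> zr; rewrite -[z](subrK a); apply: le_lt_trans (le_normcD _ _) _.
by rewrite ltrD2r.
Qed.

Lemma integ_indic_disc a r : integ (fun z : C => \1_(disc a r) z : R).
Proof.
apply: (integ_le _ _ (integZ (expR ((r + normc a) ^+ 2)) integ_gauss)).
  by apply: measR_indic; exact: measSet_disc.
move=> z; rewrite ger0_norm ?indic_ge0// indicE; case: (boolP (z \in _)) => [|_].
  rewrite inE => /disc_norm_lt zr; rewrite -expRD -expR0 ler_expR subr_ge0.
  by rewrite ler_sqr ?nnegrE ?normc_ge0 ?(ltW zr) ?(le_trans (normc_ge0 z) (ltW zr)).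
by rewrite mulr_ge0// ?expR_ge0.
Qed.

Lemma disc_mass_gt0 a r : 0 < r -> 0 < intR (fun z : C => \1_(disc a r) z : R).
Proof.
move=> r0; have mD := measSet_disc a r.
have E : ((intR (fun z : C => \1_(disc a r) z : R))%:E = dm ((@plane R : RR -> C) @^-1` (disc a r)))%E.
  rewrite -(intR_EFin (integ_indic_disc a r)).
  apply: etrans _ (etrans (integral_indic dm measurableT mD) _).
    by apply: eq_integral => p _; rewrite /indic.
  by rewrite setIT.
pose B : set RR := `]complex.Re a, complex.Re a + r / 2[ `*` `]complex.Im a, complex.Im a + r / 2[.
have mB : measurable B by apply: measurableX; exact: measurable_itv.
have BD : B `<=` (@plane R : RR -> C) @^-1` (disc a r).
  move=> [x y] [] /=; rewrite !in_itv/= => /andP[x1 x2] /andP[y1 y2].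
  rewrite /disc/=; apply: le_lt_trans (normc_le_ReIm _) _.
  have ab (s t : R) : t < s -> s < t + r / 2 -> `|s - t| < r / 2.
    by move=> h1 h2; rewrite ger0_norm ?subr_ge0 ?ltW//; lra.
  by rewrite [ltRHS]splitr !ReImE /=; apply: ltrD; exact: ab.
have sq (t : R) : lebesgue_measure (`]t, (t + r / 2)[ : set mR) = (r / 2)%:E.
  by rewrite lebesgue_measure_itv/= lte_fin ltrDl divr_gt0// -EFinB addrAC subrr add0r.
have dB : (dm B = (r / 2 * (r / 2))%:E)%E.
  apply: etrans (product_measure1E _ _ _ _) _; try exact: measurable_itv.
  by rewrite EFinM; congr (_ * _)%E; exact: sq.
rewrite -lte_fin E; apply: (@lt_le_trans _ _ (dm B)).
  by rewrite dB lte_fin mulr_gt0// divr_gt0.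
by apply: le_measure; rewrite ?inE.
Qed.

(** The number pi, kept as an unevaluated normalising constant. *)
Definition gauss_mass : R := intR gauss.

Lemma gauss_mass_gt0 : 0 < gauss_mass.
Proof.
have h : expR (- 1) * intR (fun z : C => \1_(disc 0 1) z : R) <= gauss_mass.
  rewrite -intRZ; last exact: integ_indic_disc.
  apply: (intR_le (integZ _ (integ_indic_disc _ _)) integ_gauss) => z.
  rewrite indicE; case: (boolP (z \in _)) => [|_]; last by rewrite mulr0 gauss_ge0.
  rewrite inE /disc/= subr0 mulr1 => z1; rewrite ler_expR lerN2.
  by rewrite expr_le1// ?normc_ge0// ltW.
by apply: lt_le_trans h; rewrite mulr_gt0 ?expR_gt0 ?disc_mass_gt0.
Qed.

Definition L2 f := measC f /\ integ (fun z => normc (f z) ^+ 2 * gauss z).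
Definition nrm2 f : R := intR (fun z => normc (f z) ^+ 2 * gauss z).

Lemma nrm2_ge0 f : 0 <= nrm2 f.
Proof. by apply: intR_ge0 => z; rewrite mulr_ge0 ?gauss_ge0 ?sqr_ge0. Qed.

Lemma measC_gauss : measC (fun z => (gauss z)%:C).
Proof. by apply: measC_real; exact: measR_gauss. Qed.

Lemma normc_mul_le (x y : C) : normc (x * y) <= (normc x ^+ 2 + normc y ^+ 2) / 2.
Proof.
rewrite normcM ler_pdivlMr// -subr_ge0.
have -> : normc x ^+ 2 + normc y ^+ 2 - normc x * normc y * 2 = (normc x - normc y) ^+ 2 by ring.
exact: sqr_ge0.
Qed.

Lemma measC_inner f g : measC f -> measC g -> measC (fun z => f z * (g z)^* * (gauss z)%:C).
Proof.
by move=> mf mg; exact: (measC_mul (measC_mul mf (measC_conj mg)) measC_gauss).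
Qed.

Lemma integ_inner_bound f g : L2 f -> L2 g ->
  integ (fun z => (normc (f z) ^+ 2 * gauss z + normc (g z) ^+ 2 * gauss z)).
Proof. by move=> [_ hf] [_ hg]; exact: (integD hf hg). Qed.

Lemma inner_integrand_le f g z : normc (f z * (g z)^* * (gauss z)%:C) <=
  normc (f z) ^+ 2 * gauss z + normc (g z) ^+ 2 * gauss z.
Proof.
rewrite normcM normc_real ger0_norm ?gauss_ge0// -mulrDl ler_wpM2r ?gauss_ge0//.
apply: le_trans (normc_mul_le _ _) _; rewrite normc_conj.
by rewrite ler_pdivrMr// ler_peMr ?ler1n// addr_ge0 ?sqr_ge0.
Qed.

Lemma cinteg_inner f g : L2 f -> L2 g -> cinteg (fun z => f z * (g z)^* * (gauss z)%:C).
Proof.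
move=> Lf Lg; have [mf _] := Lf; have [mg _] := Lg.
exact: (cinteg_le (measC_inner mf mg) (inner_integrand_le f g) (integ_inner_bound Lf Lg)).
Qed.

Lemma L2D f g : L2 f -> L2 g -> L2 (fun z => f z + g z).
Proof.
move=> Lf Lg; have [mf _] := Lf; have [mg _] := Lg; split; first exact: (measC_add mf mg).
apply: (integ_le _ _ (integZ 2 (integ_inner_bound Lf Lg))).
  by apply: (measRM _ measR_gauss); apply: measC_normsqr; exact: (measC_add mf mg).
move=> z; rewrite ger0_norm ?mulr_ge0 ?gauss_ge0 ?sqr_ge0 ?normc_ge0//.
rewrite -mulrDl mulrA ler_wpM2r ?gauss_ge0//.
apply: (@le_trans _ _ ((normc (f z) + normc (g z)) ^+ 2)).
  by rewrite ler_sqr ?nnegrE ?addr_ge0 ?normc_ge0// le_normcD.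
rewrite -subr_ge0.
have -> : 2 * (normc (f z) ^+ 2 + normc (g z) ^+ 2) - (normc (f z) + normc (g z)) ^+ 2
  = (normc (f z) - normc (g z)) ^+ 2 by ring.
exact: sqr_ge0.
Qed.

Lemma L2_bounded_mul (u f : C -> C) (M : R) : measC u -> (forall z, normc (u z) <= M) -> L2 f ->
  L2 (fun z => u z * f z).
Proof.
move=> mu uM [mf If]; split; first exact: (measC_mul mu mf).
apply: (integ_le _ _ (integZ (M ^+ 2) If)).
  by apply: (measRM _ measR_gauss); apply: measC_normsqr; exact: (measC_mul mu mf).
move=> z; rewrite ger0_norm ?mulr_ge0 ?gauss_ge0 ?sqr_ge0 ?normc_ge0//.
rewrite mulrA ler_wpM2r ?gauss_ge0// normcM exprMn ler_wpM2r ?sqr_ge0//.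
by rewrite ler_sqr ?nnegrE ?normc_ge0//; apply: le_trans (normc_ge0 _) (uM z).
Qed.

Lemma L2Z (c : C) f : L2 f -> L2 (fun z => c * f z).
Proof. by move=> Lf; exact: (L2_bounded_mul (measC_cst c) (fun=> lexx _) Lf). Qed.

Lemma L2B f g : L2 f -> L2 g -> L2 (fun z => f z - g z).
Proof.
move=> Lf Lg; have := L2D Lf (L2Z (-1) Lg); congr L2.
by apply/funext => z; rewrite mulN1r.
Qed.

Lemma L2_0 : L2 (fun=> 0).
Proof.
split; first exact: measC_cst.
by have := integZ 0 integ_gauss; congr integ; apply/funext => z; rewrite normc0 expr0n/=.
Qed.

Lemma L2_sum (I : Type) (r : seq I) (F : I -> C -> C) : (forall i, L2 (F i)) ->
  L2 (fun z => \sum_(i <- r) F i z).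
Proof.
move=> LF; elim: r => [|i r IH].
  by have := L2_0; congr L2; apply/funext => z; rewrite big_nil.
by have := L2D (LF i) IH; congr L2; apply/funext => z; rewrite big_cons.
Qed.

Lemma innerDl f h g : L2 f -> L2 h -> L2 g -> inner (fun z => f z + h z) g = inner f g + inner h g.
Proof.
move=> Lf Lh Lg; rewrite /inner -(integralCD (cinteg_inner Lf Lg) (cinteg_inner Lh Lg)).
by congr integralC; apply/funext => z; rewrite !mulrDl.
Qed.

Lemma innerZl (c : C) f g : L2 f -> L2 g -> inner (fun z => c * f z) g = c * inner f g.
Proof.
move=> Lf Lg; rewrite /inner -(integralCZ c (cinteg_inner Lf Lg)).
by congr integralC; apply/funext => z; rewrite !mulrA.
Qed.

Lemma inner_conj f g : L2 f -> L2 g -> inner g f = (inner f g)^*.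
Proof.
move=> Lf Lg; rewrite /inner -(integralC_conj (cinteg_inner Lf Lg)).
congr integralC; apply/funext => z.
by apply: complex_eq; rewrite !ReImE /=; ring.
Qed.

Lemma inner_self f : L2 f -> inner f f = (nrm2 f)%:C.
Proof.
move=> [mf If]; rewrite /inner integralC_ReIm /nrm2; apply: complex_eq => /=.
  by congr intR; apply/funext => z; rewrite mulc_conj -rmorphM.
rewrite /intR /Rintegral integral0_eq// => p _.
by rewrite mulc_conj -rmorphM.
Qed.

Lemma fock_L2 f : fock f -> L2 f.
Proof.
move=> [ef If]; split; first exact: entire_measC.
apply/integ_lty => //.
  by apply: (measRM _ measR_gauss); apply: measC_normsqr; exact: entire_measC.
by move=> z; rewrite mulr_ge0 ?gauss_ge0 ?sqr_ge0.
Qed.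

Lemma fockE f : entire f -> L2 f -> fock f.
Proof.
move=> ef [mf If]; split; first exact: ef.
have mu : measR (fun z => normc (f z) ^+ 2 * gauss z).
  by apply: (measRM _ measR_gauss); apply: measC_normsqr.
have u0 z : 0 <= normc (f z) ^+ 2 * gauss z by rewrite mulr_ge0 ?gauss_ge0 ?sqr_ge0.
exact: (proj2 (integ_lty mu u0) If).
Qed.

End gaussian_weight.

(** * The reproducing formula and the monomial basis *)

Section mean_value.
Variable R : realType.
Notation C := R[i].
Notation mR := (measurableTypeR R).
Notation RR := (mR * mR)%type.
Notation dm := (@dm R).
Notation gauss := (@gauss R).
Notation mu := (@lebesgue_measure R).
Implicit Types (f g h : C -> C).

Lemma entire_cr h : entire h -> cr_differentiable (fun x y : R => complex.Re (h (x +i* y)))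
  (fun x y : R => complex.Im (h (x +i* y))).
Proof.
move=> /entireP eh x0 y0; have [A HA] := eh (x0 +i* y0).
exists (complex.Re A), (- complex.Im A), (complex.Im A) => e e0.
have [d d0 Hd] := HA _ e0; exists (d / 2); first by rewrite divr_gt0.
move=> x y hx hy.
pose k : C := (x - x0) +i* (y - y0).
have kn : normc k <= `|x - x0| + `|y - y0| by exact: normc_le_ReIm.
have kd : normc k <= d by apply: le_trans kn _; rewrite [d]splitr lerD.
have xyE : x +i* y = x0 +i* y0 + k by apply: complex_eq => /=; ring.
have := Hd k kd; rewrite -xyE.
set v : C := h (x +i* y) - h (x0 +i* y0) - A * k => hv.
have hv' : normc v <= e * (`|x - x0| + `|y - y0|).
  by apply: le_trans hv _; rewrite ler_pM2l.
by split; [have := Re_le_normc v|have := Im_le_normc v] => /le_trans/(_ hv');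
  rewrite /v !ReImE /=; congr (`|_| <= _); ring.
Qed.

Lemma dm_sigma_finite : sigma_finite setT dm.
Proof.
pose I (n : nat) : set mR := [set` `]- n%:R, n%:R[].
exists (fun n => I n `*` I n) => [|n].
  apply/esym; rewrite -subTset => -[x y] _.
  exists (Num.bound (Num.max `|x| `|y|)) => //.
  have := @archi_boundP _ (Num.max `|x| `|y|); rewrite le_max normr_ge0 => /(_ isT).
  by rewrite gt_max !ltr_norml => /andP[hx hy]; split; rewrite /I /= in_itv.
split; first by apply: measurableX; exact: measurable_itv.
have E : dm (I n `*` I n) = (mu (I n) * mu (I n))%E.
  by apply: product_measure1E; exact: measurable_itv.
have f : (mu (I n) < +oo)%E by rewrite lebesgue_measure_itv/=; case: ifP => _; rewrite ?ltry// -EFinB ltry.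
by rewrite E lte_mul_pinfty// ge0_fin_numE.
Qed.

(** A copy of [dm] that carries the sigma-finite structure demanded by Fubini's theorem. *)
Definition dms : set RR -> \bar R := fun A => dm A.
HB.instance Definition _ := @isMeasure.Build _ _ _ dms
  (measure0 dm) (fun A => measure_ge0 dm A) (@measure_semi_sigma_additive _ _ _ dm).
HB.instance Definition _ := @Measure_isSigmaFinite.Build _ _ _ dms dm_sigma_finite.

Definition unimod (t : R) : C := cexp (0 +i* t).

Lemma normc_unimod t : normc (unimod t) = 1.
Proof. by rewrite normc_cexp expR0. Qed.

(** [goursat] for s |-> h (e^s z) on [x, 0] x [0, 2 pi]: the horizontal sides agree by periodicity
    of the exponential, so the mean over the circle of radius e^x |z| is the same for all x <= 0,
    and x -> -oo gives h 0. *)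
Lemma circle_mean h z : entire h ->
  itg (fun t => complex.Re (h (unimod t * z))) 0 (pi *+ 2) = complex.Re (h 0) * (pi *+ 2).
Proof.
move=> eh; pose H s := h (cexp s * z).
have eH : entire H.
  exact: (entire_comp eh (entireM (@cexp_entire R) (@entire_cst R z))).
have PQ := entire_cr eH.
set P := fun x y : R => complex.Re (H (x +i* y)) in PQ.
have p0 : (0 : R) <= pi *+ 2 by rewrite mulrn_wge0// pi_ge0.
have indep x : x <= 0 -> itg (P 0) 0 (pi *+ 2) = itg (P x) 0 (pi *+ 2).
  move=> x0; apply/eqP; rewrite -subr_eq0; apply/eqP.
  rewrite (goursat PQ x0 p0); apply/eqP; rewrite subr_eq0; apply/eqP; congr itg.
  by apply/funext => s; rewrite /H /cexp /= cos2pi sin2pi cos0 sin0.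
have -> : (fun t => complex.Re (h (unimod t * z))) = P 0 by [].
apply/eqP; rewrite -subr_eq0 -normr_le0; apply/ler_addgt0Pl => e e0; rewrite addr0.
have e1 : 0 < e / (1 + pi *+ 2) by rewrite divr_gt0// ltr_pwDl.
have [d d0 Hd] := entire_continuous 0 eh e1.
(* [x] is so negative that e^x |z| <= d, where h is close to h 0. *)
pose x := Num.min 0 (ln (d / (1 + normc z))).
have x0 : x <= 0 by rewrite ge_min lexx.
have q0 : 0 < 1 + normc z by rewrite ltr_pwDl ?normc_ge0.
have xd : expR x * normc z <= d.
  apply: (@le_trans _ _ (d / (1 + normc z) * normc z)).
    rewrite ler_wpM2r ?normc_ge0// -[leRHS]lnK ?posrE ?divr_gt0// ler_expR.
    by rewrite ge_min lexx orbT.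
  rewrite mulrAC ler_pdivrMr// ler_wpM2l ?(ltW d0)// lerDr//.
rewrite (indep x x0) -[X in _ - _ * X]subr0.
apply: (le_trans (itg_approx (K := complex.Re (h 0)) (e := e / (1 + pi *+ 2)) _ p0 _)).
- exact: (cr_continuous_r PQ).
- move=> y _; rewrite /P /H -ReN -ReD; apply: le_trans (Re_le_normc _) _.
  by have := Hd (cexp (x +i* y) * z); rewrite add0r normcM normc_cexp; apply.
rewrite subr0 mulrAC ler_pdivrMr ?ltr_pwDl// ler_wpM2l ?(ltW e0)// lerDr//.
Qed.

(** The integral does not change under a rotation of the argument, hence equals its average over all
    angles. Fubini's theorem moves this average inside, where [circle_mean] evaluates it. *)
Lemma gaussian_mean_Re h : entire h -> integ (fun z => normc (h z) * gauss z) ->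
  intR (fun z => complex.Re (h z) * gauss z) = complex.Re (h 0) * gauss_mass R.
Proof.
move=> eh ih; have [mhR mhI] := entire_measC eh.
pose D : set mR := [set` `[0, pi *+ 2]].
have mD : measurable D by exact: measurable_itv.
have p0 : (0 : R) <= pi *+ 2 by rewrite mulrn_wge0// pi_ge0.
have p1 : (0 : R) < pi *+ 2 by rewrite mulrn_wgt0// pi_gt0.
have muD : mu D = (pi *+ 2)%:E.
  rewrite lebesgue_measure_itv/= lte_fin p1 -EFinB subr0//.
pose u z := complex.Re (h z) * gauss z.
have mu_ : measR u by exact: (measRM mhR (@measR_gauss R)).
have iu : integ u.
  apply: (integ_le mu_ _ ih) => z; rewrite normrM (ger0_norm (gauss_ge0 z)).
  by rewrite ler_wpM2r ?gauss_ge0// Re_le_normc.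
have gaussu t z : gauss (unimod t * z) = gauss z by rewrite /gauss normcM normc_unimod mul1r.
have inv t : integ (fun z => u (unimod t * z)) /\ intR (fun z => u (unimod t * z)) = intR u.
  have pT := dm_preserving_rotation (normc_unimod t).
  by split; [exact: (integ_preserving pT iu)|exact: (intR_preserving pT mu_)].
pose F (q : mR * RR) : R := \1_D q.1 * u (unimod q.1 * plane q.2).
have mF : measurable_fun setT F.
  apply: measurable_funM.
    have m1D : measurable_fun setT (\1_D : mR -> R) by exact: measurable_indic.
    exact: (measurableT_comp m1D measurable_fst).
  pose rot (q : mR * RR) : RR :=
    (cos q.1 * q.2.1 - sin q.1 * q.2.2, cos q.1 * q.2.2 + sin q.1 * q.2.1).
  have -> : (fun q : mR * RR => u (unimod q.1 * plane q.2)) = (fun p => u (plane p)) \o rot.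
    apply/funext => -[t [x y]] /=; congr u.
    by apply: complex_eq; rewrite !ReImE /= expR0 !mul1r.
  apply: (measurableT_comp mu_).
  have mc : measurable_fun setT (fun q : mR * RR => cos q.1 : mR).
    have m0 : measurable_fun setT (@cos R : mR -> R).
      by apply: continuous_measurable_fun; exact: continuous_cos.
    exact: (measurableT_comp m0 measurable_fst).
  have ms : measurable_fun setT (fun q : mR * RR => sin q.1 : mR).
    have m0 : measurable_fun setT (@sin R : mR -> R).
      by apply: continuous_measurable_fun; exact: continuous_sin.
    exact: (measurableT_comp m0 measurable_fst).
  have m1 : measurable_fun setT (fun q : mR * RR => q.2.1).
    exact: (measurableT_comp measurable_fst measurable_snd).
  have m2 : measurable_fun setT (fun q : mR * RR => q.2.2).
    exact: (measurableT_comp measurable_snd measurable_snd).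
  apply/measurable_fun_pairP; split.
    by apply: measurable_funB; exact: measurable_funM.
  by apply: measurable_funD; exact: measurable_funM.
have mFE : measurable_fun setT (fun q => (F q)%:E) by exact/measurable_EFinP.
have intFx t : (\int[dm]_p `|(F (t, p))%:E| = (\1_D t * intR (fun z => `|u z|))%:E)%E.
  have [it _] := inv t.
  have int1 := integ_norm it.
  transitivity (\int[dm]_p (\1_D t * `|u (unimod t * plane p)|)%:E)%E.
    by apply: eq_integral => p _ /=; rewrite normrM ger0_norm ?indicE.
  rewrite (intR_EFin (u := fun z => \1_D t * `|u (unimod t * z)|)); last exact: (integZ _ int1).
  have E1 := intRZ (\1_D t) int1.
  have E2 : intR (fun z => `|u (unimod t * z)|) = intR (fun z => `|u z|).
    apply: (@intR_preserving _ (fun z => unimod t * z) (fun z => `|u z|)).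
      exact: (dm_preserving_rotation (normc_unimod t)).
    exact: (integ_meas (integ_norm iu)).
  by rewrite E1 E2.
have intFx' t : (\int[dm]_p (F (t, p))%:E = (\1_D t * intR u)%:E)%E.
  have [it E] := inv t.
  rewrite (intR_EFin (u := fun z => \1_D t * u (unimod t * z))); last exact: (integZ _ it).
  by rewrite (intRZ (\1_D t) it) E.
have indD (c : R) : (\int[mu]_t (\1_D t * c)%:E = (c * (pi *+ 2))%:E)%E.
  transitivity (\int[mu]_(t in D) c%:E)%E.
    rewrite [RHS]integral_mkcond; apply: eq_integral => t _.
    by rewrite patchE indicE; case: (t \in D); rewrite ?mul1r ?mul0r.
  rewrite integral_cst; last exact: mD.
  by rewrite EFinM; congr (_ * _)%E; exact: muD.
have iF : (mu \x dms)%E.-integrable setT (fun q => (F q)%:E).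
  apply/(@integrable12ltyP _ _ _ _ _ mu dms _ mFE).
  under eq_integral do rewrite intFx.
  by rewrite indD ltry.
have := Fubini iF.
rewrite -[X in (X = _) -> _]/(\int[mu]_x \int[dm]_y (F (x, y))%:E)%E.
rewrite -[X in (_ = X) -> _]/(\int[dm]_y \int[mu]_x (F (x, y))%:E)%E.
under eq_integral do rewrite intFx'.
rewrite indD => E.
have : (\int[dm]_p \int[mu]_t (F (t, p))%:E = \int[dm]_p ((complex.Re (h 0) * (pi *+ 2)) * gauss (plane p))%:E)%E.
  apply: eq_integral => p _.
  transitivity (\int[mu]_(t in D) (u (unimod t * plane p))%:E)%E.
    rewrite [RHS]integral_mkcond; apply: eq_integral => t _.
    by rewrite patchE /F/= indicE; case: (t \in D); rewrite ?mul1r ?mul0r.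
  rewrite -(circle_mean (plane p) eh) /itg /Rintegral.
  transitivity (\int[mu]_(t in D) ((gauss (plane p))%:E * (complex.Re (h (unimod t * plane p)))%:E))%E.
    by apply: eq_integral => t _; rewrite /u gaussu -EFinM mulrC.
  have ci : mu.-integrable D (fun t => (complex.Re (h (unimod t * plane p)))%:E).
    apply: (integrable_segment (g := fun t => complex.Re (h (unimod t * plane p)))).
    have eH : entire (fun s => h (cexp s * plane p)).
      exact: (entire_comp eh (entireM (@cexp_entire R) (@entire_cst R _))).
    exact: (cr_continuous_r (entire_cr eH) (x0 := 0)).
  rewrite integralZl// EFinM muleC fineK//.
  exact: integrable_fin_num.
move=> E2; move: E; rewrite E2.
rewrite (intR_EFin (u := fun z => complex.Re (h 0) * (pi *+ 2) * gauss z)); last first.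
  by apply: integZ; exact: integ_gauss.
rewrite intRZ; last exact: integ_gauss.
by move=> [] /eqP; rewrite mulrAC => /eqP/(mulIf (lt0r_neq0 p1)).
Qed.

Lemma gaussian_mean h : entire h -> integ (fun z => normc (h z) * gauss z) ->
  integralC (fun z => h z * (gauss z)%:C) = h 0 * (gauss_mass R)%:C.
Proof.
move=> eh ih; rewrite integralC_ReIm; apply: complex_eq; rewrite !ReImE /=.
  rewrite mulr0 subr0 -gaussian_mean_Re//; congr intR; apply/funext => z.
  by rewrite !ReImE /= mulr0 subr0.
rewrite mulr0 add0r.
pose k z := - 'i%C * h z.
have ek : entire k by exact: (entireM (@entire_cst R _) eh).
have kE z : complex.Re (k z) = complex.Im (h z) by rewrite /k !ReImE /=; ring.
have nk z : normc (k z) = normc (h z).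
  by rewrite normcM normcN /= expr0n expr1n add0r sqrtr1 mul1r.
rewrite -[complex.Im (h 0)]kE -gaussian_mean_Re//.
  by congr intR; apply/funext => z; rewrite kE ImM /= mulr0 add0r.
by under eq_fun do rewrite nk.
Qed.

End mean_value.

(** * The reproducing kernel and the orthonormal monomials *)

Section reproducing.
Variable R : realType.
Notation C := R[i].
Notation gauss := (@gauss R).
Notation c0 := (gauss_mass R).
Implicit Types (f g h : C -> C).

Lemma conj_real (x : R) : (x%:C : C)^* = x%:C.
Proof. exact: conjc_real. Qed.

Lemma cexp_conj (z : C) : cexp z^* = (cexp z)^*.
Proof. by case: z => a b; apply: complex_eq => /=; rewrite ?cosN ?sinN ?mulrN. Qed.

Lemma cexp_real (x : R) : cexp x%:C = (expR x)%:C.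
Proof. by apply: complex_eq => /=; rewrite ?cos0 ?sin0 ?mulr1 ?mulr0. Qed.

Lemma gauss_cexp (z : C) : (gauss z)%:C = cexp (- (z * z^*)).
Proof. by rewrite mulc_conj -rmorphN cexp_real. Qed.

Definition kern (w z : C) : C := cexp (w^* * z).

Lemma kern_entire w : entire (kern w).
Proof. exact: (entire_comp (@cexp_entire R) (entireM (@entire_cst R _) (@entire_id R))). Qed.

Lemma integ_kern_bound w : integ (fun z : C => expR (normc w * normc z) ^+ 2 * gauss z).
Proof.
have := integ_exp_gauss (2 * normc w); congr integ; apply/funext => z.
by rewrite -expRM_natl mulr_natl mulr2n; congr (expR _ * _); ring.
Qed.

Lemma kern_L2 w : L2 (kern w).
Proof.
have mk := entire_measC (@kern_entire w); split=> //.
apply: (integ_le (measRM (measC_normsqr mk) (@measR_gauss R)) _ (integ_kern_bound w)) => z.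
rewrite ger0_norm ?mulr_ge0 ?gauss_ge0 ?sqr_ge0 ?normc_ge0// ler_wpM2r ?gauss_ge0//.
rewrite ler_sqr ?nnegrE ?normc_ge0 ?expR_ge0//.
by apply: le_trans (normc_cexp_le _) _; rewrite normcM normc_conj.
Qed.

(** The auxiliary h z = f (z + w) exp (- conj w z) has value f w at 0, and translating h times
    [gauss] by w gives exactly the integrand of the inner product with the kernel. The Gaussian mean
    value of h does the rest. *)
Lemma reproducing f w : fock f -> inner f (kern w) = f w * c0%:C.
Proof.
move=> Ff; have [ef _] := Ff; have Lf := fock_L2 Ff; have [mf _] := Lf.
have [mk _] := kern_L2 w.
pose h z := f (z + w) * cexp (- w^* * z).
pose k z := f z * (kern w z)^* * (gauss z)%:C.
have eh : entire h.
  apply: entireM.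
    exact: (entire_comp ef (entireD (@entire_id R) (@entire_cst R w))).
  exact: (entire_comp (@cexp_entire R) (entireM (@entire_cst R _) (@entire_id R))).
have hk z : h (z - w) * (gauss (z - w))%:C = k z.
  rewrite /h /k subrK -!mulrA; congr (_ * _).
  rewrite /kern -cexp_conj !gauss_cexp -!cexpD; congr cexp.
  by apply: complex_eq; rewrite !ReImE; ring.
have mkk : measC k by exact: measC_inner.
have ik : integ (fun z => normc (k z)).
  apply: (integ_le (measC_norm mkk) _ (integ_inner_bound Lf (kern_L2 w))) => z.
  by rewrite ger0_norm ?normc_ge0// inner_integrand_le.
have ih : integ (fun z => normc (h z) * gauss z).
  have := integ_preserving (dm_preserving_translation w) ik; congr integ; apply/funext => z.
  by rewrite -hk addrK normcM normc_real ger0_norm ?gauss_ge0.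
have mhg : measC (fun z => h z * (gauss z)%:C).
  exact: (measC_mul (entire_measC eh) (@measC_gauss R)).
have := gaussian_mean eh ih.
rewrite -(integralC_preserving (dm_preserving_translation (- w)) mhg) /h add0r mulr0 cexp0 mulr1.
move=> <-; rewrite /inner; congr integralC; apply/funext => z; exact: esym (hk z).
Qed.

Definition mon (k : nat) (z : C) : C := z ^+ k.

Lemma mon_entire k : entire (mon k).
Proof. by rewrite /mon; exact: (@entireX R (fun z => z) k (@entire_id R)). Qed.

Lemma mon_L2 k : L2 (mon k).
Proof.
split; first exact: (entire_measC (@mon_entire k)).
have := integ_pow_gauss R (k + k); congr integ; apply/funext => z.
by rewrite normcX -exprM muln2 addnn.
Qed.

Lemma mon_fock k : fock (mon k).
Proof. exact: (fockE (@mon_entire k) (mon_L2 k)). Qed.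

Lemma innerZr (c : C) f g : L2 f -> L2 g -> inner f (fun z => c * g z) = c^* * inner f g.
Proof.
move=> Lf Lg; rewrite (inner_conj (L2Z c Lg) Lf) innerZl// rmorphM/=.
by rewrite -inner_conj.
Qed.

Lemma innerDr f g h : L2 f -> L2 g -> L2 h ->
  inner f (fun z => g z + h z) = inner f g + inner f h.
Proof.
move=> Lf Lg Lh; rewrite (inner_conj (L2D Lg Lh) Lf) innerDl// rmorphD/=.
by rewrite -!inner_conj.
Qed.

Lemma inner0l g : inner (fun=> 0) g = 0.
Proof.
rewrite /inner integralC_ReIm; apply: complex_eq => /=; rewrite /intR /Rintegral integral0_eq// => p _.
  by rewrite !mul0r.
by rewrite !mul0r.
Qed.

Lemma inner_suml (I : Type) (r : seq I) (a : I -> C) (F : I -> C -> C) g :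
  (forall i, L2 (F i)) -> L2 g ->
  inner (fun z => \sum_(i <- r) a i * F i z) g = \sum_(i <- r) a i * inner (F i) g.
Proof.
move=> LF Lg; elim: r => [|i r IH].
  have -> : (fun z => \sum_(i <- [::]) a i * F i z) = (fun=> 0).
    by apply/funext => z; rewrite big_nil.
  by rewrite big_nil inner0l.
have -> : (fun z => \sum_(j <- i :: r) a j * F j z) =
    (fun z => a i * F i z + \sum_(j <- r) a j * F j z).
  by apply/funext => z; rewrite big_cons.
have Ls : L2 (fun z => \sum_(j <- r) a j * F j z).
  by apply: L2_sum => j; exact: (L2Z _ (LF j)).
by rewrite big_cons (innerDl (L2Z (a i) (LF i)) Ls Lg) (innerZl (a i) (LF i) Lg) IH.
Qed.

Lemma inner_sumr (I : Type) (r : seq I) (a : I -> C) (F : I -> C -> C) f :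
  (forall i, L2 (F i)) -> L2 f ->
  inner f (fun z => \sum_(i <- r) a i * F i z) = \sum_(i <- r) (a i)^* * inner f (F i).
Proof.
move=> LF Lf.
have Ls : L2 (fun z => \sum_(j <- r) a j * F j z).
  by apply: L2_sum => j; exact: (L2Z _ (LF j)).
rewrite (inner_conj Ls Lf) (inner_suml _ _ LF Lf) rmorph_sum.
by apply: eq_bigr => i _; rewrite rmorphM/= -(inner_conj (LF i) Lf).
Qed.

(** The exponential series of the kernel is integrated term by term; its partial sums obey the same
    bound exp (|w| |z|) as the kernel, which gives the dominating function. *)
Lemma kern_sum_tends f w : fock f ->
  ctends (fun n => \sum_(k < n) w ^+ k / k`!%:R * inner f (mon k)) (f w * c0%:C).
Proof.
move=> Ff; have Lf := fock_L2 Ff; have [mf _] := Lf.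
rewrite -(reproducing w Ff).
pose S n z := cexp_sum n (w^* * z).
have SE n : S n = fun z => \sum_(k < n) ((w ^+ k / k`!%:R)^*) * mon k z.
  apply/funext => z; apply: eq_bigr => k _.
  by rewrite exprMn rmorphM/= rmorphXn/= fmorphV/= rmorph_nat mulrAC.
have LS n : L2 (S n) by rewrite SE; apply: L2_sum => k; exact: (L2Z _ (mon_L2 k)).
have -> : (fun n => \sum_(k < n) w ^+ k / k`!%:R * inner f (mon k)) = (fun n => inner f (S n)).
  apply/funext => n; rewrite SE inner_sumr//; last by move=> k; exact: mon_L2.
  by apply: eq_bigr => k _; congr (_ * _); exact: esym (conjcK _).
have [mk _] := kern_L2 w.
apply: (integralC_cvg (v := fun z => normc (f z) ^+ 2 * gauss z + expR (normc w * normc z) ^+ 2 * gauss z)).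
- by move=> n; have [mS _] := LS n; exact: measC_inner.
- exact: measC_inner.
- move=> z e e0.
  have d0 : 0 < e / (1 + normc (f z)) by rewrite divr_gt0// ltr_pwDl// normc_ge0.
  apply: filterS (@cexp_sum_tends _ (w^* * z) _ d0) => n hn.
  rewrite -mulrBl -mulrBr normcM normcM -rmorphB normc_conj normc_real ger0_norm ?gauss_ge0//.
  apply: (@le_trans _ _ (normc (f z) * (e / (1 + normc (f z))) * 1)).
    apply: ler_pM; rewrite ?mulr_ge0 ?normc_ge0 ?gauss_ge0 ?gauss_le1//.
    by rewrite ler_wpM2l ?normc_ge0.
  rewrite mulr1 mulrCA ler_piMr ?(ltW e0)// ler_pdivrMr ?mul1r ?lerDr//.
  by rewrite ltr_pwDl// normc_ge0.
- by have [_ If] := Lf; exact: (integD If (integ_kern_bound w)).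
- move=> n z; apply: le_trans (inner_integrand_le _ _ _) _; rewrite lerD2l.
  rewrite ler_wpM2r ?gauss_ge0// ler_sqr ?nnegrE ?normc_ge0 ?expR_ge0//.
  by apply: le_trans (cexp_sum_le _ _) _; rewrite normcM normc_conj.
Qed.

Lemma unimodX (t : R) n : unimod t ^+ n = unimod (n%:R * t).
Proof.
elim: n => [|n IH]; first by rewrite expr0 mul0r /unimod cexp0.
rewrite exprS IH /unimod -cexpD; congr cexp; apply: complex_eq => /=; first by rewrite addr0.
by rewrite -natr1; ring.
Qed.

(* A rotation that multiplies the integrand by -1 leaves the integral unchanged. *)
Lemma radial_orthogonal (w : C -> R) (M : R) j k : measR w -> (forall z, `|w z| <= M) ->
  (forall u z, normc u = 1 -> w (u * z) = w z) -> j != k ->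
  inner (fun z => (w z)%:C * mon j z) (mon k) = 0.
Proof.
move=> mw wM wu jk; pose d : R := j%:R - k%:R.
have d0 : d != 0 by rewrite subr_eq0 eqr_nat.
pose t := pi / d; pose u : C := unimod t.
have Lj : L2 (fun z => (w z)%:C * mon j z).
  by apply: (L2_bounded_mul (measC_real mw) _ (mon_L2 j)) => z; rewrite normc_real; exact: wM.
have mi : measC (fun z => (w z)%:C * mon j z * (mon k z)^* * (gauss z)%:C).
  by have [m1 _] := Lj; have [m2 _] := mon_L2 k; exact: measC_inner.
have uE : u ^+ j * (u ^+ k)^* = -1.
  rewrite !unimodX /unimod -cexp_conj -cexpD.
  have -> : (0 +i* (j%:R * t)) + (0 +i* (k%:R * t))^* = 0 +i* pi :> C.
    by apply: complex_eq => /=; rewrite ?addr0// -mulNr -mulrDl -/d /t mulrC divfK.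
  by apply: complex_eq => /=; rewrite expR0 mul1r ?cospi ?sinpi// oppr0.
have := integralC_preserving (dm_preserving_rotation (normc_unimod t)) mi.
rewrite -/u (_ : (fun z => _) = fun z => (-1) * ((w z)%:C * mon j z * (mon k z)^* * (gauss z)%:C)); last first.
  apply/funext => z; rewrite /mon !exprMn rmorphM/= -uE wu ?normc_unimod//.
  rewrite (_ : gauss (u * z) = gauss z); first by ring.
  by rewrite /gauss normcM normc_unimod mul1r.
rewrite integralCZ; last exact: (cinteg_inner Lj (mon_L2 k)).
rewrite mulN1r -/(inner (fun z => (w z)%:C * mon j z) (mon k)) => /esym/eqP.
by rewrite -addr_eq0 -mulr2n mulrn_eq0 /= => /eqP.
Qed.

Lemma mon_orthogonal j k : j != k -> inner (mon j) (mon k) = 0 :> C.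
Proof.
move=> jk; have h1 (z : C) : `|1 : R| <= 1 by rewrite normr1.
have E : (fun z : C => (1 : R)%:C * mon j z) = mon j by apply/funext => z; rewrite mul1r.
by rewrite -[mon j]E; exact: (radial_orthogonal (@measR_cst R 1) h1 (fun _ _ _ => erefl) jk).
Qed.

(** No integral is computed: in the expansion of z^k at w = 1 only the term of index k survives, so
    <z^k, z^k> / k! = c0. *)
Lemma mon_norm k : inner (mon k) (mon k) = (k`!%:R * c0)%:C :> C.
Proof.
have h := kern_sum_tends 1 (mon_fock k); rewrite /mon expr1n mul1r in h.
have f0 : (k`!%:R : C) != 0 by rewrite pnatr_eq0 -lt0n fact_gt0.
have h2 : ctends (fun n => \sum_(j < n) 1 ^+ j / j`!%:R * inner (mon k) (mon j))
    ((k`!%:R)^-1 * inner (mon k) (mon k) : C).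
  move=> e e0; exists k.+1 => // n /= kn.
  rewrite (bigD1 (Ordinal kn))//= big1 ?addr0; last first.
    by move=> j jk; rewrite mon_orthogonal ?mulr0// eq_sym.
  by rewrite expr1n mul1r subrr normc0 ltW.
have := ctends_unique h2 h => E.
by rewrite rmorphM/= rmorph_nat -E mulrA mulfV// mul1r.
Qed.

Definition enorm (k : nat) : R := (Num.sqrt (k`!%:R * c0))^-1.
Definition ebas (k : nat) (z : C) : C := (enorm k)%:C * mon k z.

Lemma enorm_gt0 k : 0 < enorm k.
Proof. by rewrite invr_gt0 sqrtr_gt0 mulr_gt0 ?gauss_mass_gt0// ltr0n fact_gt0. Qed.

Lemma enorm_sqr k : enorm k ^+ 2 = (k`!%:R * c0)^-1.
Proof.
by rewrite exprVn sqr_sqrtr// ltW// mulr_gt0 ?gauss_mass_gt0// ltr0n fact_gt0.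
Qed.

Lemma ebas_L2 k : L2 (ebas k). Proof. exact: (L2Z _ (mon_L2 k)). Qed.
Lemma ebas_entire k : entire (ebas k).
Proof. exact: (entireM (@entire_cst R _) (@mon_entire k)). Qed.
Lemma ebas_fock k : fock (ebas k). Proof. exact: (fockE (@ebas_entire k) (ebas_L2 k)). Qed.

Lemma inner_ebas f k : L2 f -> inner f (ebas k) = (enorm k)%:C * inner f (mon k).
Proof. by move=> Lf; rewrite /ebas (innerZr _ Lf (mon_L2 k)) conj_real. Qed.

Lemma ebas_orthonormal j k : inner (ebas j) (ebas k) = (j == k)%:R :> C.
Proof.
rewrite inner_ebas; last exact: ebas_L2.
rewrite innerZl; [|exact: mon_L2..].
have [->|jk] := eqVneq j k; last by rewrite mon_orthogonal// !mulr0.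
rewrite mon_norm -!rmorphM/= mulrA -expr2 enorm_sqr mulVf//.
by rewrite gt_eqF// mulr_gt0 ?gauss_mass_gt0// ltr0n fact_gt0.
Qed.

Lemma fock_expand f w : fock f ->
  ctends (fun n => \sum_(k < n) inner f (ebas k) * ebas k w) (f w).
Proof.
move=> Ff; have Lf := fock_L2 Ff.
have h := ctendsMl (c0%:C)^-1 (kern_sum_tends w Ff).
have cn : (c0%:C : C) != 0 by rewrite (inj_eq (@complexI R)) gt_eqF// gauss_mass_gt0.
rewrite mulrC mulfK// in h; move: h; congr ctends; apply/funext => n.
rewrite mulr_sumr; apply: eq_bigr => k _; rewrite inner_ebas// /ebas /mon.
have -> : (enorm k)%:C * inner f (mon k) * ((enorm k)%:C * w ^+ k) =
   (enorm k ^+ 2)%:C * (inner f (mon k) * w ^+ k) by rewrite rmorphXn/=; ring.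
have -> : ((enorm k ^+ 2)%:C : C) = (c0%:C)^-1 * (k`!%:R)^-1.
  rewrite enorm_sqr (fmorphV (real_complex R)) rmorphM/= -(rmorph_nat (real_complex R)).
  by rewrite invfM mulrC.
by ring.
Qed.

End reproducing.

Section real_inequalities.
Variable R : realType.

Lemma sum_cauchy_schwarz (I : Type) (r : seq I) (P : pred I) (x y : I -> R) :
  (forall i, 0 <= x i) -> (forall i, 0 <= y i) ->
  (\sum_(i <- r | P i) x i * y i) ^+ 2 <=
  (\sum_(i <- r | P i) x i ^+ 2) * (\sum_(i <- r | P i) y i ^+ 2).
Proof.
move=> x0 y0.
have : 0 <= \sum_(i <- r | P i) x i * y i /\ (\sum_(i <- r | P i) x i * y i) ^+ 2 <=
  (\sum_(i <- r | P i) x i ^+ 2) * (\sum_(i <- r | P i) y i ^+ 2) /\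
   0 <= \sum_(i <- r | P i) x i ^+ 2 /\ 0 <= \sum_(i <- r | P i) y i ^+ 2.
  elim: r => [|i r [S0 [IH [X0 Y0]]]]; first by rewrite !big_nil expr0n mulr0.
  rewrite !big_cons; case: ifP => // _.
  move: S0 IH X0 Y0; set S := \sum_(j <- r | P j) _; set X := \sum_(j <- r | P j) _;
    set Y := \sum_(j <- r | P j) _ => S0 IH X0 Y0.
  have xi := x0 i; have yi := y0 i.
  rewrite !addr_ge0 ?mulr_ge0 ?sqr_ge0//; split => //; split => //.
  have h : 2 * S * (x i * y i) <= X * y i ^+ 2 + x i ^+ 2 * Y.
    rewrite -ler_sqr ?nnegrE ?mulr_ge0 ?addr_ge0 ?mulr_ge0 ?sqr_ge0//.
    have h1 : (2 * S * (x i * y i)) ^+ 2 <= 4 * (X * Y) * (x i * y i) ^+ 2.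
      rewrite exprMn ler_wpM2r ?sqr_ge0// exprMn (_ : 2 ^+ 2 = 4) ?ler_wpM2l//.
      by rewrite -natrX.
    apply: le_trans h1 _; rewrite -subr_ge0.
    have -> : (X * y i ^+ 2 + x i ^+ 2 * Y) ^+ 2 - 4 * (X * Y) * (x i * y i) ^+ 2 =
      (X * y i ^+ 2 - x i ^+ 2 * Y) ^+ 2 by ring.
    exact: sqr_ge0.
  have -> : (x i * y i + S) ^+ 2 = (x i * y i) ^+ 2 + S ^+ 2 + 2 * S * (x i * y i) by ring.
  have -> : (x i ^+ 2 + X) * (y i ^+ 2 + Y) =
    (x i * y i) ^+ 2 + X * Y + (X * y i ^+ 2 + x i ^+ 2 * Y) by ring.
  by rewrite !lerD.
by case=> _ [].
Qed.

(** The tail is compared with a shifted full series through n! k! <= (n + k)!. *)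
Lemma exp_tail_le (x : R) n m : 0 <= x -> \sum_(n <= k < m) x ^+ k / k`!%:R <= x ^+ n / n`!%:R * expR x.
Proof.
move=> x0; have [mn|nm] := leqP m n.
  by rewrite big_geq// mulr_ge0 ?expR_ge0// divr_ge0// exprn_ge0.
rewrite -{1}[n]add0n big_addn.
apply: (@le_trans _ _ (x ^+ n / n`!%:R * \sum_(0 <= k < m - n) x ^+ k / k`!%:R)).
  rewrite mulr_sumr; apply: ler_sum => k _.
  have -> : x ^+ n / n`!%:R * (x ^+ k / k`!%:R) = x ^+ (k + n) / (n`! * k`!)%:R.
    by rewrite natrM exprD invfM; ring.
  rewrite ler_wpM2l ?exprn_ge0// lef_pV2 ?posrE ?ltr0n ?muln_gt0 ?fact_gt0// ler_nat.
  by rewrite -(bin_fact (leq_addl k n)) addnK leq_pmull// bin_gt0 leq_addl.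
rewrite ler_wpM2l ?divr_ge0 ?exprn_ge0//.
have := @nondecreasing_cvgn_le _ (series (exp_coeff x)) _ (is_cvg_series_exp_coeff x) (m - n)%N.
apply; apply/nondecreasing_seqP => k; rewrite /series/= big_nat_recr//= lerDl.
by rewrite exp_coeff_ge0.
Qed.

End real_inequalities.

(** * Coefficients in the Fock space, synthesis and projection *)

Section fock_coordinates.
Variable R : realType.
Notation C := R[i].
Notation mR := (measurableTypeR R).
Notation RR := (mR * mR)%type.
Notation dm := (@dm R).
Notation gauss := (@gauss R).
Notation c0 := (gauss_mass R).
Implicit Types (f g h : C -> C) (a : nat -> C).

(** Lower semicontinuity of the norm along pointwise limits. *)
Lemma fatou_nrm2 (G : nat -> C -> C) g (B : R) N : measC g -> (forall n, L2 (G n)) ->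
  (forall z, ctends (G ^~ z) (g z)) -> (forall n, (N <= n)%N -> nrm2 (G n) <= B) ->
  L2 g /\ nrm2 g <= B.
Proof.
move=> mg LG Gg GB.
pose u n (p : RR) : \bar R := (normc (G n (plane p)) ^+ 2 * gauss (plane p))%:E.
have mu n : measurable_fun setT (u n).
  by have [_ /integrableP[]] := LG n.
have u0 n p : (0 <= u n p)%E by rewrite lee_fin mulr_ge0 ?sqr_ge0 ?gauss_ge0.
pose v (p : RR) : \bar R := (normc (g (plane p)) ^+ 2 * gauss (plane p))%:E.
have uv p : limn_einf (u ^~ p) = v p.
  have H : u ^~ p @ \oo --> v p.
    apply: cvg_EFin; first exact: nearW.
    rewrite /comp /=; apply: cvgMl.
    under eq_fun do rewrite sqr_normc_ReIm !expr2.
    rewrite sqr_normc_ReIm !expr2.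
    have hR := ctends_Re (Gg (plane p)); have hI := ctends_Im (Gg (plane p)).
    by apply: cvgD; apply: cvgM.
  by have [] := cvg_limn_einf_sup H.
have := fatou dm measurableT mu (fun n p _ => u0 n p).
under [X in (X <= _)%E -> _]eq_integral do rewrite uv.
have E n : (\int[dm]_p u n p = (nrm2 (G n))%:E)%E by have [_ i] := LG n; exact: (intR_EFin i).
under [X in limn_einf X]eq_fun do rewrite E.
move=> h.
have hB : (limn_einf (fun n => (nrm2 (G n))%:E) <= B%:E)%E.
  rewrite limn_einf_lim; apply: lime_le; first exact: is_cvg_einfs.
  near=> n; apply: (@le_trans _ _ (nrm2 (G n))%:E).
    by apply: ereal_inf_lbound; exists n => //=.
  by rewrite lee_fin; apply: GB; near: n; exists N.
have vB := le_trans h hB.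
have mv : measR (fun z => normc (g z) ^+ 2 * gauss z).
  exact: (measRM (measC_normsqr mg) (@measR_gauss R)).
have iv : integ (fun z => normc (g z) ^+ 2 * gauss z).
  apply: (proj1 (integ_lty mv _)); first by move=> z; rewrite mulr_ge0 ?sqr_ge0 ?gauss_ge0.
  by apply: le_lt_trans vB _; exact: ltry.
split; first by split.
by move: vB; rewrite (intR_EFin iv) lee_fin.
Unshelve. all: by end_near. Qed.

Lemma nrm2E f : L2 f -> nrm2 f = complex.Re (inner f f).
Proof. by move=> Lf; rewrite inner_self. Qed.

Lemma nrm2B f g : L2 f -> L2 g ->
  nrm2 (fun z => f z - g z) = nrm2 f + nrm2 g - 2 * complex.Re (inner f g).
Proof.
move=> Lf Lg; have LN := L2Z (-1) Lg.
have -> : (fun z => f z - g z) = (fun z => f z + (-1) * g z).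
  by apply/funext => z; rewrite mulN1r.
rewrite !nrm2E//; last exact: L2D.
rewrite innerDl//; last exact: L2D.
rewrite !innerDr// !innerZl// !innerZr// (inner_conj Lf Lg) rmorphN rmorph1 !ReImE /=.
ring.
Qed.

Lemma nrm2Z (c : C) f : L2 f -> nrm2 (fun z => c * f z) = normc c ^+ 2 * nrm2 f.
Proof.
move=> Lf; rewrite !nrm2E//; last exact: L2Z.
by rewrite (innerZl c Lf (L2Z c Lf)) (innerZr c Lf Lf) mulrA mulc_conj inner_self// -rmorphM.
Qed.

Definition coef f (k : nat) : C := inner f (ebas k).
Definition esum_ a (n : nat) (z : C) : C := \sum_(k < n) a k * ebas k z.
Definition sqsum a (n : nat) : R := \sum_(k < n) normc (a k) ^+ 2.

Lemma esum_L2 a n : L2 (esum_ a n).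
Proof.
apply: (@L2_sum _ _ _ (fun (k : 'I_n) z => a k * ebas k z)) => k.
exact: (L2Z (a k) (ebas_L2 R k)).
Qed.

Lemma inner_esumr f a n : L2 f -> inner f (esum_ a n) = \sum_(k < n) (a k)^* * coef f k.
Proof. by move=> Lf; rewrite inner_sumr//; move=> k; exact: ebas_L2. Qed.

Lemma coef_esum a n k : coef (esum_ a n) k = if (k < n)%N then a k else 0.
Proof.
rewrite /coef inner_suml; [|by move=> j; exact: ebas_L2|exact: ebas_L2].
case: ifP => kn.
  rewrite (bigD1 (Ordinal kn))//= big1 ?addr0 ?ebas_orthonormal ?eqxx ?mulr1// => j jk.
  have {}jk : (val j == k) = false by apply/negbTE; exact: jk.
  by rewrite ebas_orthonormal jk mulr0.
rewrite big1// => j _.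
have jk : (val j == k) = false by apply: contraFF kn => /eqP <-; exact: ltn_ord.
by rewrite ebas_orthonormal jk mulr0.
Qed.

Lemma nrm2_esum a n : nrm2 (esum_ a n) = sqsum a n.
Proof.
rewrite nrm2E ?inner_esumr; try exact: esum_L2.
rewrite (_ : \sum_(k < n) _ = (sqsum a n)%:C)//.
rewrite rmorph_sum/=; apply: eq_bigr => k _.
by rewrite coef_esum ltn_ord mulrC mulc_conj.
Qed.

Lemma nrm2_sub_esum f n : L2 f ->
  nrm2 (fun z => f z - esum_ (coef f) n z) = nrm2 f - sqsum (coef f) n.
Proof.
move=> Lf; rewrite nrm2B//; last exact: esum_L2.
rewrite inner_esumr// nrm2_esum (_ : \sum_(k < n) _ = (sqsum (coef f) n)%:C) /=; first ring.
rewrite rmorph_sum/=; apply: eq_bigr => k _.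
by rewrite mulrC mulc_conj.
Qed.

Lemma bessel f n : L2 f -> sqsum (coef f) n <= nrm2 f.
Proof. by move=> Lf; rewrite -subr_ge0 -nrm2_sub_esum//; exact: nrm2_ge0. Qed.

Lemma sqsum_mono a m n : (m <= n)%N -> sqsum a m <= sqsum a n.
Proof.
move=> /subnKC <-; elim: (n - m)%N => [|k IH]; first by rewrite addn0.
by rewrite addnS /sqsum big_ord_recr/=; apply: le_trans IH _; rewrite lerDl sqr_ge0.
Qed.

Lemma coef_le f k : L2 f -> normc (coef f k) ^+ 2 <= nrm2 f.
Proof.
move=> Lf; apply: le_trans (bessel k.+1 Lf); rewrite /sqsum big_ord_recr/= lerDr.
by apply: sumr_ge0 => i _; exact: sqr_ge0.
Qed.

Lemma coefB f g k : L2 f -> L2 g -> coef (fun z => f z - g z) k = coef f k - coef g k.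
Proof.
move=> Lf Lg; have -> : (fun z => f z - g z) = (fun z => f z + (-1) * g z).
  by apply/funext => z; rewrite mulN1r.
rewrite /coef innerDl; [|exact: Lf|exact: (L2Z _ Lg)|exact: ebas_L2].
by rewrite innerZl ?mulN1r//; exact: ebas_L2.
Qed.

(** Fatou's lemma for the differences of partial sums: beyond N their squared norm is sqsum n -
    sqsum N, at most B - sqsum N. *)
Lemma esum_limit f a (B : R) N : entire f ->
  (forall z, ctends ((esum_ a)^~ z) (f z)) -> (forall n, sqsum a n <= B) ->
  L2 f /\ nrm2 (fun z => f z - esum_ a N z) <= B - sqsum a N.
Proof.
move=> ef af aB.
have [Lf _] : L2 f /\ nrm2 f <= B.
  apply: (@fatou_nrm2 (esum_ a) f B 0%N) => //; first exact: entire_measC.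
    exact: esum_L2.
  by move=> n _; rewrite nrm2_esum.
split=> //.
have [_] : L2 (fun z => f z - esum_ a N z) /\ nrm2 (fun z => f z - esum_ a N z) <= B - sqsum a N.
  apply: (@fatou_nrm2 (fun n z => esum_ a n z - esum_ a N z) _ _ N).
  - by have [] := L2B Lf (esum_L2 a N).
  - by move=> n; exact: (L2B (esum_L2 a n) (esum_L2 a N)).
  - by move=> z; exact: (ctends_sub (af z) (@ctends_cst _ _)).
  move=> n Nn; rewrite nrm2B; [|exact: esum_L2..].
  rewrite !nrm2_esum inner_esumr; last exact: esum_L2.
  rewrite (_ : \sum_(k < N) _ = (sqsum a N)%:C) /=.
    by have := aB n; lra.
  rewrite rmorph_sum/=; apply: eq_bigr => k _.
  by rewrite coef_esum (leq_trans (ltn_ord k) Nn) mulrC mulc_conj.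
by [].
Qed.

Lemma sqsum_cauchy a (B : R) : (forall n, sqsum a n <= B) -> forall e, 0 < e ->
  exists S N, (forall n, sqsum a n <= S) /\ forall n, (N <= n)%N -> S - sqsum a n <= e.
Proof.
move=> aB e e0; pose E := range (sqsum a).
have hE : has_sup E by split; [exists (sqsum a 0%N), 0%N|exists B => _ [n _ <-]].
exists (sup E).
have [_ [N _ <-] hN] := sup_adherent e0 hE.
exists N; split=> [n|n Nn]; first by apply: ub_le_sup; [case: hE|exists n].
have := sqsum_mono a Nn; move: hN; lra.
Qed.

(** Riesz-Fischer: the factor 1 / sqrt (k!) in [ebas] makes the Taylor coefficients [rapid], so the
    sum is entire, and [esum_limit] bounds its norm. *)
Lemma synthesis a (B : R) : (forall n, sqsum a n <= B) ->
  exists f, [/\ fock f, forall k, coef f k = a k & nrm2 f <= B].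
Proof.
move=> aB.
have B0 : 0 <= B by have := aB 0%N; rewrite /sqsum big_ord0.
have aleB k : normc (a k) ^+ 2 <= B.
  apply: le_trans (aB k.+1); rewrite /sqsum big_ord_recr/= lerDr.
  by apply: sumr_ge0 => i _; exact: sqr_ge0.
pose b k := a k * (enorm R k)%:C.
have rb : rapid b.
  move=> rho rho0; exists (1 + B * (expR (rho ^+ 2) / c0)) => n.
  have h : (normc (b n) * rho ^+ n) ^+ 2 <= B * (expR (rho ^+ 2) / c0).
    rewrite normcM normc_real ger0_norm ?(ltW (enorm_gt0 _ _))// !exprMn -mulrA.
    apply: (ler_pM (sqr_ge0 _) _ (aleB n)); first by rewrite mulr_ge0 ?sqr_ge0.
    rewrite enorm_sqr invfM mulrAC ler_wpM2r ?invr_ge0 ?(ltW (gauss_mass_gt0 R))//.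
    rewrite mulrC ler_pdivrMr ?ltr0n ?fact_gt0// -exprM mulnC exprM mulrC.
    by apply: exp_bound_pow; exact: sqr_ge0.
  have := sqr_ge0 (normc (b n) * rho ^+ n - 1 / 2); move: h; set x := normc (b n) * rho ^+ n.
  rewrite sqrrB; set y := B * _; nra.
pose f := pseriesC b; have ef := pseriesC_entire rb.
have af z : ctends ((esum_ a)^~ z) (f z).
  have := pseriesCP z rb; congr ctends; apply/funext => n; apply: eq_bigr => k _.
  by rewrite /b /ebas /mon mulrA.
exists f; have [Lf hf] := esum_limit 0 ef af aB.
split; first exact: (fockE ef Lf).
  move=> k; apply/eqP; rewrite -subr_eq0; apply/eqP/eq0_normc/eqP.
  rewrite -sqrf_eq0 eq_le sqr_ge0 andbT; apply/ler_addgt0Pl => e e0; rewrite addr0.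
  (* A bound S approached within e makes f - esum_N of squared norm at most e; for N > k its k-th
     coefficient is coef f k - a k. *)
  have [S [N [aS hS]]] := sqsum_cauchy aB e0.
  have [_ hN] := esum_limit (maxn N k.+1) ef af aS.
  have := coef_le k (L2B Lf (esum_L2 a (maxn N k.+1))).
  rewrite coefB//; last exact: esum_L2.
  rewrite coef_esum leq_maxr => /le_trans; apply; apply: le_trans hN _.
  by apply: hS; exact: leq_maxl.
move: hf; congr (_ <= _); last by rewrite /sqsum big_ord0 subr0.
by congr nrm2; apply/funext => z; rewrite /esum_ big_ord0 subr0.
Qed.

Lemma fock_density f e : fock f -> 0 < e ->
  exists N, nrm2 (fun z => f z - esum_ (coef f) N z) <= e.
Proof.
move=> Ff e0; have Lf := fock_L2 Ff; have [ef _] := Ff.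
have [S [N [aS hS]]] := sqsum_cauchy (fun n => bessel n Lf) e0.
exists N; have [_ h] := esum_limit N ef (fun z => fock_expand z Ff) aS.
by apply: le_trans h _; exact: hS.
Qed.

Lemma fock_coef_inj f g : fock f -> fock g -> (forall k, coef f k = coef g k) -> f = g.
Proof.
move=> Ff Fg fg; apply/funext => z.
apply: (ctends_unique (fock_expand z Ff)).
have E : (fun n => \sum_(k < n) inner g (ebas k) * ebas k z) =
    (fun n => \sum_(k < n) inner f (ebas k) * ebas k z).
  by apply/funext => n; apply: eq_bigr => k _; congr (_ * _); exact: esym (fg k).
by have := fock_expand z Fg; rewrite E.
Qed.

(** Cauchy-Schwarz between the coefficients of f and the tail of the series of |z|^(2k) / (k!
    c0). *)
Lemma fock_tail_bound f n z : fock f -> (forall k, (k < n)%N -> coef f k = 0) ->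
  normc (f z) ^+ 2 <= nrm2 f * ((normc z ^+ 2) ^+ n / n`!%:R * expR (normc z ^+ 2) / c0).
Proof.
move=> Ff f0; have Lf := fock_L2 Ff.
set M := nrm2 f * _.
have M0 : 0 <= M.
  by rewrite mulr_ge0 ?nrm2_ge0// mulr_ge0 ?invr_ge0 ?(ltW (gauss_mass_gt0 R))// mulr_ge0 ?expR_ge0// divr_ge0// exprn_ge0// sqr_ge0.
rewrite -[M]sqr_sqrtr// ler_sqr ?nnegrE ?normc_ge0 ?sqrtr_ge0//.
apply: (ctends_le (fock_expand z Ff)); apply: nearW => m.
rewrite -ler_sqr ?nnegrE ?normc_ge0 ?sqrtr_ge0// sqr_sqrtr//.
rewrite -(big_mkord xpredT (fun k => inner f (ebas k) * ebas k z)).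
have [mn|nm] := leqP m n.
  rewrite big_nat_cond big1 ?normc0 ?expr0n//= => k /andP[km _].
  by rewrite [inner _ _]f0 ?mul0r// (leq_trans km mn).
rewrite (@big_cat_nat _ _ _ n)//= ?(ltnW nm)// big_nat_cond big1 ?add0r; last first.
  by move=> k /andP[/andP[_ kn] _]; rewrite [inner _ _]f0 ?mul0r.
apply: (@le_trans _ _ ((\sum_(n <= k < m) normc (coef f k) * normc (ebas k z)) ^+ 2)).
  rewrite ler_sqr ?nnegrE ?normc_ge0 ?sumr_ge0//; last by move=> k _; rewrite mulr_ge0 ?normc_ge0.
  by apply: le_trans (normc_sum _ _ _) _; apply: ler_sum => k _; rewrite normcM.
apply: le_trans (sum_cauchy_schwarz _ _ (fun=> normc_ge0 _) (fun=> normc_ge0 _)) _.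
apply: ler_pM; rewrite ?sumr_ge0//; try by move=> k _; exact: sqr_ge0.
  apply: le_trans (bessel m Lf); rewrite /sqsum -(big_mkord xpredT (fun k => normc (coef f k) ^+ 2)).
  rewrite (@big_cat_nat _ _ _ n 0 m)//= ?(ltnW nm)// lerDr.
  by apply: sumr_ge0 => k _; exact: sqr_ge0.
have ci : 0 <= c0^-1 by rewrite invr_ge0 ltW// gauss_mass_gt0.
apply: (le_trans _ (ler_wpM2r ci (exp_tail_le n m (sqr_ge0 (normc z))))).
rewrite mulr_suml; apply: ler_sum => k _.
rewrite /ebas /mon normcM normc_real normcX ger0_norm ?(ltW (enorm_gt0 _ _))// exprMn enorm_sqr.
by rewrite invfM mulrC -!exprM mulnC mulrA.
Qed.

(** A form of Cauchy-Schwarz with a free weight: x y <= t x^2 / 2 + y^2 / (2 t) pointwise, doubled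
    by [integralC_le]. Later choices of [t] allow one of the two terms to be absorbed. *)
Lemma inner_bound f g (t : R) : L2 f -> L2 g -> 0 < t ->
  normc (inner f g) <= t * nrm2 f + nrm2 g / t.
Proof.
move=> Lf Lg t0; have [mf If] := Lf; have [mg Ig] := Lg.
have := integralC_le (v := fun z => (t / 2) * (normc (f z) ^+ 2 * gauss z) + (2 * t)^-1 * (normc (g z) ^+ 2 * gauss z)) (measC_inner mf mg).
move=> /(_ _ (integD (integZ _ If) (integZ _ Ig))).
rewrite intRD; [|exact: integZ..]; rewrite !intRZ//.
rewrite -/(nrm2 f) -/(nrm2 g) -/(inner f g) => h; apply: le_trans (h _) _; last first.
  by rewrite le_eqVlt; apply/orP; left; apply/eqP; field; rewrite gt_eqF.
move=> z; rewrite normcM normc_real ger0_norm ?gauss_ge0// normcM normc_conj.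
set x := normc (f z); set y := normc (g z).
have key : x * y <= t / 2 * x ^+ 2 + (2 * t)^-1 * y ^+ 2.
  rewrite -subr_ge0.
  have -> : t / 2 * x ^+ 2 + (2 * t)^-1 * y ^+ 2 - x * y = (t * x - y) ^+ 2 / (2 * t).
    by field; rewrite gt_eqF.
  by rewrite divr_ge0 ?sqr_ge0// mulr_ge0// ltW.
by apply: (le_trans (ler_wpM2r (gauss_ge0 z) key)); rewrite mulrDl !mulrA.
Qed.

Lemma orthogonal_fock h : L2 h -> (forall k, inner h (ebas k) = 0) -> forall g, fock g -> inner h g = 0.
Proof.
move=> Lh h0 g Fg; have Lg := fock_L2 Fg.
apply/eq0_normc/eqP; rewrite eq_le normc_ge0 andbT; apply/ler_addgt0Pl => e e0; rewrite addr0.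
have k0 : 0 < 1 + nrm2 h by rewrite ltr_pwDl// nrm2_ge0.
pose t := e / 2 / (1 + nrm2 h).
have t0 : 0 < t by rewrite !divr_gt0.
have te0 : 0 < t * (e / 2) by rewrite mulr_gt0// divr_gt0.
have [N hN] := fock_density Fg te0.
have LS := esum_L2 (coef g) N.
have -> : inner h g = inner h (fun z => g z - esum_ (coef g) N z).
  have -> : (fun z => g z - esum_ (coef g) N z) = (fun z => g z + (-1) * esum_ (coef g) N z).
    by apply/funext => z; rewrite mulN1r.
  rewrite innerDr//; last exact: L2Z.
  rewrite innerZr// inner_esumr// big1 ?mulr0 ?addr0// => k _.
  by rewrite /coef h0 mulr0.
apply: le_trans (inner_bound Lh (L2B Lg LS) t0) _.
rewrite [leRHS]splitr; apply: lerD; last by rewrite ler_pdivrMr// mulrC.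
by rewrite /t mulrAC ler_pdivrMr// ler_wpM2l ?lerDr// ltW// divr_gt0.
Qed.

(** By Bessel's inequality the coefficients of h are square-summable, so they are those of some Fock
    function g; then h - g is orthogonal to every [ebas k], hence to the space by density. *)
Lemma fock_projection h : L2 h -> exists g, fock g /\
  forall k, fock k -> inner (fun z => h z - g z) k = 0.
Proof.
move=> Lh; have [g [Fg gc _]] := synthesis (fun n => bessel n Lh).
exists g; split=> //; apply: orthogonal_fock; first exact: (L2B Lh (fock_L2 Fg)).
by move=> k; have := coefB k Lh (fock_L2 Fg); rewrite /coef [inner g _]gc subrr.
Qed.

End fock_coordinates.

(** * Compact Hermitian forms on the Fock space *)

Section homogeneous_systems.
Variable K : fieldType.

Lemma homogeneous_solution n (phi : 'I_n -> 'I_n.+1 -> K) :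
  exists2 c : 'I_n.+1 -> K, (exists i, c i != 0) & forall j, \sum_i c i * phi j i = 0.
Proof.
pose A : 'M[K]_(n.+1, n) := \matrix_(i, j) phi j i.
have kN0 : kermx A != 0.
  by rewrite kermx_eq0 -row_leq_rank -ltnNge ltnS rank_leq_col.
have [v /sub_kermxP vA v0] := rowV0Pn kN0.
exists (fun i => v 0 i).
  apply/existsP; rewrite -[X in is_true X]negbK; apply: contra v0 => /existsPn H.
  by apply/eqP/rowP => i; rewrite mxE; apply/eqP; have := H i; rewrite negbK.
move=> j; have := congr1 (fun M : 'rV_n => M 0 j) vA; rewrite !mxE => E.
by rewrite -[RHS]E; apply: eq_bigr => i _; rewrite mxE.
Qed.

End homogeneous_systems.

Section ultra_limits.
Variable R : realType.

(** Along one ultrafilter all bounded sequences converge at once, which takes the place of a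
    diagonal extraction over the coefficients. *)
Lemma ultra_cvg (G : set_system nat) (u : nat -> R) (M : R) : UltraFilter G ->
  (forall k, `|u k| <= M) -> exists p, forall e, 0 < e -> \forall k \near G, `|u k - p| <= e.
Proof.
move=> UG uM; have PG : ProperFilter G by exact: ultra_proper.
have [p [_ cp]] : (`[- M, M]%classic `&` cluster (u @ G)) !=set0.
  apply: segment_compact.
  by apply: (@filterS _ G _ setT) filterT => k _; rewrite /= in_itv/= -ler_norml.
exists p => e e0.
have [//|h] := in_ultra_setVsetC [set k | `|u k - p| <= e] UG.
have nb : nbhs p (ball p e) by exact: nbhsx_ballx.
have [_ [[k hk <-] hb]] := cp (u @` (~` [set k | `|u k - p| <= e])) (ball p e)
  (filterS (fun k (hk : (~` [set k | `|u k - p| <= e]) k) => ex_intro2 _ _ k hk erefl) h) nb.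
by case: hk; move: hb; rewrite /ball/= distrC => /ltW.
Qed.

End ultra_limits.

(** * Hermitian forms and their maximisers on the unit ball *)

Section fock_forms.
Variable R : realType.
Notation C := R[i].
Implicit Types (f g h : C -> C) (B D : (C -> C) -> (C -> C) -> C).

Lemma fockD f g : fock f -> fock g -> fock (fun z => f z + g z).
Proof.
move=> Ff Fg; have [ef _] := Ff; have [eg _] := Fg.
exact: (fockE (entireD ef eg) (L2D (fock_L2 Ff) (fock_L2 Fg))).
Qed.

Lemma fockZ (c : C) f : fock f -> fock (fun z => c * f z).
Proof.
move=> Ff; have [ef _] := Ff.
exact: (fockE (entireM (@entire_cst _ c) ef) (L2Z c (fock_L2 Ff))).
Qed.

Lemma fock0 : fock (fun=> 0 : C).
Proof. exact: (fockE (@entire_cst _ 0) (@L2_0 R)). Qed.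

Lemma fock_sum (I : Type) (r : seq I) (F : I -> C -> C) : (forall i, fock (F i)) ->
  fock (fun z => \sum_(i <- r) F i z).
Proof.
move=> FF; apply: fockE; first by apply: entire_sum => i; have [] := FF i.
by apply: L2_sum => i; exact: fock_L2.
Qed.

Lemma fock_lincomb n (c : 'I_n -> C) (F : 'I_n -> C -> C) : (forall i, fock (F i)) ->
  fock (fun z => \sum_i c i * F i z).
Proof. by move=> FF; apply: (@fock_sum _ _ (fun i z => c i * F i z)) => i; exact: fockZ. Qed.

Record hform B : Prop := HForm {
  hformD : forall f g k, fock f -> fock g -> fock k ->
    B (fun z => f z + g z) k = B f k + B g k;
  hformZ : forall (c : C) f k, fock f -> fock k -> B (fun z => c * f z) k = c * B f k;
  hformC : forall f g, fock f -> fock g -> B g f = (B f g)^* }.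

Definition quad B f : R := complex.Re (B f f).

Lemma inner_hform : hform (@inner R).
Proof.
split=> [f g k Ff Fg Fk|c f k Ff Fk|f g Ff Fg].
- by apply: innerDl; exact: fock_L2.
- by apply: innerZl; exact: fock_L2.
- by apply: inner_conj; exact: fock_L2.
Qed.

Lemma hformDr B f g k : hform B -> fock f -> fock g -> fock k ->
  B k (fun z => f z + g z) = B k f + B k g.
Proof.
move=> hB Ff Fg Fk; rewrite (hformC hB (fockD Ff Fg) Fk) (hformD hB)// rmorphD/=.
by rewrite -!(hformC hB).
Qed.

Lemma hformZr B (c : C) f k : hform B -> fock f -> fock k ->
  B k (fun z => c * f z) = c^* * B k f.
Proof.
move=> hB Ff Fk; rewrite (hformC hB (fockZ c Ff) Fk) (hformZ hB)// rmorphM/=.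
by rewrite -(hformC hB).
Qed.

Lemma hform_suml B (I : Type) (r : seq I) (a : I -> C) (F : I -> C -> C) k : hform B ->
  (forall i, fock (F i)) -> fock k ->
  B (fun z => \sum_(i <- r) a i * F i z) k = \sum_(i <- r) a i * B (F i) k.
Proof.
move=> hB FF Fk; elim: r => [|i r IH].
  have -> : (fun z => \sum_(i <- [::]) a i * F i z) = (fun z : C => 0 * (0 : C)).
    by apply/funext => z; rewrite big_nil mulr0.
  by rewrite big_nil (hformZ hB 0 fock0 Fk) mul0r.
have -> : (fun z => \sum_(j <- i :: r) a j * F j z) =
    (fun z => a i * F i z + \sum_(j <- r) a j * F j z).
  by apply/funext => z; rewrite big_cons.
have Fs : fock (fun z => \sum_(j <- r) a j * F j z).
  by apply: (@fock_sum _ _ (fun j z => a j * F j z)) => j; exact: fockZ.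
by rewrite big_cons (hformD hB (fockZ _ (FF i)) Fs Fk) (hformZ hB _ (FF i) Fk) IH.
Qed.

Lemma quadZ B (c : C) f : hform B -> fock f -> quad B (fun z => c * f z) = normc c ^+ 2 * quad B f.
Proof.
move=> hB Ff; rewrite /quad (hformZ hB)//; last exact: fockZ.
by rewrite (hformZr _ hB)// mulrA mulc_conj ReM /= mul0r subr0.
Qed.

Lemma quad0 B : hform B -> quad B (fun=> 0) = 0.
Proof.
move=> hB; have := hformZ hB 0 fock0 fock0.
have -> : (fun z : C => 0 * (0 : C)) = (fun=> 0) by apply/funext => z; rewrite mulr0.
by rewrite /quad mul0r => ->.
Qed.

Lemma fock_nrm2_eq0 f : fock f -> nrm2 f = 0 -> f = (fun=> 0).
Proof.
move=> Ff f0; apply: (fock_coef_inj Ff fock0) => k.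
rewrite [RHS]inner0l; apply/eq0_normc/eqP; rewrite -sqrf_eq0 eq_le sqr_ge0 andbT -[leRHS]f0.
exact: (coef_le k (fock_L2 Ff)).
Qed.

(** Testing positivity on k - t conj (D f k) f gives D k k >= 2 t |D f k|^2 for every real t,
    because the quadratic term in t vanishes. *)
Lemma semidefinite_null D f k : hform D -> (forall g, fock g -> 0 <= quad D g) ->
  fock f -> fock k -> quad D f = 0 -> D f k = 0.
Proof.
move=> hD D0 Ff Fk f0; apply/eqP/negPn/negP => x0.
have n0 : 0 < normc (D f k) ^+ 2.
  by rewrite lt0r sqr_ge0 andbT sqrf_eq0; apply: contra x0 => /eqP/eq0_normc ->.
have key (t : R) : 0 <= quad D k - 2 * t * normc (D f k) ^+ 2.
  pose c : C := - (t%:C * (D f k)^*).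
  have Fcf := fockZ c Ff.
  have := D0 _ (fockD Fcf Fk); rewrite /quad (hformD hD)//; last exact: fockD.
  rewrite !(hformDr hD)// ReD !ReD -!/(quad _ _) quadZ// f0 mulr0 add0r.
  rewrite (hformC hD Fcf Fk) Re_conj (hformZ hD)// addrA.
  have -> : complex.Re (c * D f k) = - (t * normc (D f k) ^+ 2).
    by rewrite /c mulNr -mulrA [_^* * _]mulrC mulc_conj -rmorphM ReN /=.
  by move=> h; apply: (le_trans h); rewrite le_eqVlt; apply/orP; left; apply/eqP; ring.
have := key ((quad D k + 1) / (2 * normc (D f k) ^+ 2)).
have -> : 2 * ((quad D k + 1) / (2 * normc (D f k) ^+ 2)) * normc (D f k) ^+ 2 = quad D k + 1.
  by field; apply/negP => /eqP E; move: n0; rewrite E expr0n ltxx.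
lra.
Qed.

(** Compactness of the operator, phrased for its form: on the unit ball the quadratic form depends,
    up to e, on finitely many coefficients. *)
Definition weakly_continuous B := forall e, 0 < e -> exists J (d : R), 0 < d /\
  forall f g, fock f -> fock g -> nrm2 f <= 1 -> nrm2 g <= 1 ->
    (forall j, (j < J)%N -> normc (coef f j - coef g j) <= d) -> `|quad B f - quad B g| <= e.

Definition bounded_form B := exists M : R, forall f, fock f -> nrm2 f <= 1 -> quad B f <= M.

(* Compactness of the unit ball in the weak topology, through an ultralimit of the coefficients
   of a maximizing sequence. *)
Lemma quad_max_attained B : hform B -> weakly_continuous B -> bounded_form B ->
  exists f0, [/\ fock f0, nrm2 f0 <= 1 & forall f, fock f -> nrm2 f <= 1 -> quad B f <= quad B f0].
Proof.
move=> hB wB [M HM].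
pose E := [set quad B f | f in [set f | fock f /\ nrm2 f <= 1]].
have n0 : nrm2 (fun=> 0 : C) <= 1.
  by rewrite nrm2E ?inner0l ?ler01//; exact: L2_0.
have hE : has_sup E.
  split; first by exists (quad B (fun=> 0)), (fun=> 0) => //; split; [exact: fock0|].
  by exists M => _ [f [Ff f1] <-]; exact: HM.
have : forall k : nat, exists f, [/\ fock f, nrm2 f <= 1 & sup E - k.+1%:R^-1 < quad B f].
  move=> k; have k0 : (0 : R) < k.+1%:R^-1 by rewrite invr_gt0.
  by have [_ [f [Ff f1] <-] h] := sup_adherent k0 hE; exists f.
move=> /choice[F HF].
have FF (k : nat) : fock (F k) by have [] := HF k.
have F1 (k : nat) : nrm2 (F k) <= 1 by have [] := HF k.
have [G [UG sG]] := ultraFilterLemma (@eventually_filter : ProperFilter \oo).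
have PG : ProperFilter G by exact: ultra_proper.
have cb j (k : nat) : normc (coef (F k) j) <= 1.
  rewrite -(@ler_pXn2r _ 2) ?nnegrE ?normc_ge0// expr1n; apply: le_trans (F1 k).
  exact: (coef_le j (fock_L2 (FF k))).
have : forall j, exists a : C, forall d, 0 < d -> \forall k \near G, normc (coef (F k) j - a) <= d.
  move=> j.
  have [p hp] := ultra_cvg UG (fun k => le_trans (Re_le_normc _) (cb j k)).
  have [q hq] := ultra_cvg UG (fun k => le_trans (Im_le_normc _) (cb j k)).
  exists (p +i* q) => d d0; have d20 : 0 < d / 2 by rewrite divr_gt0.
  apply: filterS2 (hp _ d20) (hq _ d20) => k h1 h2.
  by apply: le_trans (normc_le_ReIm _) _; rewrite [d]splitr !ReImE /= lerD.
move=> /choice[a Ha].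
have near_all J d : 0 < d -> \forall k \near G, forall j, (j < J)%N -> normc (coef (F k) j - a j) <= d.
  move=> d0; elim: J => [|J IH]; first by apply: (@filterS _ G _ setT) filterT.
  apply: filterS2 IH (Ha J _ d0) => k h1 h2 j.
  by rewrite ltnS leq_eqVlt => /predU1P[->|/h1].
have sa n : sqsum a n <= 1.
  apply/ler_addgt0Pl => e e0.
  pose d := Num.min 1 (e / (3 * n.+1%:R)).
  have d0 : 0 < d by rewrite lt_min ltr01 divr_gt0// mulr_gt0.
  have [k hk] := @filter_ex _ G _ _ (near_all n _ d0).
  have := le_trans (bessel n (fock_L2 (FF k))) (F1 k).
  have step j : (j < n)%N -> normc (a j) ^+ 2 <= normc (coef (F k) j) ^+ 2 + 3 * d.
    move=> jn; have aj : normc (a j) <= normc (coef (F k) j) + d.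
      rewrite -[a j](subrK (coef (F k) j)); apply: le_trans (le_normcD _ _) _.
      by rewrite normc_distC addrC lerD2l hk.
    apply: (@le_trans _ _ ((normc (coef (F k) j) + d) ^+ 2)).
      by rewrite ler_sqr ?nnegrE ?normc_ge0// addr_ge0 ?normc_ge0 ?ltW.
    have d1 : d <= 1 by rewrite ge_min lexx.
    have := cb j k; have := normc_ge0 (coef (F k) j).
    set x := normc _ => x0 x1; nra.
  move=> h; apply: (@le_trans _ _ (\sum_(j < n) (normc (coef (F k) j) ^+ 2 + 3 * d))).
    by apply: ler_sum => j _; exact: step.
  rewrite big_split/= sumr_const card_ord addrC lerD//.
  have : d <= e / (3 * n.+1%:R) by rewrite ge_min lexx orbT.
  rewrite ler_pdivlMr ?mulr_gt0// => hd; rewrite -[_ *+ n]mulr_natr; apply: le_trans hd.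
  by rewrite [3 * d]mulrC -mulrA ler_pM2l// ler_pM2l// ler_nat.
have [f [Ff fa f1]] := synthesis sa.
exists f; split=> // g Fg g1.
apply: (@le_trans _ _ (sup E)); first by apply: ub_le_sup; [case: hE|exists g].
apply/ler_addgt0Pl => e e0.
have e20 : 0 < e / 2 by rewrite divr_gt0.
have [J [d [d0 HJ]]] := wB _ e20.
have large : \forall k \near \oo, k.+1%:R^-1 <= e / 2.
  exists (Num.bound (e / 2)^-1) => // k /= hk.
  rewrite -[leRHS]invrK lef_pV2 ?posrE ?invr_gt0//; apply: ltW.
  apply: lt_le_trans (archi_boundP _) _; first by rewrite invr_ge0 ltW.
  by rewrite ler_nat leqW.
have [k [hk1 hk2]] := @filter_ex _ G _ _ (filterI (near_all J _ d0) (sG _ large)).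
have h : `|quad B (F k) - quad B f| <= e / 2.
  by apply: HJ => // j jJ; rewrite fa; exact: hk1.
have [_ _] := HF k; move: h hk2; rewrite ler_norml => /andP[_ h1] h2 h3.
rewrite [e]splitr; set y := k.+1%:R^-1 in h2 h3; lra.
Qed.

(** The supremum over the ball is at least 0, since the zero function competes. When it is 0 the
    pair is normalised to (0, 0), which pads the sequence of eigenvalues by zeros. *)
Definition top_pair B (p : R * (C -> C)) :=
  [/\ 0 <= p.1, fock p.2, (forall g, fock g -> quad B g <= p.1 * nrm2 g),
      (forall k, fock k -> B p.2 k = p.1%:C * inner p.2 k) &
      (0 < p.1 -> nrm2 p.2 = 1) /\ (p.1 = 0 -> p.2 = (fun=> 0))].

Lemma top_pair_exists B : hform B -> weakly_continuous B -> bounded_form B -> exists p, top_pair B p.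
Proof.
move=> hB wB bB; have [f0 [Ff0 f01 max0]] := quad_max_attained hB wB bB.
set l := quad B f0 in max0.
have z1 : nrm2 (fun=> 0 : C) = 0 by rewrite nrm2E ?inner0l//; exact: L2_0.
have l0 : 0 <= l.
  by rewrite -(quad0 hB); apply: max0; [exact: fock0|rewrite z1 ler01].
have ql g : fock g -> quad B g <= l * nrm2 g.
  move=> Fg; have [g0|gN] := eqVneq (nrm2 g) 0.
    by rewrite g0 mulr0 (fock_nrm2_eq0 Fg g0) quad0.
  have gp : 0 < nrm2 g by rewrite lt0r gN nrm2_ge0.
  pose s := (Num.sqrt (nrm2 g))^-1.
  have s2 : s ^+ 2 = (nrm2 g)^-1 by rewrite exprVn sqr_sqrtr// ltW.
  have := max0 _ (fockZ s%:C Fg).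
  rewrite nrm2Z; last exact: fock_L2.
  rewrite quadZ// normc_real real_normK ?num_real// s2 mulVf// => /(_ (lexx _)).
  by rewrite mulrC ler_pdivrMr.
have [l00|lN] := eqVneq l 0.
  exists (0, fun=> 0); split=> //=; first exact: fock0.
  - by move=> g /ql; rewrite l00.
  - move=> k Fk; have := hformZ hB 0 fock0 Fk.
    have -> : (fun z : C => 0 * (0 : C)) = (fun=> 0) by apply/funext => z; rewrite mulr0.
    by rewrite !mul0r.
  - by split=> //; rewrite ltxx.
have lp : 0 < l by rewrite lt0r lN.
have n1 : nrm2 f0 = 1.
  apply/eqP; rewrite eq_le f01/=; have := ql _ Ff0.
  by rewrite -/l -{1}[l]mulr1 ler_pM2l.
exists (l, f0); split=> //=; last by split=> // E; rewrite E eqxx in lN.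
move=> k Fk; apply/eqP; rewrite -subr_eq0 -opprB oppr_eq0; apply/eqP.
(* [D] is positive semidefinite and vanishes at the maximiser, so the maximiser lies in its kernel,
   which is the eigenvalue equation. *)
pose D g h := l%:C * inner g h - B g h.
have hI := inner_hform.
have hD : hform D.
  split=> [f g h Ff Fg Fh|c f h Ff Fh|f g Ff Fg]; rewrite /D.
  - by rewrite (hformD hB)// (hformD hI)//; ring.
  - by rewrite (hformZ hB)// (hformZ hI)//; ring.
  - by rewrite (hformC hB Ff Fg) (hformC hI Ff Fg) rmorphB rmorphM/= conj_real.
have qD g : fock g -> quad D g = l * nrm2 g - quad B g.
  move=> Fg; rewrite /quad /D ReD ReN (inner_self (fock_L2 Fg)).
  by rewrite -rmorphM.
apply: (@semidefinite_null D f0 k) => //.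
  by move=> g Fg; rewrite qD// subr_ge0 ql.
by rewrite qD// n1 mulr1 subrr.
Qed.

End fock_forms.

(** * Removing an eigenpair by a rank-one form *)

Section deflation.
Variable R : realType.
Notation C := R[i].
Implicit Types (f g h : C -> C) (B D : (C -> C) -> (C -> C) -> C).

Definition deflate B (p : R * (C -> C)) f k := B f k - p.1%:C * inner f p.2 * inner p.2 k.

Lemma deflate_hform B p : hform B -> fock p.2 -> hform (deflate B p).
Proof.
move=> hB Fp; have hI := inner_hform R; split=> [f g k Ff Fg Fk|c f k Ff Fk|f g Ff Fg]; rewrite /deflate.
- by rewrite (hformD hB)// (hformD hI)//; ring.
- by rewrite (hformZ hB)// (hformZ hI)//; ring.
- rewrite (hformC hB Ff Fg) (hformC hI Fp Fg) (hformC hI Ff Fp) rmorphB !rmorphM/= conj_real.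
  by rewrite mulrAC.
Qed.

Lemma quad_deflate B p f : fock p.2 -> fock f ->
  quad (deflate B p) f = quad B f - p.1 * normc (inner f p.2) ^+ 2.
Proof.
move=> Fp Ff; rewrite /quad /deflate ReD ReN -mulrA (hformC (inner_hform R) Ff Fp).
by rewrite mulc_conj -rmorphM.
Qed.

Lemma inner_weakly_continuous f0 e : fock f0 -> 0 < e -> exists J (d : R), 0 < d /\
  forall f g, fock f -> fock g -> nrm2 f <= 1 -> nrm2 g <= 1 ->
    (forall j, (j < J)%N -> normc (coef f j - coef g j) <= d) ->
    normc (inner f f0 - inner g f0) <= e.
Proof.
move=> F0 e0; have L0 := fock_L2 F0.
(* The part of f0 beyond its first N coefficients contributes at most 2 t for f and for g, e / 2 in
   all; the first N coefficients account for the other e / 2. *)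
pose t := e / 8; have t0 : 0 < t by rewrite divr_gt0.
have [N hN] := fock_density F0 (exprn_gt0 2 t0).
pose M := 1 + nrm2 f0; have M1 : 1 <= M by rewrite lerDl nrm2_ge0.
pose d := e / 2 / (N.+1%:R * M).
have M0 : 0 < M by exact: lt_le_trans M1.
have d0 : 0 < d by rewrite !divr_gt0// mulr_gt0.
exists N, d; split=> // f g Ff Fg f1 g1 fg.
set p := esum_ (coef f0) N; have Lp : L2 p by exact: esum_L2.
have Lr : L2 (fun z => f0 z - p z) by exact: (L2B L0 Lp).
have split_ h : L2 h -> inner h f0 = inner h p + inner h (fun z => f0 z - p z).
  move=> Lh; rewrite -innerDr//; congr inner; apply/funext => z; ring.
have small h : L2 h -> nrm2 h <= 1 -> normc (inner h (fun z => f0 z - p z)) <= 2 * t.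
  move=> Lh h1; apply: (le_trans (inner_bound Lh Lr t0)).
  have : nrm2 (fun z => f0 z - p z) / t <= t by rewrite ler_pdivrMr// -expr2.
  have : t * nrm2 h <= t by rewrite ger_pMr.
  lra.
have main : normc (inner f p - inner g p) <= e / 2.
  rewrite !inner_esumr; [|exact: fock_L2..].
  have -> : \sum_(k < N) (coef f0 k)^* * coef f k - \sum_(k < N) (coef f0 k)^* * coef g k =
     \sum_(k < N) (coef f0 k)^* * (coef f k - coef g k).
    by rewrite -sumrB; apply: eq_bigr => k _; rewrite mulrBr.
  apply: (le_trans (normc_sum _ _ _)).
  apply: (@le_trans _ _ (\sum_(k < N) M * d)).
    apply: ler_sum => k _; rewrite normcM normc_conj ler_pM ?normc_ge0//; last exact: fg.
    have := coef_le k L0; have := normc_ge0 (coef f0 k); rewrite /M.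
    by set x := normc _ => x0 xx; nra.
  rewrite sumr_const card_ord -[_ *+ N]mulr_natr /d.
  have -> : M * (e / 2 / (N.+1%:R * M)) * N%:R = e / 2 * (N%:R / N.+1%:R).
    by field; rewrite (gt_eqF M0) nat1r pnatr_eq0.
  by rewrite ger_pMr ?divr_gt0// ler_pdivrMr// mul1r ler_nat.
have Lf := fock_L2 Ff; have Lg := fock_L2 Fg.
rewrite (split_ f Lf) (split_ g Lg).
have -> : inner f p + inner f (fun z => f0 z - p z) - (inner g p + inner g (fun z => f0 z - p z)) =
  (inner f p - inner g p) + (inner f (fun z => f0 z - p z) - inner g (fun z => f0 z - p z)) by ring.
apply: (le_trans (le_normcD _ _)).
have := le_normcB (inner f (fun z => f0 z - p z)) (inner g (fun z => f0 z - p z)).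
have := small f Lf f1; have := small g Lg g1; move: main; rewrite /t; lra.
Qed.

Lemma deflate_weakly_continuous B p : weakly_continuous B -> fock p.2 ->
  weakly_continuous (deflate B p).
Proof.
move=> wB Fp e e0; have L0 := fock_L2 Fp.
pose M := 1 + nrm2 p.2; have M1 : 1 <= M by rewrite lerDl nrm2_ge0.
have M0 : 0 < M by exact: lt_le_trans M1.
pose K := 1 + `|p.1|; have K0 : 0 < K by rewrite ltr_pwDl.
pose e' := e / 2 / (2 * M * K).
have e'0 : 0 < e' by rewrite !divr_gt0// !mulr_gt0.
have [J1 [d1 [d10 H1]]] := wB _ (divr_gt0 e0 (ltr0Sn R 1)).
have [J2 [d2 [d20 H2]]] := inner_weakly_continuous Fp e'0.
exists (maxn J1 J2), (Num.min d1 d2); split; first by rewrite lt_min d10.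
move=> f g Ff Fg f1 g1 fg.
have h1 : `|quad B f - quad B g| <= e / 2.
  apply: H1 => // j jJ; apply: (le_trans (fg j _)); first by rewrite leq_max jJ.
  by rewrite ge_min lexx.
have h2 : normc (inner f p.2 - inner g p.2) <= e'.
  apply: H2 => // j jJ; apply: (le_trans (fg j _)); first by rewrite leq_max jJ orbT.
  by rewrite ge_min lexx orbT.
have bnd h : fock h -> nrm2 h <= 1 -> normc (inner h p.2) <= M.
  move=> Fh hh; apply: (le_trans (inner_bound (fock_L2 Fh) L0 ltr01)).
  by rewrite mul1r divr1 lerD2r.
rewrite !quad_deflate//.
have h3 : `|normc (inner f p.2) ^+ 2 - normc (inner g p.2) ^+ 2| <= 2 * M * e'.
  rewrite subr_sqr normrM mulrC ler_pM//.
    rewrite ger0_norm ?addr_ge0 ?normc_ge0//.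
    by have := bnd f Ff f1; have := bnd g Fg g1; lra.
  apply: le_trans h2; rewrite ler_norml.
  have A (x y : C) : normc x <= normc (x - y) + normc y.
    by rewrite -{1}[x](subrK y); exact: le_normcD.
  have := A (inner f p.2) (inner g p.2); have := A (inner g p.2) (inner f p.2).
  by rewrite normc_distC => h4 h5; apply/andP; split; lra.
have -> : quad B f - p.1 * normc (inner f p.2) ^+ 2 - (quad B g - p.1 * normc (inner g p.2) ^+ 2) =
  (quad B f - quad B g) - p.1 * (normc (inner f p.2) ^+ 2 - normc (inner g p.2) ^+ 2) by ring.
apply: (le_trans (ler_normB _ _)); rewrite [e]splitr lerD// normrM.
apply: (@le_trans _ _ (K * (2 * M * e'))).
  by apply: ler_pM => //; rewrite lerDr.
rewrite /e' le_eqVlt; apply/orP; left; apply/eqP; field.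
by rewrite (gt_eqF K0) (gt_eqF M0).
Qed.

Lemma deflate_bounded B p : bounded_form B -> fock p.2 -> 0 <= p.1 -> bounded_form (deflate B p).
Proof.
move=> [M HM] Fp p0; exists M => f Ff f1; rewrite quad_deflate//.
by apply: (le_trans _ (HM f Ff f1)); rewrite gerBl mulr_ge0// sqr_ge0.
Qed.

End deflation.

Section lincombs.
Variable R : realType.
Notation C := R[i].

Lemma orthogonal_lincomb_quad n (c : 'I_n -> C) (F : 'I_n -> C -> C) D : hform D ->
  (forall i, fock (F i)) -> (forall i j, i != j -> D (F i) (F j) = 0) ->
  quad D (fun z => \sum_(i < n) c i * F i z) = \sum_(i < n) normc (c i) ^+ 2 * quad D (F i).
Proof.
move=> hD FF orth; have Fs : fock (fun z => \sum_i c i * F i z) by exact: fock_lincomb.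
rewrite {1}/quad (hform_suml _ _ hD FF Fs) (big_morph (@complex.Re R) (@ReD R) (erefl : complex.Re 0 = 0)); apply: eq_bigr => i _.
have -> : D (F i) (fun z => \sum_j c j * F j z) = (c i)^* * D (F i) (F i).
  rewrite (hformC hD Fs (FF i)) (hform_suml _ _ hD FF (FF i)) (bigD1 i)//= big1 ?addr0.
    by rewrite rmorphM/= -(hformC hD (FF i) (FF i)).
  by move=> j ji; rewrite orth ?mulr0.
by rewrite mulrA mulc_conj ReM /= mul0r subr0.
Qed.

End lincombs.

(** * The positive spectrum of a compact Hermitian form *)

Section spectrum.
Variable R : realType.
Notation C := R[i].
Implicit Types (f g h : C -> C) (B : (C -> C) -> (C -> C) -> C) (lam : nat -> R) (F : nat -> C -> C).

(** Only the positive part of the spectrum is listed, padded by pairs (0, 0). [sp_max] is the half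
    of the minimax principle used for every lower bound on eigenvalues; [sp_cvg] excludes infinite
    multiplicities. *)
Record spectrum B lam F : Prop := Spectrum {
  sp_noninc : nonincreasing_seq lam;
  sp_ge0 : forall n, 0 <= lam n;
  sp_fock : forall n, fock (F n);
  sp_orth : forall m n, m != n -> inner (F m) (F n) = 0;
  sp_norm : forall n, 0 < lam n -> nrm2 (F n) = 1;
  sp_zero : forall n, lam n = 0 -> F n = (fun=> 0);
  sp_eig : forall n k, fock k -> B (F n) k = (lam n)%:C * inner (F n) k;
  sp_max : forall n g, fock g -> (forall i, (i < n)%N -> inner g (F i) = 0) ->
    quad B g <= lam n * nrm2 g;
  sp_cvg : forall e, 0 < e -> exists n, lam n <= e }.

Variable B : (C -> C) -> (C -> C) -> C.
Hypotheses (hB : hform B) (wB : weakly_continuous B) (bB : bounded_form B).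

Let pick (D : (C -> C) -> (C -> C) -> C) : R * (C -> C) := xget (0, fun=> 0) (top_pair D).

Let Bs := fix Bs n := if n is m.+1 then deflate (Bs m) (pick (Bs m)) else B.
Let lam n := (pick (Bs n)).1.
Let F n := (pick (Bs n)).2.

Let good (D : (C -> C) -> (C -> C) -> C) := [/\ hform D, weakly_continuous D & bounded_form D].

Let good_top (D : (C -> C) -> (C -> C) -> C) : good D -> top_pair D (pick D).
Proof.
by move=> [h w b]; have [p hp] := top_pair_exists h w b; rewrite /pick; exact: (xgetI _ hp).
Qed.

Let good_Bs n : good (Bs n).
Proof.
elim: n => [//|n IH]; have [p0 Fp _ _ _] := good_top IH; have [h w b] := IH.
by split; [exact: deflate_hform|exact: deflate_weakly_continuous|exact: deflate_bounded].
Qed.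

Let lam_ge0 n : 0 <= lam n. Proof. by have [] := good_top (good_Bs n). Qed.
Let F_fock n : fock (F n). Proof. by have [] := good_top (good_Bs n). Qed.
Let F_norm n : 0 < lam n -> nrm2 (F n) = 1.
Proof. by have [_ _ _ _ []] := good_top (good_Bs n). Qed.
Let F_zero n : lam n = 0 -> F n = (fun=> 0).
Proof. by have [_ _ _ _ []] := good_top (good_Bs n). Qed.
Let Bs_eig n k : fock k -> Bs n (F n) k = (lam n)%:C * inner (F n) k.
Proof. by have [_ _ _ h _] := good_top (good_Bs n); exact: h. Qed.
Let Bs_max n g : fock g -> quad (Bs n) g <= lam n * nrm2 g.
Proof. by have [_ _ h _ _] := good_top (good_Bs n); exact: h. Qed.

Let lam_dich n : lam n = 0 \/ 0 < lam n.
Proof. by have := lam_ge0 n; rewrite le_eqVlt => /predU1P[<-|]; [left|right]. Qed.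

(** Deflation kills the vector just found, and the earlier ones stay in the kernel because they are
    orthogonal to it. *)
Let Bs_null n i k : (i < n)%N -> fock k -> Bs n (F i) k = 0.
Proof.
elim: n i k => [//|n IH] i k; rewrite ltnS leq_eqVlt => /predU1P[->|i_n] Fk.
  rewrite /= /deflate -/(lam n) -/(F n) Bs_eig//.
  case: (lam_dich n) => [->|l0]; first by rewrite !mul0r subrr.
  by rewrite (inner_self (fock_L2 (F_fock n))) F_norm// mulr1 subrr.
rewrite /= /deflate -/(lam n) -/(F n) IH// sub0r.
case: (lam_dich n) => [->|l0]; first by rewrite !mul0r oppr0.
have [hn _ _] := good_Bs n.
have : (lam n)%:C * inner (F n) (F i) = 0.
  by rewrite -Bs_eig// (hformC hn (F_fock i) (F_fock n)) IH// rmorph0.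
move=> /eqP; rewrite mulf_eq0 => /orP[/eqP[]/eqP|/eqP E]; first by rewrite gt_eqF.
by rewrite (hformC (inner_hform R) (F_fock n) (F_fock i)) E rmorph0 mulr0 mul0r oppr0.
Qed.

Let orth_lt m n : (m < n)%N -> inner (F n) (F m) = 0.
Proof.
move=> mn; case: (lam_dich n) => [/F_zero ->|l0]; first by rewrite inner0l.
have [hn _ _] := good_Bs n.
have : (lam n)%:C * inner (F n) (F m) = 0.
  by rewrite -Bs_eig// (hformC hn (F_fock m) (F_fock n)) Bs_null// rmorph0.
by move=> /eqP; rewrite mulf_eq0 => /orP[/eqP[]/eqP|/eqP//]; rewrite gt_eqF.
Qed.

Let orth m n : m != n -> inner (F m) (F n) = 0.
Proof.
rewrite neq_ltn => /orP[mn|/orth_lt//].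
by rewrite (hformC (inner_hform R) (F_fock n) (F_fock m)) orth_lt// rmorph0.
Qed.

Let Bs_perp n g k : (forall i, (i < n)%N -> inner g (F i) = 0) -> Bs n g k = B g k.
Proof.
elim: n => [//|n IH] h; rewrite /= /deflate -/(F n) h// mulr0 mul0r subr0; apply: IH => i i_n.
by apply: h; rewrite ltnW.
Qed.

Let lam_noninc : nonincreasing_seq lam.
Proof.
apply/nonincreasing_seqP => n.
case: (lam_dich n.+1) => [->//|l0].
have -> : lam n.+1 = quad (Bs n.+1) (F n.+1).
  rewrite /quad Bs_eig// (inner_self (fock_L2 (F_fock _))) F_norm// -rmorphM mulr1.
  by [].
rewrite -[Bs n.+1]/(deflate (Bs n) (lam n, F n)) quad_deflate; [|exact: F_fock..].
apply: (@le_trans _ _ (quad (Bs n) (F n.+1))).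
  by rewrite gerBl mulr_ge0// ?lam_ge0// sqr_ge0.
by apply: (le_trans (Bs_max n (F_fock _))); rewrite F_norm ?mulr1.
Qed.

Let eig n k : fock k -> B (F n) k = (lam n)%:C * inner (F n) k.
Proof. by move=> Fk; rewrite -Bs_eig// Bs_perp// => i i_n; exact: orth_lt. Qed.

(** If all eigenvalues exceeded e, then J + 1 of the orthonormal eigenfunctions would have a unit
    combination whose first J coefficients vanish. Weak continuity compares it with 0 and bounds its
    form by e / 2, yet the form is at least e. *)
Let lam_cvg e : 0 < e -> exists n, lam n <= e.
Proof.
move=> e0; apply: contrapT => /forallNP H.
have le n : e < lam n by rewrite ltNge; apply/negP/H.
have lp n : 0 < lam n by exact: lt_trans (le n).
have [J [d [d0 HJ]]] := wB (divr_gt0 e0 (ltr0Sn R 1)).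
have [c [i0 ci0] cJ] := homogeneous_solution (fun (j : 'I_J) (i : 'I_J.+1) => coef (F i) j).
pose g z := \sum_i c i * F i z.
have FG : forall i : 'I_J.+1, fock (F i) by move=> i; exact: F_fock.
have Fg : fock g by exact: fock_lincomb.
have orthF D (nu : nat -> R) : (forall n k, fock k -> D (F n) k = (nu n)%:C * inner (F n) k) ->
    forall i j : 'I_J.+1, i != j -> D (F i) (F j) = 0.
  by move=> h i j ij; rewrite h ?orth ?mulr0.
have qI : nrm2 g = \sum_i normc (c i) ^+ 2.
  rewrite (nrm2E (fock_L2 Fg)) -/(quad (@inner R) g).
  rewrite (orthogonal_lincomb_quad c (inner_hform R) FG); last first.
    by apply: (orthF _ (fun=> 1)) => *; rewrite mul1r.
  by apply: eq_bigr => i _; rewrite /quad -nrm2E ?F_norm ?mulr1//; exact: fock_L2.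
have qB : e * nrm2 g <= quad B g.
  rewrite (orthogonal_lincomb_quad c hB FG (orthF _ _ eig)) qI mulr_sumr; apply: ler_sum => i _.
  rewrite mulrC ler_wpM2l ?sqr_ge0// /quad eig// (inner_self (fock_L2 (FG i))) F_norm// -rmorphM mulr1.
  exact: (ltW (le i)).
have gp : 0 < nrm2 g.
  rewrite qI (bigD1 i0)//= ltr_pwDl ?sumr_ge0//; last by move=> i _; exact: sqr_ge0.
  by rewrite lt0r sqr_ge0 andbT sqrf_eq0; apply: contra ci0 => /eqP/eq0_normc ->.
pose s := (Num.sqrt (nrm2 g))^-1.
have s2 : s ^+ 2 = (nrm2 g)^-1 by rewrite exprVn sqr_sqrtr// ltW.
have Fsg := fockZ s%:C Fg.
have n1 : nrm2 (fun z => s%:C * g z) = 1.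
  rewrite nrm2Z; last exact: fock_L2.
  by rewrite normc_real real_normK ?num_real// s2 mulVf// gt_eqF.
have n0 : nrm2 (fun=> 0 : C) <= 1.
  by rewrite nrm2E ?inner0l ?ler01//; exact: L2_0.
have := HJ _ _ Fsg (fock0 R) _ n0; rewrite n1 lexx => /(_ isT) H0.
have /H0 : (forall j, (j < J)%N -> normc (coef (fun z => s%:C * g z) j - coef (fun=> 0) j) <= d).
  move=> j jJ; rewrite /coef inner0l subr0 innerZl; [|exact: fock_L2|exact: ebas_L2].
  have E := hform_suml (index_enum 'I_J.+1) c (inner_hform R) FG (ebas_fock R j).
  have -> : inner g (ebas j) = 0 by exact: (etrans E (cJ (Ordinal jJ))).
  by rewrite mulr0 normc0 ltW.
rewrite quad0// subr0 (quadZ _ hB Fg) normc_real real_normK ?num_real// s2.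
rewrite ger0_norm; last first.
  by rewrite mulr_ge0 ?invr_ge0 ?(ltW gp)//; apply: (le_trans _ qB); rewrite mulr_ge0 ?ltW.
rewrite mulrC ler_pdivrMr// => h; have := le_trans qB h.
by rewrite ler_pM2r// => h'; lra.
Qed.

Lemma spectrum_exists : exists lam F, spectrum B lam F.
Proof.
exists lam, F; split=> //.
move=> n g Fg gn; have := Bs_max n Fg; rewrite /quad Bs_perp//.
Qed.

End spectrum.

(** From (2 x)^n <= n! e^(2x) one gets x^n / n! <= e^(2x) / 2^n, and 2^n >= n. *)
Lemma pow_fact_small (R : realType) (x e : R) : 0 <= x -> 0 < e -> exists n, x ^+ n / n`!%:R <= e.
Proof.
move=> x0 e0; exists (Num.bound (expR (2 * x) / e)); set n := Num.bound _.
rewrite ler_pdivrMr ?ltr0n ?fact_gt0//.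
have h := exp_bound_pow n (mulr_ge0 (ler0n R 2) x0).
have hn : expR (2 * x) / e < n%:R by rewrite archi_boundP// divr_ge0 ?expR_ge0 ?ltW.
have n2 : n%:R <= 2 ^+ n :> R by rewrite -natrX ler_nat ltnW// ltn_expl.
have p2 : (0 : R) < 2 ^+ n by rewrite exprn_gt0.
rewrite -(ler_pM2l p2) -exprMn; apply: (le_trans h).
rewrite [leRHS]mulrA [leRHS]mulrC ler_wpM2l//.
by move: hn; rewrite ltr_pdivrMr// => /ltW/le_trans; apply; rewrite ler_wpM2r// ltW.
Qed.

(** * Restriction to a subset of the plane *)

Section cut.
Variable R : realType.
Notation C := R[i].
Notation gauss := (@gauss R).
Implicit Types (f g : C -> C) (A : set C).

Lemma L2_le f g : measC f -> L2 g -> (forall z, normc (f z) <= normc (g z)) -> L2 f.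
Proof.
move=> mf [mg Ig] fg; split=> //.
apply: (@integ_le _ _ (fun z => normc (g z) ^+ 2 * gauss z) _ _ Ig).
  exact: (measRM (measC_normsqr mf) (@measR_gauss R)).
move=> z /=; rewrite ger0_norm; last by apply: mulr_ge0; [exact: sqr_ge0|exact: gauss_ge0].
rewrite ler_wpM2r ?gauss_ge0//.
by rewrite ler_pXn2r ?nnegrE ?normc_ge0.
Qed.

Lemma nrm2_le f g : measC f -> L2 g -> (forall z, normc (f z) <= normc (g z)) -> nrm2 f <= nrm2 g.
Proof.
move=> mf Lg fg; have [_ If] := L2_le mf Lg fg; have [_ Ig] := Lg.
apply: (intR_le If Ig) => z /=; rewrite ler_wpM2r ?gauss_ge0//.
by rewrite ler_pXn2r ?nnegrE ?normc_ge0.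
Qed.

Lemma nrm2D_le f g : L2 f -> L2 g -> nrm2 (fun z => f z + g z) <= 2 * nrm2 f + 2 * nrm2 g.
Proof.
move=> Lf Lg; have [_ I1] := L2D Lf Lg; have [_ If] := Lf; have [_ Ig] := Lg.
rewrite -!intRZ// -intRD; [|exact: integZ..].
apply: intR_le => //; first exact: (integD (integZ _ If) (integZ _ Ig)).
move=> z /=; rewrite !mulrA -mulrDl ler_wpM2r ?gauss_ge0//.
have := le_normcD (f z) (g z); have := normc_ge0 (f z + g z).
have := normc_ge0 (f z); have := normc_ge0 (g z).
set a := normc (_ + _); set x := normc (f z); set y := normc (g z) => *.
by have := sqr_ge0 (x - y); nra.
Qed.

Definition cut A f z : C := (\1_A z)%:C * f z.

Lemma normc_indic A z : normc (\1_A z : R)%:C = \1_A z.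
Proof. by rewrite normc_real ger0_norm// indic_ge0. Qed.

Lemma normc_cut A f z : normc (cut A f z) = \1_A z * normc (f z).
Proof. by rewrite normcM normc_indic. Qed.

Lemma indicM A z : (\1_A z * \1_A z : R) = \1_A z.
Proof. by rewrite indicE; case: (_ \in _); rewrite ?mul1r ?mul0r. Qed.

Lemma cut_measC A f : measSet A -> measC f -> measC (cut A f).
Proof. by move=> mA mf; exact: (measC_mul (measC_real (measR_indic mA)) mf). Qed.

Lemma cut_le A f z : normc (cut A f z) <= normc (f z).
Proof. by rewrite normc_cut ler_piMl ?normc_ge0 ?indic_le1. Qed.

Lemma cut_L2 A f : measSet A -> L2 f -> L2 (cut A f).
Proof.
move=> mA Lf; have [mf _] := Lf.
by apply: (L2_le (cut_measC mA mf) Lf) => z; exact: cut_le.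
Qed.

Lemma nrm2_cut_le A f : measSet A -> L2 f -> nrm2 (cut A f) <= nrm2 f.
Proof.
move=> mA Lf; have [mf _] := Lf.
by apply: (nrm2_le (cut_measC mA mf) Lf) => z; exact: cut_le.
Qed.

Lemma nrm2_cut_sub A A' f : measSet A -> measSet A' -> A `<=` A' -> L2 f ->
  nrm2 (cut A f) <= nrm2 (cut A' f).
Proof.
move=> mA mA' sA Lf; have [mf _] := Lf.
apply: (nrm2_le (cut_measC mA mf) (cut_L2 mA' Lf)) => z.
rewrite !normc_cut ler_wpM2r ?normc_ge0// !indicE.
by have [/set_mem/sA/mem_set ->|_] := boolP (z \in A).
Qed.

Lemma cutD A f g : cut A (fun z => f z + g z) = (fun z => cut A f z + cut A g z).
Proof. by apply/funext => z; rewrite /cut mulrDr. Qed.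

Lemma nrm2_cutD_le A f g : measSet A -> L2 f -> L2 g ->
  nrm2 (cut A (fun z => f z + g z)) <= 2 * nrm2 (cut A f) + 2 * nrm2 (cut A g).
Proof. by move=> mA Lf Lg; rewrite cutD; apply: nrm2D_le; exact: cut_L2. Qed.

Definition mass (rho : R) : R := intR (fun z : C => \1_(disc 0 rho) z).

Lemma nrm2_cut_sup rho f K : L2 f ->
  (forall z, disc 0 rho z -> normc (f z) ^+ 2 <= K) -> nrm2 (cut (disc 0 rho) f) <= K * mass rho.
Proof.
move=> Lf fK; have [_ I1] := cut_L2 (measSet_disc 0 rho) Lf.
have I2 := @integ_indic_disc R 0 rho.
rewrite /mass -intRZ//; apply: (intR_le I1 (integZ _ I2)) => z /=.
rewrite normc_cut indicE; case: (boolP (z \in disc 0 rho)) => [/set_mem zD|_].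
  rewrite mul1r mulr1; apply: (le_trans _ (fK z zD)).
  by rewrite ler_piMr ?gauss_le1// sqr_ge0.
by rewrite mul0r expr0n mul0r mulr0.
Qed.

(** Bounds the mass on the disc of radius [rho] of a unit vector whose first n coefficients vanish.
    It is e^(O(n)) / n!, the source of the factorial in the upper bound for the eigenvalues. *)
Definition tail (rho : R) n : R :=
  (rho ^+ 2) ^+ n / n`!%:R * (expR (rho ^+ 2) / gauss_mass R * mass rho).

Lemma tail_const_ge0 rho : 0 <= expR (rho ^+ 2) / gauss_mass R * mass rho.
Proof.
rewrite mulr_ge0 ?divr_ge0 ?expR_ge0 ?(ltW (gauss_mass_gt0 R))//.
by apply: intR_ge0 => z; exact: indic_ge0.
Qed.

Lemma nrm2_cut_tail rho f n : 0 <= rho -> fock f -> (forall k, (k < n)%N -> coef f k = 0) ->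
  nrm2 (cut (disc 0 rho) f) <= nrm2 f * tail rho n.
Proof.
move=> r0 Ff f0; rewrite /tail !mulrA.
apply: nrm2_cut_sup; first exact: fock_L2.
move=> z; rewrite /disc/= subr0 => /ltW zr; apply: (le_trans (fock_tail_bound z Ff f0)).
have zr2 : normc z ^+ 2 <= rho ^+ 2 by rewrite ler_pXn2r ?nnegrE ?normc_ge0.
rewrite !mulrA ler_wpM2r ?invr_ge0 ?(ltW (gauss_mass_gt0 R))//.
apply: ler_pM; rewrite ?expR_ge0 ?ler_expR//.
  by apply: divr_ge0 => //; apply: mulr_ge0; [exact: nrm2_ge0|apply: exprn_ge0; exact: sqr_ge0].
rewrite ler_wpM2r ?invr_ge0// ler_wpM2l ?nrm2_ge0//.
by apply: lerXn2r => //; rewrite nnegrE; exact: sqr_ge0.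
Qed.

Lemma tail_small rho e : 0 < e -> exists n, tail rho n <= e.
Proof.
move=> e0; have K0 := tail_const_ge0 rho; rewrite /tail; set K := expR _ / _ * _ in K0 *.
have K1 : 0 < 1 + K by rewrite ltr_pwDl.
have [n hn] := pow_fact_small (sqr_ge0 rho) (divr_gt0 e0 K1).
exists n; apply: (@le_trans _ _ (e / (1 + K) * K)); first by rewrite ler_wpM2r.
by rewrite mulrAC ler_pdivrMr// ler_wpM2l ?(ltW e0)// lerDr.
Qed.

End cut.

(** * The Hermitian form of a Toeplitz operator *)

Section toeplitz_form.
Variable R : realType.
Notation C := R[i].
Implicit Types (f g h : C -> C).

Record symbol (V : C -> R) (M : R) (A : set C) (rho : R) : Prop := Symbol {
  symbol_meas : measR V;
  symbol_M_gt0 : 0 < M;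
  symbol_rho_ge0 : 0 <= rho;
  symbol_measSet : measSet A;
  symbol_sub : A `<=` disc 0 rho;
  symbol_le : forall z, `|V z| <= M * \1_A z }.

Variables (V : C -> R) (M : R) (DD : set C) (rho : R).
Hypothesis sV : symbol V M DD rho.

Let M0 := symbol_M_gt0 sV.

Definition tform (W : C -> R) f g := inner (fun z => (W z)%:C * f z) g.

Lemma symbol_bnd z : normc (V z)%:C <= M.
Proof.
rewrite normc_real; apply: (le_trans (symbol_le sV z)).
by rewrite ler_piMr ?indic_le1// ltW.
Qed.

Lemma symbol_L2 f : L2 f -> L2 (fun z => (V z)%:C * f z).
Proof. by move=> Lf; apply: (L2_bounded_mul (measC_real (symbol_meas sV)) symbol_bnd Lf). Qed.

Lemma symbol_cut z : (V z)%:C = (V z)%:C * (\1_DD z)%:C :> C.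
Proof.
rewrite -rmorphM/=; congr (_%:C); have := symbol_le sV z; rewrite !indicE.
case: (_ \in _) => /=; first by rewrite !mulr1.
by rewrite !mulr0 normr_le0 => /eqP.
Qed.

Lemma tform_hform : hform (tform V).
Proof.
split=> [f g k Ff Fg Fk|c f k Ff Fk|f g Ff Fg]; rewrite /tform.
- rewrite -innerDl; [|exact/symbol_L2/fock_L2|exact/symbol_L2/fock_L2|exact: fock_L2].
  by congr inner; apply/funext => z; rewrite mulrDr.
- rewrite -innerZl; [|exact/symbol_L2/fock_L2|exact: fock_L2].
  by congr inner; apply/funext => z; rewrite mulrCA.
- rewrite -(inner_conj (symbol_L2 (fock_L2 Ff)) (fock_L2 Fg)) /inner.
  congr integralC; apply/funext => z.
  by rewrite rmorphM/= conj_real; ring.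
Qed.

Lemma tform_bound f g t : L2 f -> L2 g -> 0 < t ->
  normc (tform V f g) <= M * (t * nrm2 (cut DD f) + nrm2 (cut DD g) / t).
Proof.
move=> Lf Lg t0; have mD := symbol_measSet sV.
have Lcf := cut_L2 mD Lf; have Lcg := cut_L2 mD Lg.
have -> : tform V f g = inner (fun z => (V z)%:C * cut DD f z) (cut DD g).
  rewrite /tform /inner; congr integralC; apply/funext => z; rewrite /cut rmorphM/= conj_real.
  have E : (V z)%:C * ((\1_DD z)%:C * f z) * ((\1_DD z)%:C * (g z)^*) =
     ((V z)%:C * (\1_DD z)%:C) * (\1_DD z)%:C * (f z * (g z)^*) by ring.
  by rewrite E -!symbol_cut; ring.
(* With weight t / M the factor M^2 produced by the symbol turns into M t, and the other term into M
   / t. *)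
have Mt : 0 < t / M by rewrite divr_gt0.
apply: (le_trans (inner_bound (symbol_L2 Lcf) Lcg Mt)).
rewrite invf_div mulrDr; apply: lerD; last by rewrite mulrCA.
apply: (@le_trans _ _ (t / M * (M ^+ 2 * nrm2 (cut DD f)))).
  rewrite ler_wpM2l ?(ltW Mt)//.
  have [m1 _] := symbol_L2 Lcf.
  have h : nrm2 (fun z => (V z)%:C * cut DD f z) <= nrm2 (fun z => M%:C * cut DD f z).
    apply: (nrm2_le m1 (L2Z _ Lcf)) => z; rewrite (normcM (V z)%:C) (normcM M%:C) ler_wpM2r ?normc_ge0//.
    by apply: (le_trans (symbol_bnd z)); rewrite normc_real ler_norm.
  by apply: (le_trans h); rewrite nrm2Z// normc_real real_normK ?num_real.
by rewrite le_eqVlt; apply/orP; left; apply/eqP; field; rewrite gt_eqF.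
Qed.

Lemma quad_tform f : L2 f ->
  quad (tform V) f = intR (fun z => V z * (normc (f z) ^+ 2 * @gauss R z)).
Proof.
move=> Lf; rewrite /quad /tform /inner integralC_ReIm/=; congr intR; apply/funext => z.
have -> : (V z)%:C * f z * (f z)^* * (gauss z)%:C = (V z)%:C * (f z * (f z)^*) * (gauss z)%:C by ring.
by rewrite mulc_conj -!rmorphM; exact: (esym (mulrA _ _ _)).
Qed.

Lemma quad_tform_le f : L2 f -> quad (tform V) f <= 2 * M * nrm2 (cut DD f).
Proof.
move=> Lf; apply: (le_trans (ler_norm _)); apply: (le_trans (Re_le_normc _)).
by apply: (le_trans (tform_bound Lf Lf ltr01)); rewrite divr1; nra.
Qed.

Lemma tform_bounded : bounded_form (tform V).
Proof.
exists (2 * M) => f Ff f1; apply: (le_trans (quad_tform_le (fock_L2 Ff))).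
rewrite ger_pMr ?mulr_gt0//; apply: (le_trans _ f1).
exact: (nrm2_cut_le (symbol_measSet sV) (fock_L2 Ff)).
Qed.

(** Only h = f - g matters: its first J coefficients are small by assumption, and the remaining part
    is small on the disc carrying V by [tail_small]. *)
Lemma tform_weakly_continuous : weakly_continuous (tform V).
Proof.
move=> e e0; have mD := symbol_measSet sV.
(* [t] and [q] are tuned so that each of the two terms of E below is at most M (t + q / t) = e /
   4. *)
pose t := e / (8 * M); have t0 : 0 < t by rewrite divr_gt0// mulr_gt0.
pose q := e * t / (8 * M); have q0 : 0 < q.
  by apply: divr_gt0; apply: mulr_gt0.
have [J hJ] := tail_small rho (divr_gt0 q0 (ltr0Sn R 15)).
have d2p : 0 < q / (4 * J.+1%:R) by rewrite divr_gt0// mulr_gt0.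
exists J, (Num.sqrt (q / (4 * J.+1%:R))); split; first by rewrite sqrtr_gt0.
move=> f g Ff Fg f1 g1 fg; have hB := tform_hform.
have Lf := fock_L2 Ff; have Lg := fock_L2 Fg.
pose h z := f z + (-1) * g z.
have Fh : fock h by exact: (fockD Ff (fockZ _ Fg)).
have Lh := fock_L2 Fh.
have hE : h = (fun z => f z - g z) by apply/funext => z; rewrite /h mulN1r.
have ch k : coef h k = coef f k - coef g k by rewrite hE coefB.
have hN : nrm2 h <= 4.
  apply: (le_trans (nrm2D_le Lf (L2Z (-1) Lg))); rewrite nrm2Z// normcN normc1 expr1n.
  lra.
pose p := esum_ (coef h) J.
have Lp : L2 p by exact: esum_L2.
have Fp : fock p.
  by apply: (@fock_lincomb _ _ (fun k : 'I_J => coef h k) (fun k => ebas k)) => k; exact: ebas_fock.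
pose r z := h z - p z.
have rE : r = (fun z => h z + (-1) * p z) by apply/funext => z; rewrite /r mulN1r.
have Fr : fock r by rewrite rE; exact: (fockD Fh (fockZ _ Fp)).
have cr k : (k < J)%N -> coef r k = 0.
  by move=> kJ; rewrite coefB// coef_esum kJ subrr.
have rN : nrm2 r <= 4.
  apply: (le_trans _ hN); rewrite nrm2_sub_esum// gerBl.
  by apply: sumr_ge0 => k _; exact: sqr_ge0.
have small : nrm2 (cut DD h) <= q.
  have -> : h = (fun z => p z + r z) by apply/funext => z; rewrite /r; ring.
  apply: (le_trans (nrm2_cutD_le mD Lp (fock_L2 Fr))).
  have h1 : nrm2 (cut DD p) <= q / 4.
    apply: (le_trans (nrm2_cut_le mD Lp)); rewrite nrm2_esum.
    apply: (@le_trans _ _ (\sum_(k < J) (q / (4 * J.+1%:R)))).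
      apply: ler_sum => k _; rewrite -[leRHS](sqr_sqrtr (ltW d2p)).
      by rewrite ler_pXn2r ?nnegrE ?normc_ge0 ?sqrtr_ge0// ch fg.
    rewrite sumr_const card_ord -[_ *+ J]mulr_natr.
    have -> : q / (4 * J.+1%:R) * J%:R = q / 4 * (J%:R / J.+1%:R).
      by field; rewrite nat1r pnatr_eq0.
    apply: ler_piMr; first by apply: divr_ge0; [exact: ltW|].
    by rewrite ler_pdivrMr// mul1r ler_nat.
  have h2 : nrm2 (cut DD r) <= 4 * (q / 16).
    apply: (le_trans (nrm2_cut_sub mD (measSet_disc _ _) (symbol_sub sV) (fock_L2 Fr))).
    apply: (le_trans (nrm2_cut_tail (symbol_rho_ge0 sV) Fr cr)).
    by apply: ler_pM => //; rewrite ?nrm2_ge0// mulr_ge0 ?tail_const_ge0// divr_ge0// exprn_ge0// sqr_ge0.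
  lra.
have E : quad (tform V) f - quad (tform V) g = complex.Re (tform V h f + tform V g h).
  have FNg := fockZ (-1) Fg.
  rewrite /h (hformD hB Ff FNg Ff) (hformDr hB Ff FNg Fg) (hformZ hB _ Fg Ff) (hformZr _ hB Fg Fg).
  rewrite rmorphN1 !mulN1r /quad (hformC hB Ff Fg) !ReD !ReN Re_conj; ring.
rewrite E; apply: (le_trans (Re_le_normc _)); apply: (le_trans (le_normcD _ _)).
have t'0 : 0 < t^-1 by rewrite invr_gt0.
have b1 := tform_bound Lh Lf t'0; have b2 := tform_bound Lg Lh t0.
have cf : nrm2 (cut DD f) <= 1 by exact: (le_trans (nrm2_cut_le mD Lf)).
have cg : nrm2 (cut DD g) <= 1 by exact: (le_trans (nrm2_cut_le mD Lg)).
have hq : nrm2 (cut DD h) / t <= e / (8 * M).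
  by rewrite ler_pdivrMr//; apply: (le_trans small); rewrite /q mulrAC.
have k1 : normc (tform V h f) <= e / 4.
  apply: (le_trans b1); rewrite invrK [_^-1 * _]mulrC.
  have -> : e / 4 = M * (e / (8 * M) + t) by rewrite /t; field; rewrite gt_eqF.
  by rewrite ler_wpM2l ?(ltW M0)// lerD// ger_pMl.
have k2 : normc (tform V g h) <= e / 4.
  apply: (le_trans b2).
  have -> : e / 4 = M * (t + e / (8 * M)) by rewrite /t; field; rewrite gt_eqF.
  by rewrite ler_wpM2l ?(ltW M0)// lerD// ger_pMr.
lra.
Qed.

Lemma toeplitzP f : fock f ->
  fock (toeplitz V f) /\ forall k, fock k -> inner (toeplitz V f) k = tform V f k.
Proof.
move=> Ff; have LVf := symbol_L2 (fock_L2 Ff).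
have [g hg] := fock_projection LVf.
have [FT hT] : (fock (toeplitz V f) /\ forall k, fock k ->
  inner (fun z => (V z)%:C * f z - toeplitz V f z) k = 0) by exact: (@xgetPex _ (fun=> 0) [set _ | _] (ex_intro _ g hg)).
split=> // k Fk; apply/esym/eqP; rewrite -subr_eq0; apply/eqP; rewrite -[RHS](hT k Fk).
have LN := L2Z (-1) (fock_L2 FT).
have -> : (fun z => (V z)%:C * f z - toeplitz V f z) =
   (fun z => (V z)%:C * f z + (-1) * toeplitz V f z).
  by apply/funext => z; rewrite mulN1r.
by rewrite innerDl ?innerZl ?mulN1r//; exact: fock_L2.
Qed.

Lemma toeplitz_eigP f mu : fock f -> toeplitz V f = (fun z => mu%:C * f z) <->
  forall k, fock k -> tform V f k = mu%:C * inner f k.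
Proof.
move=> Ff; have [FT hT] := toeplitzP Ff; split.
  move=> E k Fk; rewrite -hT// E innerZl//; exact: fock_L2.
move=> H; apply: (fock_coef_inj FT (fockZ _ Ff)) => k.
have Fe := ebas_fock R k.
by rewrite /coef hT// H// innerZl//; exact: fock_L2.
Qed.

End toeplitz_form.

(** * Identification of the constructed spectrum with the enumerated eigenvalues *)

Section eigenvalue_enumeration.
Variable R : realType.
Notation C := R[i].
Implicit Types (f g h : C -> C).

(** [has_dim] asserts a basis of some size; this makes the size well defined, hence the enumeration
    of eigenvalues unique. *)
Lemma has_dim_le (E : set (C -> C)) m n : has_dim E m -> has_dim E n -> (m <= n)%N.
Proof.
move=> [b [bE bfree _]] [b' [_ _ b'span]]; rewrite leqNgt; apply/negP => nm.
pose w (i : 'I_n.+1) := widen_ord nm i.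
have /choice[A HA] : forall i : 'I_m, exists c : 'I_n -> C, forall z, b i z = \sum_(j < n) c j * b' j z.
  by move=> i; exact: b'span.
have [c [i0 ci0] hc] := homogeneous_solution (fun (j : 'I_n) (i : 'I_n.+1) => A (w i) j).
pose c' (i : 'I_m) : C := if insub (val i) is Some k then c k else 0.
have c'w k : c' (w k) = c k by rewrite /c' /= valK.
have H (G : 'I_m -> C) : \sum_(i < m) c' i * G i = \sum_(k < n.+1) c k * G (w k).
  rewrite (bigID (fun i : 'I_m => (i < n.+1)%N))/= [X in _ + X]big1 ?addr0; last first.
    by move=> i ni; rewrite /c' insubN ?mul0r.
  rewrite (reindex_onto w (fun i => inord i)); last first.
    by move=> i i_n; apply/val_inj; rewrite /= inordK.
  apply: eq_big => [k|k _]; last by rewrite c'w.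
  by rewrite /= ltn_ord/=; apply/eqP/val_inj; rewrite /= inordK.
have : c' (w i0) = 0.
  apply: bfree => z; rewrite H.
  under eq_bigr do rewrite HA mulr_sumr.
  rewrite exchange_big/= big1// => j _.
  by under eq_bigr do rewrite mulrA; rewrite -mulr_suml hc mul0r.
by rewrite c'w => /eqP; rewrite (negbTE ci0).
Qed.

Lemma enumerates_pos_eigenvalues_unique (T : (C -> C) -> C -> C) lam lam' :
  enumerates_pos_eigenvalues T lam -> enumerates_pos_eigenvalues T lam' -> lam = lam'.
Proof.
move=> [n1 p1 h1] [n2 p2 h2]; apply: multiplicities_inj => // mu mu0.
have [m d1 c1] := h1 _ mu0; have [m' d2 c2] := h2 _ mu0.
split; first by apply/finite_setP; exists m.
have mm : m = m' by apply/eqP; rewrite eqn_leq (has_dim_le d1 d2) (has_dim_le d2 d1).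
by apply: (card_eq_trans c1); rewrite mm card_eq_sym.
Qed.

Variables (V : C -> R) (M : R) (A : set C) (rho : R).
Hypothesis sV : symbol V M A rho.
Variables (lam : nat -> R) (F : nat -> C -> C).
Hypothesis sp : spectrum (tform V) lam F.

Let hB := tform_hform sV.
Let F_fock := sp_fock sp.

Lemma spectrum_fin mu : 0 < mu -> finite_set [set n | lam n = mu].
Proof.
move=> mu0; have [N hN] := sp_cvg sp (divr_gt0 mu0 (ltr0Sn R 1)).
apply: (@sub_finite_set _ _ `I_N); last exact: finite_II.
move=> n /= E; rewrite ltnNge; apply/negP => /(sp_noninc sp); rewrite E.
by move=> /le_trans /(_ hN); lra.
Qed.

(** For such a g the form equals mu |g|^2, while [sp_max] bounds it by lam n |g|^2 for every n, and
    lam n drops below [mu]. *)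
Lemma spectrum_complete g mu : fock g -> 0 < mu ->
  (forall k, fock k -> tform V g k = mu%:C * inner g k) ->
  (forall n, inner g (F n) = 0) -> g = (fun=> 0).
Proof.
move=> Fg mu0 geig gF; apply: (fock_nrm2_eq0 Fg).
apply/eqP; rewrite eq_le nrm2_ge0 andbT; apply/negPn/negP; rewrite -ltNge => gp.
have [n hn] := sp_cvg sp (divr_gt0 mu0 (ltr0Sn R 1)).
have := sp_max sp Fg (fun i (_ : (i < n)%N) => gF i).
rewrite /quad geig// (inner_self (fock_L2 Fg)) -rmorphM/= ler_pM2r// => h.
by have := le_trans h hn; lra.
Qed.

Lemma spectrum_orth g mu n : fock g ->
  (forall k, fock k -> tform V g k = mu%:C * inner g k) -> lam n != mu -> inner g (F n) = 0.
Proof.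
move=> Fg geig nmu; have hI := inner_hform R.
have := geig _ (F_fock n); rewrite (hformC hB (F_fock n) Fg) (sp_eig sp)// rmorphM/= conj_real.
rewrite -(hformC hI (F_fock n) Fg) => /eqP; rewrite -subr_eq0 -mulrBl -rmorphB mulf_eq0.
by case/orP=> [/eqP[]/eqP|/eqP//]; rewrite subr_eq0 (negbTE nmu).
Qed.

(** The eigenspace of [mu] is spanned by the [F n] with lam n = mu: an eigenfunction minus its
    projection on them is an eigenfunction orthogonal to every [F n], hence 0. *)
Lemma spectrum_enumerates : enumerates_pos_eigenvalues (toeplitz V) lam.
Proof.
split; [exact: (sp_noninc sp)|exact: (sp_ge0 sp)|move=> mu mu0].
have /finite_setP[m cm] := spectrum_fin mu0; exists m => //.
have /card_set_bijP[N [Nfun Ninj Nsurj]] : (`I_m #= [set n | lam n = mu])%card by rewrite card_eq_sym.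
have lamN (i : 'I_m) : lam (N i) = mu by apply: Nfun => /=.
have nN (i : 'I_m) : nrm2 (F (N i)) = 1 by apply: (sp_norm sp); rewrite lamN.
have hI := inner_hform R.
pose b (i : 'I_m) := F (N i); have Fb i : fock (b i) by exact: F_fock.
have inner_comb c j : inner (fun z => \sum_(i < m) c i * b i z) (b j) = c j.
  rewrite (hform_suml _ _ hI Fb (Fb j)) (bigD1 j)//= big1 ?addr0.
    by rewrite (inner_self (fock_L2 (Fb j))) nN mulr1.
  move=> i ij; rewrite (sp_orth sp) ?mulr0//; apply: contra ij => /eqP E.
  by apply/eqP/val_inj/Ninj => //; rewrite inE /=.
exists b; split.
- move=> i; split; first exact: Fb.
  apply/(toeplitz_eigP sV _ (Fb i)) => k Fk.
  by rewrite (sp_eig sp)// lamN.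
- move=> c H j; rewrite -(inner_comb c j).
  have -> : (fun z => \sum_(i < m) c i * b i z) = (fun=> 0) by apply/funext.
  exact: inner0l.
- move=> f [Ff /(toeplitz_eigP sV _ Ff) feig].
  exists (fun i => inner f (b i)); set c := fun i => inner f (b i).
  pose p z := \sum_(i < m) c i * b i z.
  have Fp : fock p by exact: fock_lincomb.
  pose g z := f z + (-1) * p z.
  have FNp := fockZ (-1) Fp.
  have Fg : fock g by exact: (fockD Ff FNp).
  have peig k : fock k -> tform V p k = mu%:C * inner p k.
    move=> Fk; rewrite /p (hform_suml _ _ hB Fb Fk) (hform_suml _ _ hI Fb Fk) mulr_sumr.
    by apply: eq_bigr => i _; rewrite (sp_eig sp)// lamN; ring.
  have geig k : fock k -> tform V g k = mu%:C * inner g k.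
    move=> Fk; rewrite /g (hformD hB Ff FNp Fk) (hformZ hB _ Fp Fk) feig// peig//.
    by rewrite (hformD hI Ff FNp Fk) (hformZ hI _ Fp Fk); ring.
  have gF n : inner g (F n) = 0.
    have [E|/(spectrum_orth Fg geig)//] := eqVneq (lam n) mu.
    have [i im Ni] := Nsurj n E; rewrite -Ni.
    change (inner g (b (Ordinal (im : (i < m)%N))) = 0).
    rewrite /g (hformD hI Ff FNp (Fb _)) (hformZ hI _ Fp (Fb _)) inner_comb /c; ring.
  move=> z; have := congr1 (@^~ z) (spectrum_complete Fg mu0 geig gF).
  by rewrite /g mulN1r => /eqP; rewrite subr_eq0 => /eqP.
Qed.

Lemma lambda_plusE : lambda_plus V = lam.
Proof.
apply: xget_unique; first exact: spectrum_enumerates.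
by move=> l /enumerates_pos_eigenvalues_unique; apply; exact: spectrum_enumerates.
Qed.

End eigenvalue_enumeration.

(** * Polynomials on discs *)

Section exponential_bounds.
Variable R : realType.
Implicit Types (u v : nat -> R).

(** Bookkeeping for factors e^(O(N)), which make up the O(n) in the final exponent. *)
Definition exp_bounded u := exists2 K : R, 0 < K & forall N, (0 < N)%N -> u N <= expR (K * N%:R).

Lemma exp_bounded_le u v : (forall N, (0 < N)%N -> u N <= v N) -> exp_bounded v -> exp_bounded u.
Proof. by move=> uv [K K0 h]; exists K => // N N0; apply: (le_trans (uv N N0)); exact: h. Qed.

Lemma exp_boundedM u v : (forall N, 0 <= u N) -> (forall N, 0 <= v N) ->
  exp_bounded u -> exp_bounded v -> exp_bounded (fun N => u N * v N).
Proof.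
move=> u0 v0 [K K0 h] [K' K'0 h']; exists (K + K'); first exact: addr_gt0.
by move=> N N0; rewrite mulrDl expRD; apply: ler_pM => //; [exact: h|exact: h'].
Qed.

Lemma exp_bounded_cst (c : R) : exp_bounded (fun=> c).
Proof.
exists (1 + `|c|); first by rewrite ltr_pwDl.
move=> N N0; apply: (@le_trans _ _ (1 + (1 + `|c|) * N%:R)); last exact: expR_ge1Dx.
have : 1 <= N%:R :> R by rewrite ler1n.
have := ler_norm c; have := normr_ge0 c; nra.
Qed.

Lemma exp_bounded_nat : exp_bounded (fun N => N%:R).
Proof.
exists 1 => // N _; rewrite mul1r; apply: le_trans (expR_ge1Dx _); lra.
Qed.

Lemma exp_bounded_pow (q : R) : 0 <= q -> exp_bounded (fun N => q ^+ N).
Proof.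
move=> q0; exists (1 + q); first by rewrite ltr_pwDl.
move=> N _; rewrite mulrC expRM_natl; apply: lerXn2r; rewrite ?nnegrE ?expR_ge0//.
by apply: le_trans (expR_ge1Dx _); lra.
Qed.

End exponential_bounds.

(** * Comparison of polynomial norms on discs and on the plane *)

Section polynomials.
Variable R : realType.
Notation C := R[i].
Notation c0 := (gauss_mass R).
Notation gauss := (@gauss R).
Implicit Types (q : {poly C}) (a z : C) (r rho : R).

Definition polyfun q z : C := q.[z].

Lemma polyfunE q n : (size q <= n)%N -> polyfun q = fun z => \sum_(k < n) q`_k * mon k z.
Proof. by move=> qn; apply/funext => z; rewrite /polyfun (horner_coef_wide _ qn). Qed.

Lemma polyfun_fock q : fock (polyfun q).
Proof.
rewrite (polyfunE (leqnn _)).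
by apply: (@fock_lincomb _ _ (fun k : 'I__ => q`_k) (fun k => mon k)) => k; exact: mon_fock.
Qed.

Lemma nrm2_polyfun q n : (size q <= n)%N ->
  nrm2 (polyfun q) = \sum_(k < n) normc q`_k ^+ 2 * (k`!%:R * c0).
Proof.
move=> qn; rewrite (nrm2E (fock_L2 (polyfun_fock q))) -/(quad (@inner R) _) (polyfunE qn).
rewrite (@orthogonal_lincomb_quad _ _ (fun k : 'I_n => q`_k) (fun k : 'I_n => mon k)); last first.
- by move=> i j ij; exact: mon_orthogonal.
- by move=> k; exact: mon_fock.
- exact: inner_hform.
by apply: eq_bigr => k _; rewrite /quad mon_norm.
Qed.

Lemma inner_polyfun q k : inner (polyfun q) (mon k) = q`_k * (k`!%:R * c0)%:C.
Proof.
rewrite (polyfunE (leq_maxl (size q) k.+1)) inner_suml; [|by move=> j; exact: mon_L2|exact: mon_L2].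
rewrite (bigD1 (Ordinal (leq_maxr (size q) k.+1)))//= big1 ?addr0 ?mon_norm// => j jk.
by rewrite mon_orthogonal ?mulr0//; apply: contra jk => /eqP jk; apply/eqP/val_inj.
Qed.

Lemma polyfun_eq0 q : polyfun q = (fun=> 0) -> q = 0.
Proof.
move=> q0; apply/polyP => k; rewrite coef0; have := inner_polyfun q k.
rewrite q0 inner0l => /esym/eqP; rewrite mulf_eq0 => /orP[/eqP//|/eqP[]/eqP].
by rewrite mulf_eq0 pnatr_eq0 (gt_eqF (gauss_mass_gt0 R)) orbF -leqn0 leqNgt fact_gt0.
Qed.

Lemma esum_polyfun b n : exists2 q : {poly C}, (size q <= n)%N & esum_ b n = polyfun q.
Proof.
exists (\poly_(k < n) (b k * (enorm R k)%:C)); first exact: size_poly.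
apply/funext => z; rewrite /polyfun horner_poly; apply: eq_bigr => k _.
by rewrite /ebas mulrA.
Qed.

Definition disc_form r := tform (fun z : C => \1_(disc 0 r) z : R).

Lemma symbol_disc r : 0 <= r -> symbol (fun z : C => \1_(disc 0 r) z : R) 1 (disc 0 r) r.
Proof.
move=> r0; split=> //; [exact: (measR_indic (measSet_disc _ _))|exact: measSet_disc|].
by move=> z; rewrite mul1r ger0_norm ?indic_ge0.
Qed.

Lemma quad_indic A f : measSet A -> L2 f -> nrm2 (cut A f) = complex.Re (tform (fun z => \1_A z : R) f f).
Proof.
move=> mA Lf; rewrite nrm2E; last exact: cut_L2.
congr complex.Re; rewrite /inner /tform /inner; congr integralC; apply/funext => z.
by rewrite /cut rmorphM/= conj_real mulrCA !mulrA -rmorphM/= indicM.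
Qed.

Lemma disc_orthogonal r j k : j != k -> disc_form r (mon j) (mon k) = 0.
Proof.
move=> jk; have b1 (z : C) : `|\1_(disc 0 r) z : R| <= 1 by rewrite ger0_norm ?indic_ge0 ?indic_le1.
apply: (radial_orthogonal (measR_indic (measSet_disc 0 r)) b1) => // u z u1.
by rewrite !indicE; congr (_%:R); congr nat_of_bool; apply/idP/idP; rewrite !inE /disc/= !subr0 normcM u1 mul1r.
Qed.

(** Monomials stay orthogonal on a centred disc, so the mass of a polynomial there dominates that of
    each of its terms. *)
Lemma disc_coef_le r q k : 0 <= r ->
  normc q`_k ^+ 2 * nrm2 (cut (disc 0 r) (mon k)) <= nrm2 (cut (disc 0 r) (polyfun q)).
Proof.
move=> r0; have mD := measSet_disc (0 : C) r; have sD := symbol_disc r0.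
rewrite (quad_indic mD (fock_L2 (polyfun_fock q))) (polyfunE (leq_maxl (size q) k.+1)).
set n := maxn _ _.
rewrite -/(disc_form r) -/(quad (disc_form r) _).
rewrite (@orthogonal_lincomb_quad _ _ (fun k : 'I_n => q`_k) (fun k : 'I_n => mon k)); last first.
- by move=> i j ij; exact: disc_orthogonal.
- by move=> i; exact: mon_fock.
- exact: (tform_hform sD).
rewrite (bigD1 (Ordinal (leq_maxr (size q) k.+1)))//= /quad -(quad_indic mD (mon_L2 R k)) lerDl.
apply: sumr_ge0 => i _; rewrite mulr_ge0 ?sqr_ge0//.
by rewrite -(quad_indic mD (mon_L2 R i)) nrm2_ge0.
Qed.

Lemma gauss_ge_disc rho z : disc 0 rho z -> expR (- rho ^+ 2) <= gauss z.
Proof.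
rewrite /disc/= subr0 => zr; rewrite ler_expR lerN2.
by rewrite ler_sqr ?nnegrE ?normc_ge0// ltW// (le_lt_trans (normc_ge0 z)).
Qed.

(** The disc of radius r/8 around 3r/4 lies in the given one, and |z| >= r/2 on it. *)
Lemma disc_mon_ge r : 0 < r -> exists2 nu, 0 < nu &
  forall k, (r ^+ 2 / 4) ^+ k * nu <= nrm2 (cut (disc 0 r) (mon k)).
Proof.
move=> r0; pose b : C := (3 * r / 4)%:C; pose t := r / 8.
have t0 : 0 < t by rewrite divr_gt0.
pose g := expR (- r ^+ 2); have g0 : 0 < g by exact: expR_gt0.
have m0 := @disc_mass_gt0 R b t t0; set m := intR _ in m0.
have bn : normc b = 3 * r / 4 by rewrite normc_real ger0_norm// !mulr_ge0// ltW.
exists (g * m); first exact: mulr_gt0.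
move=> k; rewrite mulrA /m -intRZ; last exact: integ_indic_disc.
have [_ I1] := cut_L2 (measSet_disc 0 r) (mon_L2 R k).
apply: (intR_le (integZ _ (@integ_indic_disc R b t)) I1) => z /=.
rewrite indicE; case: (boolP (z \in disc b t)) => [|_]; last first.
  by rewrite mulr0 mulr_ge0 ?sqr_ge0 ?gauss_ge0.
rewrite inE /disc/= => zb.
have zr : disc 0 r z.
  rewrite /disc/= subr0 -[z](subrK b); apply: (le_lt_trans (le_normcD _ _)); rewrite bn.
  by move: zb; rewrite /t; lra.
have zl : r / 2 <= normc z.
  have : normc b <= normc (z - b) + normc z.
    by rewrite normc_distC -{1}[b](subrK z); exact: le_normcD.
  by rewrite bn; move: zb; rewrite /t; lra.
rewrite mulr1 normc_cut indicE mem_set// mul1r /mon normcX -exprM mulnC exprM.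
apply: ler_pM; rewrite ?exprn_ge0 ?(ltW g0)//; first by rewrite divr_ge0 ?sqr_ge0.
  apply: lerXn2r; rewrite ?nnegrE ?sqr_ge0 ?divr_ge0 ?sqr_ge0//.
  have -> : r ^+ 2 / 4 = (r / 2) ^+ 2 by field.
  by apply: lerXn2r; rewrite ?nnegrE ?normc_ge0// divr_ge0// ltW.
exact: gauss_ge_disc.
Qed.

(** Expanding around [a] moves the disc to the origin, where [disc_coef_le] applies. The Gaussian
    weight is not translation invariant; it is bounded by 1 on one side and below by [g] on the
    other. *)
Lemma poly_coef_bound a r : 0 < r -> exists2 K, 0 < K & exists2 Q, 1 <= Q &
  forall q k, normc (q \Po ('X + a%:P))`_k ^+ 2 <= K * Q ^+ k * nrm2 (cut (disc a r) (polyfun q)).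
Proof.
move=> r0; have [nu nu0 Hnu] := disc_mon_ge r0.
pose g := expR (- (r + normc a) ^+ 2); have g0 : 0 < g by exact: expR_gt0.
exists (nu * g)^-1; first by rewrite invr_gt0 mulr_gt0.
exists (1 + 4 / r ^+ 2); first by rewrite lerDl divr_ge0 ?sqr_ge0.
move=> q k; set p := q \Po _.
have mD := measSet_disc (0 : C) r; have mDa := measSet_disc a r.
have Lp := fock_L2 (polyfun_fock p); have Lq := fock_L2 (polyfun_fock q).
have trans : g * nrm2 (cut (disc 0 r) (polyfun p)) <= nrm2 (cut (disc a r) (polyfun q)).
  pose u z := \1_(disc a r) z * normc (polyfun q z) ^+ 2.
  have mu : measR u.
    by have [m1 _] := Lq; exact: (measRM (measR_indic mDa) (measC_normsqr m1)).
  have [_ I1] := cut_L2 mD Lp; have [_ I2] := cut_L2 mDa Lq.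
  have ug z : u z <= g^-1 * (normc (cut (disc a r) (polyfun q) z) ^+ 2 * gauss z).
    rewrite normc_cut /u indicE; case: (boolP (z \in disc a r)) => [|_]; last first.
      by rewrite !mul0r expr0n mul0r mulr0.
    rewrite inE => zD; rewrite !mul1r mulrCA ler_peMr ?sqr_ge0// ler_pdivlMl// mulr1.
    apply: gauss_ge_disc; rewrite /disc/= subr0; exact: (disc_norm_lt zD).
  have iu : integ u.
    apply: (integ_le mu _ (integZ g^-1 I2)) => z /=; rewrite ger0_norm//.
    by rewrite mulr_ge0 ?indic_ge0 ?sqr_ge0.
  have pT := dm_preserving_translation a.
  have h1 : nrm2 (cut (disc 0 r) (polyfun p)) <= intR (fun z => u (z + a)).
    apply: (intR_le I1 (integ_preserving pT iu)) => z /=.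
    have E : \1_(disc 0 r) z = \1_(disc a r) (z + a) :> R.
      by rewrite !indicE; congr (_%:R); congr nat_of_bool; apply/idP/idP; rewrite !inE /disc/= subr0 addrK.
    have Ep : polyfun p z = polyfun q (z + a) by rewrite /polyfun /p horner_comp !hornerE.
    rewrite normc_cut E Ep /u exprMn expr2 indicM.
    by rewrite ler_piMr ?gauss_le1// mulr_ge0 ?indic_ge0 ?sqr_ge0.
  rewrite mulrC -ler_pdivlMr// mulrC; apply: (le_trans h1).
  rewrite (intR_preserving pT mu) /nrm2 -intRZ//.
  exact: (intR_le iu (integZ _ I2) ug).
have h := disc_coef_le p k (ltW r0).
have rk : 0 < (r ^+ 2 / 4) ^+ k by rewrite exprn_gt0// divr_gt0// exprn_gt0.
have h2 : normc p`_k ^+ 2 * ((r ^+ 2 / 4) ^+ k * nu) <= g^-1 * nrm2 (cut (disc a r) (polyfun q)).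
  rewrite ler_pdivlMl//; apply: le_trans trans; rewrite ler_wpM2l ?(ltW g0)//.
  by apply: le_trans h; rewrite ler_wpM2l ?sqr_ge0.
have h3 : normc p`_k ^+ 2 <= (nu * g)^-1 * (4 / r ^+ 2) ^+ k * nrm2 (cut (disc a r) (polyfun q)).
  have -> : (nu * g)^-1 * (4 / r ^+ 2) ^+ k * nrm2 (cut (disc a r) (polyfun q)) =
      ((r ^+ 2 / 4) ^+ k * nu)^-1 * (g^-1 * nrm2 (cut (disc a r) (polyfun q))).
    by rewrite -[4 / _]invf_div exprVn !invfM; ring.
  by rewrite ler_pdivlMl ?mulr_gt0// mulrC.
apply: (le_trans h3); rewrite ler_wpM2r ?nrm2_ge0// ler_wpM2l ?invr_ge0 ?(ltW (mulr_gt0 nu0 g0))//.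
by apply: lerXn2r; rewrite ?nnegrE ?addr_ge0 ?divr_ge0 ?sqr_ge0// lerDr.
Qed.

(** A Remez-type comparison: passing from a small disc to a large one costs only an exponential in
    the degree. The Taylor coefficients at [a] are read off the small disc and resummed on the large
    one. *)
Lemma poly_disc_bound a r rho : 0 < r -> 0 <= rho -> exists2 K, 0 < K &
  forall q N, (0 < N)%N -> (size q <= N)%N ->
  nrm2 (cut (disc 0 rho) (polyfun q)) <= expR (K * N%:R) * nrm2 (cut (disc a r) (polyfun q)).
Proof.
move=> r0 rho0; have [K K0 [Q Q1 HQ]] := poly_coef_bound a r0.
pose T := Q * (1 + (rho + normc a) ^+ 2).
have T0 : 0 <= T by rewrite mulr_ge0 ?addr_ge0 ?sqr_ge0// (le_trans ler01).
have T1 : 1 <= T by rewrite mulr_ege1// lerDl sqr_ge0.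
have mass0 : 0 <= mass rho by apply: intR_ge0 => z; exact: indic_ge0.
have [L L0 HL] : exp_bounded (fun N => (N%:R * N%:R) * (K * mass rho * T ^+ N)).
  apply: exp_boundedM => [N|N||]; rewrite ?mulr_ge0 ?exprn_ge0 ?(ltW K0)//.
    by apply: exp_boundedM => //; exact: exp_bounded_nat.
  apply: exp_boundedM => [N|N||]; rewrite ?mulr_ge0 ?exprn_ge0 ?(ltW K0)//.
    exact: exp_bounded_cst.
  exact: exp_bounded_pow.
exists L => // q N N0 qN; set S := nrm2 (cut (disc a r) _).
have S0 : 0 <= S by exact: nrm2_ge0.
apply: (@le_trans _ _ (N%:R * N%:R * (K * mass rho * T ^+ N) * S)); last first.
  by rewrite ler_wpM2r//; exact: HL.
have -> : N%:R * N%:R * (K * mass rho * T ^+ N) * S = (N%:R * (N%:R * (K * T ^+ N * S))) * mass rho by ring.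
apply: nrm2_cut_sup; first exact: (fock_L2 (polyfun_fock q)).
move=> z; rewrite /disc/= subr0 => zr.
pose p := q \Po ('X + a%:P).
have pN : (size p <= N)%N.
  by rewrite size_comp_poly2// size_XaddC.
have -> : polyfun q z = \sum_(k < N) p`_k * (z - a) ^+ k.
  by rewrite -(horner_coef_wide _ pN) /polyfun horner_comp !hornerE subrK.
have h1 := @sum_cauchy_schwarz R _ (index_enum 'I_N) xpredT (fun=> 1 : R)
  (fun k : 'I_N => normc (p`_k * (z - a) ^+ k)) (fun=> ler01) (fun k => normc_ge0 _).
apply: (@le_trans _ _ ((\sum_(k < N) normc (p`_k * (z - a) ^+ k)) ^+ 2)).
  by apply: lerXn2r; rewrite ?nnegrE ?normc_ge0 ?normc_sum// sumr_ge0// => k _; exact: normc_ge0.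
move: h1; under eq_bigr do rewrite mul1r; move=> /le_trans; apply.
under eq_bigr do rewrite expr1n.
rewrite sumr_const card_ord ler_wpM2l//.
have -> : N%:R * (K * T ^+ N * S) = \sum_(k < N) (K * T ^+ N * S).
  by rewrite sumr_const card_ord mulr_natl.
apply: ler_sum => k _; rewrite normcM normcX exprMn -exprM mulnC exprM.
have za : normc (z - a) ^+ 2 <= 1 + (rho + normc a) ^+ 2.
  apply: (@le_trans _ _ ((rho + normc a) ^+ 2)); last by rewrite lerDr.
  apply: lerXn2r; rewrite ?nnegrE ?normc_ge0// ?addr_ge0 ?normc_ge0//.
  by apply: (le_trans (le_normcB _ _)); rewrite lerD2r ltW.
apply: (@le_trans _ _ (K * Q ^+ k * S * (1 + (rho + normc a) ^+ 2) ^+ k)).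
  apply: ler_pM; [exact: sqr_ge0|by apply: exprn_ge0; exact: sqr_ge0|exact: HQ|].
  by apply: lerXn2r; rewrite ?nnegrE ?sqr_ge0 ?addr_ge0 ?sqr_ge0.
have -> : K * Q ^+ k * S * (1 + (rho + normc a) ^+ 2) ^+ k = K * T ^+ k * S.
  by rewrite /T exprMn; ring.
by rewrite ler_wpM2r// ler_wpM2l ?(ltW K0)// ler_weXn2l// ltnW.
Qed.

(** The squared norm of z^k is k! c0, so recovering the Fock norm from coefficients costs N!. This
    is the origin of the factorial in the lower bounds for eigenvalues. *)
Lemma poly_fock_bound a r : 0 < r -> exists2 K, 0 < K &
  forall q N, (0 < N)%N -> (size q <= N)%N ->
  nrm2 (polyfun q) <= expR (K * N%:R) * N`!%:R * nrm2 (cut (disc a r) (polyfun q)).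
Proof.
move=> r0; have [K1 K10 H1] := poly_disc_bound a r0 ler01.
have [K K0 [Q Q1 HQ]] := @poly_coef_bound 0 1 ltr01.
have c00 := ltW (gauss_mass_gt0 R).
have Q0 : 0 <= Q by exact: le_trans Q1.
have [L L0 HL] : exp_bounded (fun N => N%:R * (c0 * K * Q ^+ N)).
  apply: exp_boundedM => [N|N||]; rewrite ?mulr_ge0 ?exprn_ge0 ?(ltW K0)//.
    exact: exp_bounded_nat.
  apply: exp_boundedM => [N|N||]; rewrite ?mulr_ge0 ?exprn_ge0 ?(ltW K0)//.
    exact: exp_bounded_cst.
  exact: exp_bounded_pow.
exists (L + K1) => [|q N N0 qN]; first exact: addr_gt0.
set S := nrm2 (cut (disc a r) _); pose S1 := nrm2 (cut (disc 0 1) (polyfun q)).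
have S10 : 0 <= S1 by exact: nrm2_ge0.
have key : nrm2 (polyfun q) <= N%:R * (c0 * K * Q ^+ N) * N`!%:R * S1.
  rewrite (nrm2_polyfun qN).
  have -> : N%:R * (c0 * K * Q ^+ N) * N`!%:R * S1 = \sum_(k < N) (K * Q ^+ N * S1 * (N`!%:R * c0)).
    by rewrite sumr_const card_ord -[RHS]mulr_natl; ring.
  apply: ler_sum => k _; apply: ler_pM; rewrite ?sqr_ge0 ?mulr_ge0//; last first.
    by rewrite ler_wpM2r// ler_nat; exact: (leq_fact (ltnW (ltn_ord k))).
  have := HQ q k; rewrite polyC0 addr0 comp_polyXr => /le_trans; apply.
  by rewrite ler_wpM2r// ler_wpM2l ?(ltW K0)// ler_weXn2l// ltnW.
apply: (le_trans key); have h2 := H1 q N N0 qN; rewrite -/S1 -/S in h2.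
rewrite mulrDl expRD.
apply: (@le_trans _ _ (expR (L * N%:R) * N`!%:R * (expR (K1 * N%:R) * S))).
  apply: ler_pM => //; rewrite ?mulr_ge0 ?exprn_ge0 ?(ltW K0)//.
  by rewrite ler_wpM2r//; exact: HL.
by rewrite le_eqVlt; apply/orP; left; apply/eqP; ring.
Qed.

End polynomials.

(** * Eigenvalue bounds for separated symbols *)

Section separated_symbols.
Variable R : realType.
Notation C := R[i].
Notation gauss := (@gauss R).
Implicit Types (f g h : C -> C) (A : set C).

Lemma nrm2_cut_mono A f g (H : R) : measSet A -> L2 f -> L2 g -> 0 <= H ->
  (forall z, A z -> normc (f z) ^+ 2 <= H * normc (g z) ^+ 2) ->
  nrm2 (cut A f) <= H * nrm2 (cut A g).
Proof.
move=> mA Lf Lg H0 fg; have [_ I1] := cut_L2 mA Lf; have [_ I2] := cut_L2 mA Lg.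
rewrite {2}/nrm2 -intRZ//; apply: (intR_le I1 (integZ _ I2)) => z /=.
rewrite mulrA ler_wpM2r ?gauss_ge0// !normc_cut indicE.
case: (boolP (z \in A)) => [/set_mem/fg|_]; first by rewrite !mul1r.
by rewrite !mul0r expr0n mulr0.
Qed.

Section bessel_projection.
Variables (n : nat) (E : 'I_n -> C -> C).
Hypotheses (EF : forall i, fock (E i)) (E1 : forall i, nrm2 (E i) = 1).
Hypothesis EO : forall i j, i != j -> inner (E i) (E j) = 0.

Lemma orthonormal_coord (c : 'I_n -> C) j : inner (fun z => \sum_i c i * E i z) (E j) = c j.
Proof.
rewrite (hform_suml _ _ (inner_hform R) EF (EF j)) (bigD1 j)//= big1 ?addr0.
  by rewrite (inner_self (fock_L2 (EF j))) E1 mulr1.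
by move=> i ij; rewrite EO ?mulr0.
Qed.

Lemma orthonormal_nrm2 (c : 'I_n -> C) :
  nrm2 (fun z => \sum_i c i * E i z) = \sum_i normc (c i) ^+ 2.
Proof.
rewrite (nrm2E (fock_L2 (fock_lincomb c EF))) -/(quad (@inner R) _).
rewrite (orthogonal_lincomb_quad c (inner_hform R) EF EO).
by apply: eq_bigr => i _; rewrite /quad (inner_self (fock_L2 (EF i))) E1 mulr1.
Qed.

Definition perp g z : C := g z - \sum_i inner g (E i) * E i z.

Lemma perp_fock g : fock g -> fock (perp g).
Proof.
move=> Fg; have := fockD Fg (fockZ (-1) (fock_lincomb (fun i => inner g (E i)) EF)).
by congr fock; apply/funext => z; rewrite mulN1r.
Qed.

Lemma perp_orth g j : fock g -> inner (perp g) (E j) = 0.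
Proof.
move=> Fg; have Fp := fock_lincomb (fun i => inner g (E i)) EF.
have -> : perp g = (fun z => g z + (-1) * \sum_i inner g (E i) * E i z).
  by apply/funext => z; rewrite mulN1r.
have hI := inner_hform R.
by rewrite (hformD hI Fg (fockZ _ Fp) (EF j)) (hformZ hI _ Fp (EF j)) orthonormal_coord mulN1r subrr.
Qed.

Lemma perp_nrm2 g : fock g -> nrm2 (perp g) = nrm2 g - \sum_i normc (inner g (E i)) ^+ 2.
Proof.
move=> Fg; pose c i := inner g (E i); have Fp := fock_lincomb c EF.
rewrite (nrm2B (fock_L2 Fg) (fock_L2 Fp)) orthonormal_nrm2.
rewrite (inner_conj (fock_L2 Fp) (fock_L2 Fg)) Re_conj (hform_suml _ _ (inner_hform R) EF Fg).
rewrite (big_morph (@complex.Re R) (@ReD R) (erefl : complex.Re 0 = 0)).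
have -> : \sum_i complex.Re (c i * inner (E i) g) = \sum_i normc (c i) ^+ 2.
  apply: eq_bigr => i _; rewrite (inner_conj (fock_L2 Fg) (fock_L2 (EF i))) -/(c i).
  by rewrite mulc_conj.
ring.
Qed.

Lemma perp_le g : fock g -> nrm2 (perp g) <= nrm2 g.
Proof. by move=> Fg; rewrite perp_nrm2// gerBl sumr_ge0// => i _; exact: sqr_ge0. Qed.

Lemma bessel_family g : fock g -> \sum_i normc (inner g (E i)) ^+ 2 <= nrm2 g.
Proof. by move=> Fg; rewrite -subr_ge0 -perp_nrm2// nrm2_ge0. Qed.

End bessel_projection.

(** There are n linear conditions on the n + 1 coefficients of [Q]. The multiplier [H] is 1 in the
    bound for singular values, and a high power of an affine polynomial in the bound for one
    sign. *)
Lemma poly_orthogonal_exists n (E : 'I_n -> C -> C) (H : {poly C}) :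
  (forall i, fock (E i)) -> exists Q : {poly C},
  [/\ Q != 0, (size Q <= n.+1)%N & forall j, inner (polyfun (Q * H)) (E j) = 0].
Proof.
move=> EF.
have [c [i0 ci0] hc] := homogeneous_solution (fun (j : 'I_n) (k : 'I_n.+1) =>
  inner (polyfun ('X^k * H)) (E j)).
pose Q : {poly C} := \sum_k c k *: 'X^k.
have Qk (k : 'I_n.+1) : Q`_k = c k.
  rewrite /Q coef_sum (bigD1 k)//= coefZ coefXn eqxx mulr1 big1 ?addr0// => i ik.
  have {}ik : (val k == val i) = false by apply/negbTE; rewrite eq_sym; exact: ik.
  by rewrite coefZ coefXn ik mulr0.
exists Q; split.
- by apply: contra ci0 => /eqP Q0; rewrite -Qk Q0 coef0.
- apply: (leq_trans (size_sum _ _ _)); apply/bigmax_leqP => k _.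
  by apply: (leq_trans (size_scale_leq _ _)); rewrite size_polyXn.
move=> j; rewrite -[RHS](hc j).
have -> : polyfun (Q * H) = fun z => \sum_k c k * polyfun ('X^k * H) z.
  apply/funext => z; rewrite /polyfun /Q mulr_suml horner_sum; apply: eq_bigr => k _.
  by rewrite -scalerAl hornerZ.
by rewrite (hform_suml _ _ (inner_hform R) _ (EF j))// => k; exact: polyfun_fock.
Qed.

(* [al * z + be] separates [Op] from [Om]; the discs witness nonempty interiors. *)
Record separated (W : C -> R) (M : R) (Op Om : set C) (rho c : R) (al be : C) (eps : R)
    (ap am : C) (r : R) : Prop := Separated {
  sep_symbol : symbol W M (Op `|` Om) rho;
  sep_measp : measSet Op;
  sep_measm : measSet Om;
  sep_c_gt0 : 0 < c;
  sep_Wp : forall z, Op z -> c <= W z;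
  sep_Wm : forall z, Om z -> W z <= - c;
  sep_eps_gt0 : 0 < eps;
  sep_linep : forall z, Op z -> eps <= complex.Re (al * z + be);
  sep_linem : forall z, Om z -> complex.Re (al * z + be) <= - eps;
  sep_r_gt0 : 0 < r;
  sep_discp : disc ap r `<=` Op;
  sep_discm : disc am r `<=` Om }.

Lemma symbolN (V : C -> R) M A rho : symbol V M A rho -> symbol (fun z => - V z) M A rho.
Proof.
case=> mV M0 r0 mA sA VA; split=> //; first exact: measRN.
by move=> z; rewrite normrN.
Qed.

Lemma separatedN W M Op Om rho c al be eps ap am r :
  separated W M Op Om rho c al be eps ap am r ->
  separated (fun z => - W z) M Om Op rho c (- al) (- be) eps am ap r.
Proof.
case=> sW mp mm c0 Wp Wm e0 lp lm r0 dp dm_; split=> //.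
- by rewrite setUC; exact: symbolN.
- by move=> z /Wm; rewrite lerNr.
- by move=> z /Wp; rewrite lerN2.
- by move=> z /lm; rewrite mulNr -opprD ReN lerNr.
- by move=> z /lp; rewrite mulNr -opprD ReN lerN2.
Qed.

Variables (W : C -> R) (M : R) (Op Om : set C) (rho c : R) (al be : C) (eps : R) (ap am : C) (r : R).
Hypothesis S : separated W M Op Om rho c al be eps ap am r.

Let sW := sep_symbol S.
Let O := Op `|` Om.
Let mO : measSet O := symbol_measSet sW.
Let hB := tform_hform sW.
Let M0 := symbol_M_gt0 sW.
Let c0 := sep_c_gt0 S.
Let e0 := sep_eps_gt0 S.
Let lin : {poly C} := al *: 'X + be%:P.
Let Cm := 1 + (normc al * rho + normc be) ^+ 2.

Let Cm_ge1 : 1 <= Cm. Proof. by rewrite lerDl sqr_ge0. Qed.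
Let Cm_gt0 : 0 < Cm. Proof. exact: lt_le_trans Cm_ge1. Qed.

Let linE z : lin.[z] = al * z + be.
Proof. by rewrite /lin !hornerE. Qed.

Let lin_le z : disc 0 rho z -> normc lin.[z] ^+ 2 <= Cm.
Proof.
rewrite /disc/= subr0 => /ltW zr; apply: (@le_trans _ _ ((normc al * rho + normc be) ^+ 2)); last first.
  by rewrite /Cm lerDr.
have h0 : 0 <= normc al * rho + normc be.
  by rewrite addr_ge0 ?mulr_ge0 ?normc_ge0// (symbol_rho_ge0 sW).
apply: lerXn2r; rewrite ?nnegrE ?normc_ge0//.
rewrite linE; apply: (le_trans (le_normcD _ _)).
by rewrite lerD2r normcM ler_wpM2l ?normc_ge0.
Qed.

Let size_lin : (size lin <= 2)%N.
Proof.
apply: (leq_trans (size_polyD _ _)); rewrite geq_max; apply/andP; split.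
  by apply: (leq_trans (size_scale_leq _ _)); rewrite size_polyX.
by apply: (leq_trans (size_polyC_leq1 _)).
Qed.

Let lin_cut_le A Q : measSet A -> A `<=` disc 0 rho ->
  nrm2 (cut A (polyfun (lin * Q))) <= Cm * nrm2 (cut A (polyfun Q)).
Proof.
move=> mA sA; apply: (nrm2_cut_mono mA (fock_L2 (polyfun_fock _)) (fock_L2 (polyfun_fock _)) (ltW Cm_gt0)).
move=> z /sA zD; rewrite /polyfun hornerM normcM exprMn ler_wpM2r ?sqr_ge0//.
exact: lin_le.
Qed.

(** W and Re (al z + be) have the same sign on [Op] and on [Om], so their product is at least c eps
    there; off these sets W vanishes. *)
Let coercive Q : c * eps * nrm2 (cut O (polyfun Q)) <=
  complex.Re (tform W (polyfun Q) (polyfun (lin * Q))).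
Proof.
have Lf := fock_L2 (polyfun_fock Q); have Lmf := fock_L2 (polyfun_fock (lin * Q)).
have [_ I1] := cut_L2 mO Lf; have [I2 _] := cinteg_inner (symbol_L2 sW Lf) Lmf.
rewrite /tform /inner integralC_ReIm /= -intRZ//; apply: (intR_le (integZ _ I1) I2) => z /=.
have -> : complex.Re ((W z)%:C * polyfun Q z * (polyfun (lin * Q) z)^* * (gauss z)%:C) =
    W z * complex.Re (al * z + be) * (normc (polyfun Q z) ^+ 2 * gauss z).
  have -> : (W z)%:C * polyfun Q z * (polyfun (lin * Q) z)^* * (gauss z)%:C =
     ((W z * (normc (polyfun Q z) ^+ 2 * gauss z))%:C : C) * (lin.[z])^*.
    rewrite /polyfun hornerM [(lin.[z] * _)^*]rmorphM/=.
    transitivity ((W z)%:C * (Q.[z] * Q.[z]^*) * (gauss z)%:C * (lin.[z])^*); first by ring.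
    rewrite mulc_conj -!rmorphM; by congr (_ * _); congr (_%:C); ring.
  by rewrite ReM /= mul0r subr0 Re_conj linE; ring.
rewrite normc_cut exprMn; set y := normc _ ^+ 2; have y0 : 0 <= y by exact: sqr_ge0.
have gz := gauss_ge0 z; have yg := mulr_ge0 y0 gz.
have := symbol_le sW z; rewrite !indicE; case: (boolP (z \in O)) => [|_]; last first.
  by rewrite mulr0 normr_le0 => /eqP ->; rewrite expr0n /= !mul0r mulr0.
rewrite inE => zO _; rewrite expr1n mul1r; apply: ler_wpM2r => //.
case: zO => zO.
  have := sep_Wp S zO; have := sep_linep S zO => h1 h2.
  by apply: ler_pM => //; exact: ltW.
have := sep_Wm S zO; have := sep_linem S zO => h1 h2.
have k1 : c <= - W z by rewrite lerNr.
have k2 : eps <= - complex.Re (al * z + be) by rewrite lerNr.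
by have := ler_pM (ltW c0) (ltW e0) k1 k2; rewrite mulrNN.
Qed.

Variables (a b : nat -> R) (Fp Fm : nat -> C -> C).
Hypothesis spp : spectrum (tform W) a Fp.
Hypothesis spm : spectrum (tform (fun z => - W z)) b Fm.

Let tformN f g : fock f -> fock g -> tform (fun z => - W z) f g = - tform W f g.
Proof.
move=> Ff Fg; rewrite /tform -mulN1r -innerZl; [|exact: (symbol_L2 sW (fock_L2 Ff))|exact: fock_L2].
by congr inner; apply/funext => z; rewrite rmorphN/=; ring.
Qed.

(** The first p members belong to positive eigenvalues, the others to negative ones, with signed
    eigenvalues [nu]; p is left free so that it can follow the merge. *)
Let E p i := if (i < p)%N then Fp i else Fm (i - p)%N.
Let nu p i := if (i < p)%N then a i else - b (i - p)%N.

Let E_fock p i : fock (E p i).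
Proof. by rewrite /E; case: ifP => _; [exact: (sp_fock spp)|exact: (sp_fock spm)]. Qed.

Let E_eig p i k : fock k -> tform W (E p i) k = (nu p i)%:C * inner (E p i) k.
Proof.
move=> Fk; rewrite /E /nu; case: ifP => _; first exact: (sp_eig spp).
have := sp_eig spm (i - p)%N Fk; rewrite tformN//; last exact: (sp_fock spm).
by move=> /(congr1 -%R); rewrite opprK => ->; rewrite rmorphN mulNr.
Qed.

(* The factor [h ^+ (k * N)] makes the test functions negligible on [Om] compared with [Op]. *)
Lemma positive_eigenvalue_bound : exists k, exists2 K, 0 < K &
  forall n, 1 <= expR (K * n.+1%:R) * ((k.+1 * n.+1)`!)%:R * a n.
Proof.
have [K1 K10 H1] := poly_fock_bound ap (sep_r_gt0 S).
have [K2 K20 H2] := poly_disc_bound ap (sep_r_gt0 S) (symbol_rho_ge0 sW).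
(* |lin + x|^2 = x^2 + 2 x Re lin + |lin|^2, and x eps = Cm makes the middle term at least 2 Cm on
   [Op] and at most -2 Cm on [Om], where |lin|^2 <= Cm cannot compensate it. *)
pose x := Cm / eps; have x0 : 0 < x by rewrite divr_gt0.
pose hp := x ^+ 2 + 2 * Cm; pose hm := x ^+ 2.
have hp0 : 0 < hp by apply: addr_gt0; [exact: exprn_gt0|exact: mulr_gt0].
have hm0 : 0 <= hm by exact: sqr_ge0.
pose h : {poly C} := lin + (x%:C)%:P.
have hE z : normc h.[z] ^+ 2 = x ^+ 2 + 2 * x * complex.Re (al * z + be) + normc lin.[z] ^+ 2.
  rewrite /h hornerD hornerC !sqr_normc_ReIm linE ReD ImD /=; ring.
have h_p z : Op z -> hp <= normc h.[z] ^+ 2.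
  move=> zO; rewrite hE; have := sep_linep S zO; set y := complex.Re _ => ey.
  have xe : x * eps = Cm by rewrite /x divfK// gt_eqF.
  have := ler_wpM2l (ltW x0) ey; have := sqr_ge0 (normc lin.[z]); rewrite xe /hp; lra.
have h_m z : Om z -> normc h.[z] ^+ 2 <= hm.
  move=> zO; rewrite hE; have := sep_linem S zO; set y := complex.Re _ => ey.
  have xe : x * eps = Cm by rewrite /x divfK// gt_eqF.
  have zD : disc 0 rho z by apply: (symbol_sub sW); right.
  have := ler_wpM2l (ltW x0) ey; have := lin_le zD; have := ltW Cm_gt0; rewrite mulrN xe /hm; lra.
pose th := hm / hp; have th0 : 0 <= th by rewrite divr_ge0// ltW.
have th1 : th < 1 by rewrite ltr_pdivrMr// mul1r ltrDl mulr_gt0.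
clearbody hp hm.
(* [k] is independent of n: th^k has to beat the loss e^K2 per degree in [poly_disc_bound]. The
   bound by 1 lets the N-th power be replaced by the first; the bound by c / (2 M) keeps the part on
   [Om] below half of the part on [Op]. *)
have [k hk] : exists k, expR K2 * th ^+ k <= Num.min 1 (c / (2 * M)).
  have m0 : 0 < Num.min 1 (c / (2 * M)) / expR K2.
    by rewrite divr_gt0 ?expR_gt0// lt_min ltr01 divr_gt0// mulr_gt0.
  have := @cvg_expr R th; rewrite ger0_norm// th1 => /(_ isT) /cvgrPdist_lt /(_ _ m0)[k _ hk].
  exists k; have := hk k (leqnn k); rewrite sub0r normrN ger0_norm ?exprn_ge0//.
  by rewrite ltr_pdivlMr ?expR_gt0// mulrC => /ltW.
have [L L0 HL] : exp_bounded (fun N => (expR K1 ^+ k.+1) ^+ N * (2 / c)).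
  apply: exp_boundedM => [N|N||]; rewrite ?exprn_ge0 ?expR_ge0 ?divr_ge0 ?(ltW c0)//.
    by apply: exp_bounded_pow; rewrite exprn_ge0 ?expR_ge0.
  exact: exp_bounded_cst.
exists k; exists L => // n; set N := n.+1.
have FpF (i : 'I_n) : fock (Fp i) by exact: (sp_fock spp).
have [Q [Q0 sQ fE]] := poly_orthogonal_exists (h ^+ (k * N)) FpF.
set f := polyfun _ in fE.
have Ff : fock f by exact: polyfun_fock.
have Lf := fock_L2 Ff; have LQ := fock_L2 (polyfun_fock Q).
have h_neq0 : h != 0.
  have z0 : Op ap by apply: (sep_discp S); rewrite /disc/= subrr normc0 (sep_r_gt0 S).
  apply: contraTneq (h_p _ z0) => ->.
  by rewrite horner0 normc0 expr0n /= -ltNge.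
have sh : (size h <= 2)%N.
  apply: (leq_trans (size_polyD _ _)); rewrite geq_max size_lin/=.
  exact: (leq_trans (size_polyC_leq1 _)).
have sf : (size (Q * h ^+ (k * N))%R <= k.+1 * N)%N.
  apply: (leq_trans (size_polyMleq _ _)); rewrite -subn1 leq_subLR.
  have s1 : (size (h ^+ (k * N)) <= (k * N).+1)%N.
    apply: (leq_trans (size_poly_exp_leq _ _)); rewrite ltnS.
    by rewrite -{2}[(k * N)%N]mul1n leq_mul2r; apply/orP; right; rewrite -subn1 leq_subLR.
  by apply: (leq_trans (leq_add sQ s1)); rewrite addnS add1n mulSn.
have fz z : normc (f z) ^+ 2 = (normc h.[z] ^+ 2) ^+ (k * N) * normc (polyfun Q z) ^+ 2.
  by rewrite /f /polyfun hornerM horner_exp normcM normcX exprMn -!exprM mulrC [(_ * 2)%N]mulnC.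
have mp := sep_measp S; have mm := sep_measm S.
have mD := measSet_disc ap r.
have fm : nrm2 (cut Om f) <= hm ^+ (k * N) * nrm2 (cut Om (polyfun Q)).
  apply: (nrm2_cut_mono mm Lf LQ); first exact: (exprn_ge0 _ hm0).
  move=> z zO; rewrite fz ler_wpM2r ?sqr_ge0//.
  by apply: lerXn2r; rewrite ?nnegrE ?sqr_ge0// h_m.
have fp : nrm2 (cut Op (polyfun Q)) <= (hp ^+ (k * N))^-1 * nrm2 (cut Op f).
  have hpk : 0 < hp ^+ (k * N) by rewrite exprn_gt0.
  apply: (nrm2_cut_mono mp LQ Lf); first by rewrite invr_ge0 ltW.
  move=> z zO; rewrite fz ler_pdivlMl// ler_wpM2r ?sqr_ge0//.
  by apply: lerXn2r; rewrite ?nnegrE ?sqr_ge0 ?(ltW hp0)// h_p.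
set X := nrm2 (cut Op f) in fp *.
have X_ge0 : 0 <= X by exact: nrm2_ge0.
have Qm : nrm2 (cut Om (polyfun Q)) <= expR (K2 * N%:R) * nrm2 (cut Op (polyfun Q)).
  have sOm : Om `<=` disc 0 rho by move=> z zO; apply: (symbol_sub sW); right.
  apply: (le_trans (nrm2_cut_sub mm (measSet_disc _ _) sOm LQ)).
  apply: (le_trans (H2 Q N (ltn0Sn n) sQ)); rewrite ler_wpM2l ?expR_ge0//.
  exact: (nrm2_cut_sub mD mp (sep_discp S) LQ).
have small : nrm2 (cut Om f) <= c / (2 * M) * X.
  apply: (le_trans fm).
  apply: (@le_trans _ _ (hm ^+ (k * N) * (expR (K2 * N%:R) * ((hp ^+ (k * N))^-1 * X)))).
    apply: ler_wpM2l; first exact: (exprn_ge0 _ hm0).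
    apply: (le_trans Qm).
    by rewrite ler_wpM2l ?expR_ge0.
  have -> : hm ^+ (k * N) * (expR (K2 * N%:R) * ((hp ^+ (k * N))^-1 * X)) = (expR K2 * th ^+ k) ^+ N * X.
    rewrite exprMn -exprM /th expr_div_n [K2 * _]mulrC expRM_natl; ring.
  rewrite ler_wpM2r//.
  move: hk; rewrite le_min => /andP[hk1 hk2]; apply: le_trans hk2.
  have y0 : 0 <= expR K2 * th ^+ k by rewrite mulr_ge0 ?expR_ge0 ?exprn_ge0.
  by rewrite /N exprS ler_piMr// exprn_ile1.
have quad_ge : c / 2 * X <= quad (tform W) f.
  have q1 : c * X - M * nrm2 (cut Om f) <= quad (tform W) f.
    have [_ I1] := cut_L2 mp Lf; have [_ I2] := cut_L2 mm Lf.
    have [I3 _] := cinteg_inner (symbol_L2 sW Lf) Lf.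
    rewrite quad_tform// /X -!intRZ// -intRB; [|exact: integZ..].
    apply: intR_le; first exact: (integB (integZ _ I1) (integZ _ I2)).
      congr integ: I3; apply/funext => z.
      have -> : (W z)%:C * f z * (f z)^* * (gauss z)%:C = (W z)%:C * (f z * (f z)^*) * (gauss z)%:C by ring.
      by rewrite mulc_conj -!rmorphM; exact: (esym (mulrA _ _ _)).
    move=> z /=; rewrite !normc_cut !exprMn.
    set y := normc (f z) ^+ 2; have yg : 0 <= y * gauss z by rewrite mulr_ge0 ?gauss_ge0 ?sqr_ge0.
    have -> : c * (\1_Op z ^+ 2 * y * gauss z) - M * (\1_Om z ^+ 2 * y * gauss z) =
       (c * \1_Op z ^+ 2 - M * \1_Om z ^+ 2) * (y * gauss z) by ring.
    rewrite ler_wpM2r// !expr2 !indicM.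
    have := symbol_le sW z; rewrite ler_norml => /andP[Wl _].
    have := @indic_ge0 R Om z => m_ge0.
    rewrite [\1_Op z]indicE; case: (boolP (z \in Op)) => [|zNp].
      rewrite inE => /(sep_Wp S) h1; rewrite mulr1.
      by apply: le_trans h1; rewrite gerBl mulr_ge0// ltW.
    rewrite mulr0 sub0r; apply: (le_trans _ Wl); rewrite lerN2 ler_wpM2l ?(ltW M0)//.
    rewrite !indicE in_setU (negbTE zNp) orFb//.
  apply: le_trans q1.
  have : M * nrm2 (cut Om f) <= c / 2 * X.
    apply: (@le_trans _ _ (M * (c / (2 * M) * X))); first by rewrite ler_wpM2l ?(ltW M0).
    by rewrite le_eqVlt; apply/orP; left; apply/eqP; field; rewrite gt_eqF.
  lra.
have nf0 : 0 < nrm2 f.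
  rewrite lt0r nrm2_ge0 andbT; apply/negP => /eqP/(fock_nrm2_eq0 Ff)/polyfun_eq0/eqP.
  by rewrite mulf_eq0 (negbTE Q0) expf_eq0 (negbTE h_neq0) andbF.
have hf : nrm2 f <= expR (K1 * (k.+1 * N)%:R) * ((k.+1 * N)`!)%:R * X.
  apply: (le_trans (H1 _ (k.+1 * N)%N (ltn0Sn _) sf)); rewrite ler_wpM2l ?mulr_ge0 ?expR_ge0//.
  exact: (nrm2_cut_sub mD mp (sep_discp S) Lf).
have X0 : 0 < X.
  rewrite lt0r X_ge0 andbT; apply/negP => /eqP XE.
  by move: hf; rewrite XE mulr0 leNgt nf0.
have qa : quad (tform W) f <= a n * nrm2 f.
  by apply: (sp_max spp Ff) => i i_n; exact: (fE (Ordinal i_n)).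
have an0 := sp_ge0 spp n.
have fin : c / 2 <= a n * (expR (K1 * (k.+1 * N)%:R) * ((k.+1 * N)`!)%:R).
  rewrite -(ler_pM2r X0); apply: (le_trans quad_ge); apply: (le_trans qa).
  by rewrite -mulrA ler_wpM2l.
have := HL N (ltn0Sn n); rewrite -exprM.
have -> : expR K1 ^+ (k.+1 * N) = expR (K1 * (k.+1 * N)%:R) by rewrite [K1 * _]mulrC expRM_natl.
move=> hL; apply: (@le_trans _ _ (expR (K1 * (k.+1 * N)%:R) * (2 / c) * ((k.+1 * N)`!)%:R * a n)).
  have -> : expR (K1 * (k.+1 * N)%:R) * (2 / c) * ((k.+1 * N)`!)%:R * a n =
    (a n * (expR (K1 * (k.+1 * N)%:R) * ((k.+1 * N)`!)%:R)) / (c / 2).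
    by field; rewrite gt_eqF.
  by rewrite ler_pdivlMr ?mul1r// divr_gt0.
by rewrite ler_wpM2r// ler_wpM2r.
Qed.

Hypotheses (a_gt0 : forall i, 0 < a i) (b_gt0 : forall i, 0 < b i).

Let E_nrm2 p i : nrm2 (E p i) = 1.
Proof. by rewrite /E; case: ifP => _; [exact: (sp_norm spp)|exact: (sp_norm spm)]. Qed.

(** Across the two families the eigenvalues -b k < 0 < a l differ, which forces orthogonality. *)
Let E_orth p i j : i != j -> inner (E p i) (E p j) = 0.
Proof.
have mixed k l : inner (Fm k) (Fp l) = 0.
  apply: (@spectrum_orth R W M _ rho sW a Fp spp (Fm k) (- b k) l (sp_fock spm k)).
    move=> h Fh; have := sp_eig spm k Fh; rewrite tformN//; last exact: (sp_fock spm).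
    by move=> /(congr1 -%R); rewrite opprK => ->; rewrite rmorphN mulNr.
  by rewrite gt_eqF// (lt_trans _ (a_gt0 l))// oppr_lt0.
move=> ij; rewrite /E; case: ltnP => ip; case: ltnP => jp; first exact: (sp_orth spp).
- rewrite (hformC (inner_hform R) (sp_fock spm _) (sp_fock spp _)) mixed; exact: rmorph0.
- exact: mixed.
- apply: (sp_orth spm); apply: contra ij => /eqP h.
  by rewrite -(subnK ip) -(subnK jp) h.
Qed.

(** The removed component is a combination of the E_i, and B(f, E_i) = nu_i <f, E_i> = 0. *)
Let perp_of_eig p n f g : fock f -> fock g ->
  (forall i : 'I_n, inner f (E p i) = 0) -> tform W f (perp (fun i : 'I_n => E p i) g) = tform W f g.
Proof.
move=> Ff Fg fE; have EF (i : 'I_n) : fock (E p i) by exact: E_fock.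
have Fs := fock_lincomb (fun i : 'I_n => inner g (E p i)) EF.
have -> : perp (fun i : 'I_n => E p i) g = (fun z => g z + (-1) * \sum_(i < n) inner g (E p i) * E p i z).
  by apply/funext => z; rewrite /perp mulN1r.
rewrite (hformDr hB Fg (fockZ _ Fs) Ff) (hformZr _ hB Fs Ff) (hformC hB Fs Ff).
rewrite (hform_suml _ _ hB EF Ff) big1 ?rmorph0 ?mulr0 ?addr0// => i _.
by rewrite E_eig// (hformC (inner_hform R) Ff (EF i)) fE rmorph0 !mulr0.
Qed.

(* [tform W f] vanishes on the eigenfunctions, so [lin * f] may be replaced by its
   projection [g'], and minimax applies to both [f + g'] and [f - g']. *)
Lemma eigenvalue_lower_bound : exists2 K, 0 < K & forall n p q s, (p + q)%N = n ->
  a p <= s -> b q <= s -> 1 <= expR (K * n.+1%:R) * (n.+1)`!%:R * s.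
Proof.
have [K K0 HK] := poly_fock_bound ap (sep_r_gt0 S).
have ce0 : 0 < 2 * (c * eps) by rewrite !mulr_gt0.
set T := (1 + expR K * Cm) / (2 * (c * eps)).
have T0 : 0 <= T.
  by rewrite divr_ge0 ?(ltW ce0)// addr_ge0// mulr_ge0 ?expR_ge0// ltW.
have [L L0 HL] : exp_bounded (fun N => (expR K) ^+ N * ((1 + N%:R) * T)).
  have h0 N : 0 <= 1 + N%:R :> R by rewrite addr_ge0.
  apply: exp_boundedM => [N|N||].
  - by rewrite exprn_ge0 ?expR_ge0.
  - by rewrite mulr_ge0.
  - by apply: exp_bounded_pow; exact: expR_ge0.
  apply: exp_boundedM => //; last exact: exp_bounded_cst.
  apply: (@exp_bounded_le R _ (fun N => 2 ^+ N)) => [N N0|]; last exact: exp_bounded_pow.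
  by rewrite -natrX nat1r ler_nat; exact: ltn_expl.
exists L => // n p q s pq aps bqs.
have EF (i : 'I_n) : fock (E p i) by exact: E_fock.
have EN (i : 'I_n) : nrm2 (E p i) = 1 by exact: E_nrm2.
have EO (i j : 'I_n) : i != j -> inner (E p i) (E p j) = 0 by exact: E_orth.
have [Q [Q0 sQ fE]] := poly_orthogonal_exists 1 EF.
rewrite mulr1 in fE; set f := polyfun Q in fE.
pose g := polyfun (lin * Q); pose g' := perp (fun i : 'I_n => E p i) g.
have Ff : fock f by exact: polyfun_fock.
have Fg : fock g by exact: polyfun_fock.
have Fg' : fock g' by exact: perp_fock.
have FNg' := fockZ (-1) Fg'.
have g'E (i : 'I_n) : inner g' (E p i) = 0 by exact: perp_orth.
have hI := inner_hform R.
have s0 : 0 < s by exact: lt_le_trans (a_gt0 p) aps.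
have up (h : C -> C) : fock h -> (forall i : 'I_n, inner h (E p i) = 0) ->
    quad (tform W) h <= s * nrm2 h /\ - quad (tform W) h <= s * nrm2 h.
  move=> Fh hE; split.
    apply: (@le_trans _ _ (a p * nrm2 h)); last by rewrite ler_wpM2r ?nrm2_ge0.
    apply: (sp_max spp Fh) => i ip.
    have i_n : (i < n)%N by rewrite -pq (leq_trans ip)// leq_addr.
    by have := hE (Ordinal i_n); rewrite /E /= ip.
  apply: (@le_trans _ _ (b q * nrm2 h)); last by rewrite ler_wpM2r ?nrm2_ge0.
  rewrite /quad -ReN -tformN//; apply: (sp_max spm Fh) => j jq.
  have j_n : (p + j < n)%N by rewrite -pq ltn_add2l.
  by have := hE (Ordinal j_n); rewrite /E /= ltnNge leq_addr /= addKn.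
have [u1 _] : quad (tform W) (fun z => f z + g' z) <= s * nrm2 (fun z => f z + g' z) /\
    - quad (tform W) (fun z => f z + g' z) <= s * nrm2 (fun z => f z + g' z).
  by apply: up; [exact: fockD|move=> i; rewrite (hformD hI Ff Fg' (EF i)) fE g'E addr0].
have [_ u2] : quad (tform W) (fun z => f z + (-1) * g' z) <= s * nrm2 (fun z => f z + (-1) * g' z) /\
    - quad (tform W) (fun z => f z + (-1) * g' z) <= s * nrm2 (fun z => f z + (-1) * g' z).
  apply: up; first exact: fockD.
  by move=> i; rewrite (hformD hI Ff FNg' (EF i)) (hformZ hI _ Fg' (EF i)) fE g'E mulr0 addr0.
have quadD D : hform D -> quad D (fun z => f z + g' z) = quad D f + quad D g' + 2 * complex.Re (D f g').
  move=> hD; rewrite /quad (hformD hD Ff Fg' (fockD Ff Fg')) (hformDr hD Ff Fg' Ff) (hformDr hD Ff Fg' Fg').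
  rewrite (hformC hD Ff Fg') !ReD Re_conj; ring.
have quadB D : hform D -> quad D (fun z => f z + (-1) * g' z) = quad D f + quad D g' - 2 * complex.Re (D f g').
  move=> hD; rewrite /quad (hformD hD Ff FNg' (fockD Ff FNg')) (hformDr hD Ff FNg' Ff) (hformDr hD Ff FNg' FNg').
  rewrite (hformZr _ hD Fg' Ff) (hformZr _ hD Fg' FNg') !(hformZ hD _ Fg')// (hformC hD Ff Fg').
  rewrite rmorphN1 !mulN1r opprK !ReD !ReN Re_conj; ring.
have nI h : fock h -> nrm2 h = quad (@inner R) h by move=> Fh; rewrite (nrm2E (fock_L2 Fh)).
rewrite quadD// (nI _ (fockD Ff Fg')) quadD// -!nI// in u1.
rewrite quadB// (nI _ (fockD Ff FNg')) quadB// -!nI// in u2.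
(* Adding the two minimax inequalities cancels the diagonal terms and leaves 4 Re B(f, g') <= 2 s
   (|f|^2 + |g'|^2). *)
have main : c * eps * nrm2 (cut O f) <= s / 2 * (nrm2 f + nrm2 g').
  apply: (le_trans (coercive Q)); rewrite -/f -/g -(perp_of_eig Ff Fg fE) -/g'.
  nra.
have mD := measSet_disc ap r.
have sDO : disc ap r `<=` O by move=> z /(sep_discp S); left.
set X := nrm2 (cut (disc ap r) f).
have XO : X <= nrm2 (cut O f) by exact: (nrm2_cut_sub mD mO sDO (fock_L2 Ff)).
have h1 : nrm2 f <= expR (K * n.+1%:R) * (n.+1)`!%:R * X by exact: HK.
(* [lin] raises the degree by one, hence (n + 2)!; the extra factor n + 2 goes into the exponential
   constant. *)
have h2 : nrm2 g' <= expR (K * n.+2%:R) * (n.+2)`!%:R * (Cm * X).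
  apply: (le_trans (perp_le EF EN EO Fg)).
  have sg : (size (lin * Q)%R <= n.+2)%N.
    apply: (leq_trans (size_polyMleq _ _)); rewrite -subn1 leq_subLR.
    by apply: (leq_trans (leq_add size_lin sQ)).
  apply: (le_trans (HK _ n.+2 (ltn0Sn _) sg)); rewrite ler_wpM2l ?mulr_ge0 ?expR_ge0//.
  by apply: (lin_cut_le Q mD) => z /sDO/(symbol_sub sW).
have X0 : 0 < X.
  rewrite lt0r nrm2_ge0 andbT; apply: contra Q0 => /eqP X0.
  apply/eqP/polyfun_eq0/(fock_nrm2_eq0 Ff); apply/eqP.
  by rewrite eq_le nrm2_ge0 andbT; move: h1; rewrite X0 mulr0.
have eK : expR (K * n.+2%:R) = expR K * expR (K * n.+1%:R).
  by rewrite -expRD; congr expR; rewrite -[n.+2]add1n natrD; ring.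
have fS : ((n.+2)`!%:R : R) = n.+2%:R * (n.+1)`!%:R by rewrite factS natrM.
have eN : expR (K * n.+1%:R) = expR K ^+ n.+1 by rewrite mulrC expRM_natl.
have key : 2 * (c * eps) <= s * (expR (K * n.+1%:R) * (n.+1)`!%:R * (1 + n.+2%:R * expR K * Cm)).
  rewrite -(ler_pM2r X0).
  have -> : s * (expR (K * n.+1%:R) * (n.+1)`!%:R * (1 + n.+2%:R * expR K * Cm)) * X =
      s * (expR (K * n.+1%:R) * (n.+1)`!%:R * X + expR (K * n.+2%:R) * (n.+2)`!%:R * (Cm * X)).
    by rewrite eK fS; ring.
  have m1 : c * eps * X <= s / 2 * (nrm2 f + nrm2 g').
    by apply: le_trans main; rewrite ler_wpM2l ?mulr_ge0 ?(ltW c0) ?(ltW e0).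
  have m2 : s * (nrm2 f + nrm2 g') <= s * (expR (K * n.+1%:R) * (n.+1)`!%:R * X +
      expR (K * n.+2%:R) * (n.+2)`!%:R * (Cm * X)).
    by rewrite ler_wpM2l ?(ltW s0)// lerD.
  apply: le_trans m2; move: m1; lra.
have fac : 0 <= expR (K * n.+1%:R) * (n.+1)`!%:R by rewrite mulr_ge0 ?expR_ge0.
have le1 : 1 + n.+2%:R * expR K * Cm <= (1 + n.+1%:R) * (1 + expR K * Cm).
  by rewrite nat1r -mulrA [leRHS]mulrDr mulr1 lerD2r ler1n.
have := HL n.+1 (ltn0Sn n); rewrite -eN => hL.
have step : 1 <= expR (K * n.+1%:R) * ((1 + n.+1%:R) * T) * (n.+1)`!%:R * s.
  have -> : expR (K * n.+1%:R) * ((1 + n.+1%:R) * T) * (n.+1)`!%:R * s =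
      (s * (expR (K * n.+1%:R) * (n.+1)`!%:R * ((1 + n.+1%:R) * (1 + expR K * Cm)))) / (2 * (c * eps)).
    by rewrite /T; ring.
  rewrite ler_pdivlMr// mul1r; apply: (le_trans key); rewrite ler_wpM2l ?(ltW s0)//.
  by rewrite ler_wpM2l.
apply: (le_trans step); rewrite ler_wpM2r ?(ltW s0)// ler_wpM2r//.
Qed.

Let rho_gt0 : 0 < rho.
Proof.
have h : disc 0 rho ap.
  apply: (symbol_sub sW); left; apply: (sep_discp S).
  by rewrite /disc/= subrr normc0 (sep_r_gt0 S).
by apply: le_lt_trans h; exact: normc_ge0.
Qed.

Let tail_gt0 n : 0 < tail rho n.
Proof.
rewrite /tail mulr_gt0 ?divr_gt0 ?mulr_gt0 ?exprn_gt0 ?ltr0n ?fact_gt0 ?expR_gt0 ?invr_gt0 ?gauss_mass_gt0//.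
exact: disc_mass_gt0.
Qed.

(* [f] solves the [k.+1] equations [tform W f (ebas j) = 0]; the degree drops to [k] because
   the multiplier [lin] has degree 1. *)
Lemma eigenvalue_upper_bound : exists2 K, 0 < K & forall k p q s, (p + q)%N = k.+2 -> 0 < s ->
  (forall i, (i < p)%N -> s <= a i) -> (forall j, (j < q)%N -> s <= b j) ->
  s * (k.+2)`!%:R <= expR (K * k.+2%:R).
Proof.
(* For this weight the term of [tform_bound] in [lin * Q] is at most half of the coercivity bound
   and can be absorbed, which yields [C1]. *)
pose t := 2 * M * Cm / (c * eps); have t_gt0 : 0 < t by rewrite divr_gt0 ?mulr_gt0.
pose C1 := 2 * M * t / (c * eps); pose C2 := 2 * (1 + C1); pose C3 := 4 * M ^+ 2 * C2.
have C1_ge0 : 0 <= C1.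
  by apply/ltW/divr_gt0; apply: mulr_gt0 => //; exact: mulr_gt0.
have C2_ge0 : 0 <= C2 by apply: mulr_ge0 => //; exact: addr_ge0.
have C3_ge0 : 0 <= C3.
  by apply: mulr_ge0 => //; apply: mulr_ge0 => //; exact: sqr_ge0.
pose kap := expR (rho ^+ 2) / gauss_mass R * mass rho; have kap_ge0 : 0 <= kap := tail_const_ge0 rho.
pose P := 1 + rho ^+ 2; have P_ge1 : 1 <= P by rewrite lerDl sqr_ge0.
have P_ge0 : 0 <= P by exact: le_trans P_ge1.
have [L L0 HL] : exp_bounded (fun N => (C3 * kap ^+ 2) * ((P ^+ 2) ^+ N * (N%:R * (N%:R * N%:R)))).
  have e1 := @exp_bounded_nat R.
  have n0 (N : nat) : 0 <= N%:R :> R by [].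
  have n2 (N : nat) : 0 <= N%:R * N%:R :> R by rewrite mulr_ge0.
  have n3 (N : nat) : 0 <= N%:R * (N%:R * N%:R) :> R by rewrite mulr_ge0.
  have P2 N : 0 <= (P ^+ 2) ^+ N by rewrite exprn_ge0// sqr_ge0.
  apply: exp_boundedM => [N|N||]; [|by rewrite mulr_ge0|exact: exp_bounded_cst|].
    by rewrite mulr_ge0// sqr_ge0.
  apply: exp_boundedM => //; first by apply: exp_bounded_pow; exact: sqr_ge0.
  by apply: exp_boundedM => //; apply: exp_boundedM.
exists (L / 2); first by rewrite divr_gt0.
move=> k p q s pq s0 sa sb.
pose EE (i : 'I_k.+2) := E p i.
have EF i : fock (EE i) by exact: E_fock.
have EN i : nrm2 (EE i) = 1 by exact: E_nrm2.
have EO i j : i != j -> inner (EE i) (EE j) = 0 by exact: E_orth.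
have s_nu (i : 'I_k.+2) : s <= `|nu p i|.
  rewrite /nu; case: ltnP => ip; first by rewrite ger0_norm ?(ltW (a_gt0 _))//; exact: sa.
  by rewrite normrN ger0_norm ?(ltW (b_gt0 _))//; apply: sb; rewrite ltn_subLR// pq.
have [d [i0 di0] hd] := homogeneous_solution (fun (j : 'I_k.+1) (i : 'I_k.+2) => tform W (EE i) (ebas j)).
pose f z := \sum_i d i * EE i z.
have Ff : fock f by exact: fock_lincomb.
have Lf := fock_L2 Ff.
have nf : nrm2 f = \sum_i normc (d i) ^+ 2 by exact: orthonormal_nrm2.
have nf0 : 0 < nrm2 f.
  rewrite nf (bigD1 i0)//= ltr_pwDl ?sumr_ge0//; last by move=> i _; exact: sqr_ge0.
  by rewrite lt0r sqr_ge0 andbT sqrf_eq0; apply: contra di0 => /eqP/eq0_normc ->.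
have fe j : (j < k.+1)%N -> tform W f (ebas j) = 0.
  by move=> jk; rewrite (hform_suml _ _ hB EF (ebas_fock R j)); exact: (hd (Ordinal jk)).
have [Q sQ pQ] := esum_polyfun (coef f) k.
have Fp' : fock (polyfun Q) by exact: polyfun_fock.
have Fmp : fock (polyfun (lin * Q)) by exact: polyfun_fock.
have fmp : tform W f (polyfun (lin * Q)) = 0.
  have sm : (size (lin * Q)%R <= k.+1)%N.
    apply: (leq_trans (size_polyMleq _ _)); rewrite -subn1 leq_subLR.
    by apply: (leq_trans (leq_add size_lin sQ)).
  rewrite (hformC hB Fmp Ff) (polyfunE sm).
  rewrite (hform_suml _ _ hB (fun j : 'I_k.+1 => mon_fock R j) Ff) big1 ?rmorph0// => j _.
  have := fe j (ltn_ord j); rewrite /ebas (hformZr _ hB (mon_fock R j) Ff).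
  move=> /eqP; rewrite mulf_eq0 conj_real => /orP[/eqP[]/eqP|/eqP h].
    by rewrite (gt_eqF (enorm_gt0 R j)).
  by rewrite (hformC hB Ff (mon_fock R j)) h rmorph0 mulr0.
pose r' z := f z + (-1) * polyfun Q z.
have FNp := fockZ (-1) Fp'.
have Fr : fock r' by exact: fockD.
have rE : r' = (fun z => f z - esum_ (coef f) k z).
  by apply/funext => z; rewrite /r' mulN1r pQ.
have nr : nrm2 r' <= nrm2 f.
  by rewrite rE nrm2_sub_esum// gerBl sumr_ge0// => i _; exact: sqr_ge0.
have cr j : (j < k)%N -> coef r' j = 0.
  by move=> jk; rewrite rE coefB ?coef_esum ?jk ?subrr//; exact: esum_L2.
have mD := measSet_disc (0 : C) rho.
have rO : nrm2 (cut O r') <= nrm2 f * tail rho k.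
  apply: (le_trans (nrm2_cut_sub mO mD (symbol_sub sW) (fock_L2 Fr))).
  apply: (le_trans (nrm2_cut_tail (symbol_rho_ge0 sW) Fr cr)).
  by rewrite ler_wpM2r// ltW.
have fpr : f = (fun z => polyfun Q z + r' z) by apply/funext => z; rewrite /r'; ring.
have Lr := fock_L2 Fr; have Lp := fock_L2 Fp'; have Lmp := fock_L2 Fmp.
have ce0 : 0 < c * eps by rewrite mulr_gt0.
have pO : nrm2 (cut O (polyfun Q)) <= C1 * nrm2 (cut O r').
  have h1 := coercive Q.
  have h2 : tform W (polyfun Q) (polyfun (lin * Q)) = - tform W r' (polyfun (lin * Q)).
    by apply/eqP; rewrite -addr_eq0 -(hformD hB Fp' Fr Fmp) -fpr fmp.
  have h3 : complex.Re (tform W (polyfun Q) (polyfun (lin * Q))) <=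
      M * (t * nrm2 (cut O r') + nrm2 (cut O (polyfun (lin * Q))) / t).
    rewrite h2 ReN; apply: (le_trans (ler_norm _)); rewrite normrN.
    by apply: (le_trans (Re_le_normc _)); exact: (tform_bound sW Lr Lmp t_gt0).
  have h4 := lin_cut_le Q mO (symbol_sub sW).
  have h5 : M * (nrm2 (cut O (polyfun (lin * Q))) / t) <= c * eps / 2 * nrm2 (cut O (polyfun Q)).
    have -> : c * eps / 2 * nrm2 (cut O (polyfun Q)) = M * (Cm * nrm2 (cut O (polyfun Q)) / t).
      by rewrite /t; field; rewrite (gt_eqF M0) (gt_eqF Cm_gt0) (gt_eqF c0) (gt_eqF e0).
    by rewrite ler_wpM2l ?(ltW M0)// ler_wpM2r// invr_ge0 ltW.
  have h6 : c * eps / 2 * nrm2 (cut O (polyfun Q)) <= M * (t * nrm2 (cut O r')).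
    by move: (le_trans h1 h3) h5; rewrite mulrDr; lra.
  rewrite -(ler_pM2l (divr_gt0 ce0 (ltr0Sn R 1))); apply: (le_trans h6).
  by rewrite le_eqVlt; apply/orP; left; apply/eqP; rewrite /C1; field; rewrite (gt_eqF c0) (gt_eqF e0).
have fO : nrm2 (cut O f) <= C2 * (nrm2 f * tail rho k).
  rewrite {1}fpr; apply: (le_trans (nrm2_cutD_le mO Lp Lr)).
  apply: (@le_trans _ _ (C2 * nrm2 (cut O r'))); last by rewrite ler_wpM2l.
  by move: pO; rewrite /C2; lra.
pose g := toeplitz W f; have [Fg gk] := toeplitzP sW Ff; rewrite -/g in Fg gk.
have Lg := fock_L2 Fg.
(* The coefficients of T f are the numbers [tform W f (ebas j)], zero for j < k + 1: the tail is one
   order better than that of [r']. *)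
have gO : nrm2 (cut O g) <= nrm2 g * tail rho k.+1.
  apply: (le_trans (nrm2_cut_sub mO mD (symbol_sub sW) Lg)).
  apply: (nrm2_cut_tail (symbol_rho_ge0 sW) Fg) => j jk.
  by rewrite /coef gk ?fe//; exact: ebas_fock.
have gup : nrm2 g <= C3 * tail rho k * tail rho k.+1 * nrm2 f.
  (* With this weight the term in g on the right is at most half of [nrm2 g]. *)
  pose u := 2 * M * tail rho k.+1; have u0 : 0 < u.
    by apply: mulr_gt0 => //; exact: mulr_gt0.
  have h1 : nrm2 g <= M * (u * nrm2 (cut O f) + nrm2 (cut O g) / u).
    rewrite (nrm2E Lg) gk//; apply: (le_trans (ler_norm _)); apply: (le_trans (Re_le_normc _)).
    exact: (tform_bound sW Lf Lg u0).
  have h2 : M * (nrm2 (cut O g) / u) <= nrm2 g / 2.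
    have -> : nrm2 g / 2 = M * (nrm2 g * tail rho k.+1 / u).
      by rewrite /u; field; rewrite (gt_eqF M0) (gt_eqF (tail_gt0 _)).
    by rewrite ler_wpM2l ?(ltW M0)// ler_wpM2r// invr_ge0 ltW.
  have h3 : M * (u * nrm2 (cut O f)) <= M * (u * (C2 * (nrm2 f * tail rho k))).
    by rewrite ler_wpM2l ?(ltW M0)// ler_wpM2l// ltW.
  have h4 : nrm2 g <= 2 * (M * (u * (C2 * (nrm2 f * tail rho k)))).
    by move: h1 h2 h3; rewrite mulrDr; lra.
  by apply: (le_trans h4); rewrite /u /C3 le_eqVlt; apply/orP; left; apply/eqP; ring.
(* Bessel's inequality in the eigenfunctions: the i-th coordinate of T f is nu_i d_i, of modulus at
   least s |d_i|. *)
have glow : s ^+ 2 * nrm2 f <= nrm2 g.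
  apply: le_trans (bessel_family EF EN EO Fg); rewrite nf mulr_sumr; apply: ler_sum => i _.
  have conjZ (x : R) (y : C) : (x%:C * y)^* = x%:C * y^* by rewrite rmorphM/= conj_real.
  rewrite gk// (hformC hB (EF i) Ff) E_eig// conjZ.
  rewrite -(hformC (inner_hform R) (EF i) Ff) (orthonormal_coord EF EN EO).
  rewrite normcM normc_real exprMn ler_wpM2r ?sqr_ge0//.
  by apply: lerXn2r; rewrite ?nnegrE// ltW.
have s2 : s ^+ 2 <= C3 * tail rho k * tail rho k.+1.
  by rewrite -(ler_pM2r nf0); exact: (le_trans glow gup).
have fk : ((k`!)%:R : R) != 0 by rewrite pnatr_eq0 -lt0n fact_gt0.
have kS : (k.+1%:R : R) != 0 by rewrite pnatr_eq0.
have P_ge : rho ^+ 2 <= P by rewrite lerDr.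
(* The tails carry 1 / (k! (k+1)!), which cancels (k+2)!^2 up to (k+1) (k+2)^2. The estimate is for
   the square, hence the exponent L / 2 at the end. *)
have key : (s * (k.+2)`!%:R) ^+ 2 <= expR (L * k.+2%:R).
  apply: le_trans (HL k.+2 (ltn0Sn _)); rewrite exprMn.
  apply: (@le_trans _ _ (C3 * tail rho k * tail rho k.+1 * (k.+2)`!%:R ^+ 2)).
    by rewrite ler_wpM2r ?sqr_ge0.
  have -> : C3 * tail rho k * tail rho k.+1 * (k.+2)`!%:R ^+ 2 =
     C3 * kap ^+ 2 * (((rho ^+ 2) ^+ k * (rho ^+ 2) ^+ k.+1) * (k.+1%:R * (k.+2%:R * k.+2%:R))).
    rewrite /tail -/kap !factS !natrM; move: fk kS.
    move: (k.+1%:R) (k.+2%:R) (k`!%:R) => x y z z0 x0.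
    by field; rewrite z0 x0.
  apply: ler_wpM2l; first by rewrite mulr_ge0// sqr_ge0.
  apply: ler_pM.
  - by apply: mulr_ge0; apply: exprn_ge0; exact: sqr_ge0.
  - by rewrite !mulr_ge0.
  - rewrite -[leRHS]exprM mul2n -addnn exprD.
    have rm m : 0 <= (rho ^+ 2) ^+ m by apply: exprn_ge0; exact: sqr_ge0.
    apply: ler_pM => //.
      apply: (@le_trans _ _ (P ^+ k)); first by apply: lerXn2r; rewrite ?nnegrE ?sqr_ge0.
      by rewrite ler_weXn2l// leqW.
    apply: (@le_trans _ _ (P ^+ k.+1)); first by apply: lerXn2r; rewrite ?nnegrE ?sqr_ge0.
    by rewrite ler_weXn2l.
  - by rewrite ler_wpM2r ?mulr_ge0// ler_nat.
have -> : expR (L / 2 * k.+2%:R) = Num.sqrt (expR (L * k.+2%:R)).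
  have -> : expR (L * k.+2%:R) = expR (L / 2 * k.+2%:R) ^+ 2.
    by rewrite -expRM_natl; congr expR; field.
  by rewrite sqrtr_sqr ger0_norm ?expR_ge0.
rewrite -[leLHS]ger0_norm ?mulr_ge0 ?(ltW s0)// -sqrtr_sqr.
by rewrite ler_wsqrtr.
Qed.

End separated_symbols.

(** * From eigenvalue bounds to the asymptotics of a separated Borel symbol *)

Section separated_asymptotics.
Variable R : realType.
Notation C := R[i].

(** Here n! <= n^n, and in the next lemma n^n <= n! e^n: together they are Stirling's formula up to
    an error O(n). *)
Lemma ln_fact_le n : ln (n`!%:R : R) <= nlogn R n.
Proof.
have [->|n0] := posnP n; first by rewrite fact0 ln1 /nlogn mul0r.
rewrite /nlogn mulr_natl -lnXn ?ltr0n// ler_ln ?posrE ?ltr0n ?fact_gt0 ?exprn_gt0 ?ltr0n//.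
rewrite -natrX ler_nat; elim: n {n0} => // n IH.
by rewrite factS expnS leq_mul2l/= (leq_trans IH)//; case: (n) => // m; rewrite leq_exp2r.
Qed.

Lemma ln_fact_ge n : nlogn R n - n%:R <= ln (n`!%:R : R).
Proof.
have [->|n0] := posnP n; first by rewrite fact0 ln1 /nlogn mul0r subr0.
have h := @exp_bound_pow R n%:R n (ler0n R n).
rewrite lerBlDr -[X in _ + X](expRK n%:R) -lnM ?posrE ?ltr0n ?fact_gt0 ?expR_gt0//.
by rewrite /nlogn mulr_natl -lnXn ?ltr0n// ler_ln ?posrE ?exprn_gt0 ?ltr0n// ?mulr_gt0 ?expR_gt0 ?ltr0n ?fact_gt0.
Qed.

Variables (W : C -> R) (M : R) (Op Om : set C) (rho c : R) (al be : C) (eps : R) (ap am : C) (r : R).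
Hypothesis S : separated W M Op Om rho c al be eps ap am r.

(** The bound excludes a zero term, so each sign has infinitely many eigenvalues. Taking logarithms,
    the factorial of (k + 1) N instead of N only enlarges the constant. *)
Lemma spectrum_gt0 (V : C -> R) Op' Om' al' be' ap' am' a F :
  separated V M Op' Om' rho c al' be' eps ap' am' r -> spectrum (tform V) a F ->
  (forall n, 0 < a n) /\ exists2 K : R, 0 < K & \forall i \near \oo, - (K * nlogn R i.+1) <= ln (a i).
Proof.
move=> S' sp; have [k [K K0 HK]] := positive_eigenvalue_bound S' sp.
have fp m : (0 : R) < (m`!)%:R by rewrite ltr0n fact_gt0.
have a0 n : 0 < a n.
  rewrite lt0r (sp_ge0 sp) andbT; apply/negP => /eqP an.
  by have := HK n; rewrite an mulr0 ler10.
split=> //; pose C0 := K + k.+1%:R * (1 + ln (k.+1%:R)).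
have lk : 0 <= ln (k.+1%:R : R) by rewrite ln_ge0// ler1n.
exists C0; first by rewrite ltr_pwDl// mulr_ge0// addr_ge0.
apply: filterS (ln_nat_large (1 : R)) => n l1; set N := n.+1 in l1 *.
have N0 : (0 : R) < N%:R by rewrite ltr0n.
have h : 0 <= K * N%:R + ln ((k.+1 * N)`!%:R : R) + ln (a n).
  rewrite -[K * _]expRK -!lnM ?posrE ?mulr_gt0 ?expR_gt0//.
  by apply: ln_ge0; exact: HK.
have h2 := ln_fact_le (k.+1 * N).
have h3 : nlogn R (k.+1 * N) = k.+1%:R * N%:R * (ln k.+1%:R + ln N%:R).
  by rewrite /nlogn natrM lnM ?posrE ?ltr0n.
have h4 : K * N%:R <= K * nlogn R N.
  by rewrite ler_wpM2l ?(ltW K0)// /nlogn ler_peMr// ltW.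
have h5 : nlogn R (k.+1 * N) <= k.+1%:R * (1 + ln k.+1%:R) * nlogn R N.
  rewrite h3 /nlogn -!mulrA ler_wpM2l// mulrCA ler_wpM2l ?(ltW N0)//.
  rewrite mulrDl mul1r addrC lerD2l ler_peMr//.
by rewrite /C0 mulrDl; lra.
Qed.

Lemma separated_asymptotics :
  eq_exp_nlogn (singular_value W) /\
  exists delta_p Delta_p delta_m Delta_m : R,
    [/\ [/\ 0 < delta_p, delta_p <= Delta_p & Delta_p < 1],
        [/\ 0 < delta_m, delta_m <= Delta_m & Delta_m < 1],
        delta_p + Delta_m = 1 /\ delta_m + Delta_p = 1,
        exp_nlogn_le delta_p (lambda_plus W) /\
        le_exp_nlogn Delta_p (lambda_plus W) &
        exp_nlogn_le delta_m (lambda_minus W) /\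
        le_exp_nlogn Delta_m (lambda_minus W)].
Proof.
have sW := sep_symbol S; have SN := separatedN S; have sWN := symbolN sW.
have [a [Fp spp]] := spectrum_exists (tform_hform sW) (tform_weakly_continuous sW) (tform_bounded sW).
have [b [Fm spm]] := spectrum_exists (tform_hform sWN) (tform_weakly_continuous sWN) (tform_bounded sWN).
have aE := lambda_plusE sW spp; have bE : lambda_minus W = b := lambda_plusE sWN spm.
have [a0 [Ka Ka0 aC]] := spectrum_gt0 S spp.
have [b0 [Kb Kb0 bC]] := spectrum_gt0 SN spm.
have small (V : C -> R) l F : spectrum (tform V) l F -> forall e, 0 < e -> exists n, l n < e.
  move=> sp e e0; have [n hn] := sp_cvg sp (divr_gt0 e0 (ltr0Sn R 1)).
  by exists n; apply: (le_lt_trans hn); lra.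
have asm := small _ _ _ spp; have bsm := small _ _ _ spm.
have nia := sp_noninc spp; have nib := sp_noninc spm.
pose s := merge_seq a b.
have sE : singular_value W = s.
  rewrite /singular_value aE bE; apply: xget_unique.
    exact: (merge_rearranges nia nib a0 b0 asm bsm).
  move=> s' hs'; apply/esym; apply: (rearranges_union_unique _ _ hs').
    by move=> mu; apply: merge_seq_finite.
  exact: (merge_rearranges nia nib a0 b0 asm bsm).
pose I n := (merge_pos a b n).1; pose J n := (merge_pos a b n).2.
have IJ n : (I n + J n)%N = n := merge_pos_add a b n.
have s0 n : 0 < s n by exact: merge_seq_gt0.
have sord : ordered_like s.
  have [K1 K10 H1] := eigenvalue_lower_bound S spp spm a0 b0.
  have [K2 K20 H2] := eigenvalue_upper_bound S spp spm a0 b0.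
  (* The summand 1 pays for the gap between ln N! and N ln N. Index 0 is left out because the upper
     bound concerns at least two eigenvalues. *)
  exists (K1 + K2 + 1); first by rewrite !addr_gt0.
  exists 1%N => // -[//|k] _; set n := k.+1; set N := n.+1.
  have N0 : (0 : R) < N%:R by rewrite ltr0n.
  have f0 : (0 : R) < (N`!)%:R by rewrite ltr0n fact_gt0.
  have lo : 0 <= K1 * N%:R + ln (N`!%:R : R) + ln (s n).
    rewrite -[K1 * _]expRK -!lnM ?posrE ?mulr_gt0 ?expR_gt0//; apply: ln_ge0.
    by apply: (H1 n (I n) (J n) (s n) (IJ n)); rewrite /s /merge_seq le_max lexx ?orbT.
  have up : ln (s n) + ln (N`!%:R : R) <= K2 * N%:R.
    rewrite -[leRHS]expRK -lnM ?posrE// ler_ln ?posrE ?mulr_gt0 ?expR_gt0//.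
    (* After step n the merge has taken n + 1 = k + 2 terms, all at least [s n]; the upper bound is
       applied to exactly these. *)
    have [sa sb] := merge_seq_le nia nib n.
    apply: (H2 k (I n.+1) (J n.+1) (s n) (IJ n.+1) (s0 n)) => i.
      have [[_ [[E _] E2]]|[_ [[E _] E2]]] := merge_posS a b n; rewrite /I E.
        by rewrite ltnS leq_eqVlt => /predU1P[->|]; [rewrite /s E2|exact: sa].
      exact: sa.
    have [[_ [[_ E] E2]]|[_ [[_ E] E2]]] := merge_posS a b n; rewrite /J E; first exact: sb.
    by rewrite ltnS leq_eqVlt => /predU1P[->|]; [rewrite /s E2|exact: sb].
  have f1 := ln_fact_le N; have f2 := ln_fact_ge N.
  have k1 := mulr_gt0 K10 N0; have k2 := mulr_gt0 K20 N0.
  by rewrite ler_norml !mulrDl mul1r; apply/andP; split; lra.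
have /choice[NI HNI] := merge_hit_l nia nib a0 bsm.
have /choice[NJ HNJ] := merge_hit_r nia nib b0 asm.
have leI m : (I m <= m)%N by rewrite -{2}(IJ m) leq_addr.
have leJ m : (J m <= m)%N by rewrite -{2}(IJ m) leq_addl.
have gI : exists2 d : R, 0 < d & \forall n \near \oo, d * n.+1%:R <= (I n).+1%:R.
  apply: (@linear_growth R s a I NI sord _ _ leI Ka Ka0 aC).
    by move=> m n mn; have [] := merge_pos_mono a b mn.
  by move=> i; have [] := HNI i.
have gJ : exists2 d : R, 0 < d & \forall n \near \oo, d * n.+1%:R <= (J n).+1%:R.
  apply: (@linear_growth R s b J NJ sord _ _ leJ Kb Kb0 bC).
    by move=> m n mn; have [] := merge_pos_mono a b mn.
  by move=> i; have [] := HNJ i.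
have [dp [dm [dp0 dm0 dpm [I1 J1] [I2 J2]]]] := densities IJ gI gJ.
have Dp0 : 0 < 1 - dm by lra.
have Dm0 : 0 < 1 - dp by lra.
have NPI i : [/\ I (NI i) = i, s (NI i) = a i & (i <= NI i)%N].
  by have [h1 h2 h3 h4] := HNI i; split=> //; rewrite -{1}h1 leI.
have NPJ i : [/\ J (NJ i) = i, s (NJ i) = b i & (i <= NJ i)%N].
  by have [h1 h2 h3 h4] := HNJ i; split=> //; rewrite -{1}h1 leJ.
split; first by rewrite sE; exact: ordered_like_eq.
exists dp, (1 - dm), dm, (1 - dp); rewrite aE bE; split.
- by split=> //; lra.
- by split=> //; lra.
- by split; ring.
- split; first exact: (pullback_ge sord a0 NPI dp0 I1).
  exact: (pullback_le sord a0 NPI Dp0 I2).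
- split; first exact: (pullback_ge sord b0 NPJ dm0 J1).
  exact: (pullback_le sord b0 NPJ Dm0 J2).
Qed.

End separated_asymptotics.

(** * Reduction of the theorem to separated Borel symbols *)

Section integral_ae.
Context d (T : measurableType d) (R : realType) (mu : {measure set T -> \bar R}).
Import HBNNSimple.
Local Open Scope ereal_scope.

(** A simple function below u, set to 0 on the exceptional null set, lies below v and keeps its
    integral. *)
Let ge0_le (u v : T -> \bar R) : (forall x, 0 <= u x) -> (forall x, 0 <= v x) ->
  {ae mu, forall x, u x = v x} -> \int[mu]_x u x <= \int[mu]_x v x.
Proof.
move=> u0 v0 [N [mN N0 uvN]].
rewrite ge0_integralTE// ge0_integralTE//; apply: ge_ereal_sup => _ [h hu <-].
have mNc := measurableC mN; pose h' := proj_nnsfun h mNc.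
apply: (@le_trans _ _ (sintegral mu h')); last first.
  apply: ereal_sup_ubound; exists h' => //= x.
  rewrite mindicE; case: (boolP (x \in ~` N)) => [|_]; last by rewrite mulr0.
  rewrite inE => xN; rewrite mulr1; have -> : v x = u x; last exact: hu.
  by apply: esym; apply: contrapT => uv; exact: (xN (uvN _ uv)).
rewrite -!integralT_nnsfun le_eqVlt; apply/orP; left; apply/eqP.
apply: ge0_ae_eq_integral => //.
- by apply/measurable_EFinP.
- by apply/measurable_EFinP.
- by move=> x _; rewrite lee_fin.
- by move=> x _; rewrite lee_fin.
exists N; split=> // x /= hx; apply: contrapT => xN; apply: hx => _.
by rewrite mindicE mem_set ?mulr1.
Qed.

(* Unlike in [ae_eq_integral], [u] and [v] need not be measurable: the integral of a
   nonnegative function is defined as a supremum over simple functions below it. *)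
Lemma integral_ae_congr (u v : T -> \bar R) :
  {ae mu, forall x, u x = v x} -> \int[mu]_x u x = \int[mu]_x v x.
Proof.
move=> uv; have vu : {ae mu, forall x, v x = u x} by apply: filterS uv.
have eqn (s t : T -> \bar R) : (forall x, 0 <= s x) -> (forall x, 0 <= t x) ->
    {ae mu, forall x, s x = t x} -> \int[mu]_x s x = \int[mu]_x t x.
  move=> s0 t0 st; apply/eqP; rewrite eq_le !ge0_le//.
  by apply: filterS st.
rewrite integralE [RHS]integralE; congr (_ - _); apply: eqn.
- by move=> x; exact: funepos_ge0.
- by move=> x; exact: funepos_ge0.
- by apply: filterS uv => x E; rewrite !funeposE E.
- by move=> x; exact: funeneg_ge0.
- by move=> x; exact: funeneg_ge0.
- by apply: filterS uv => x E; rewrite !funenegE E.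
Qed.

End integral_ae.

(** * Separation of compact sets with disjoint closed convex hulls *)

Section plane_topology.
Variable R : realType.
Notation C := R[i].
Implicit Types (A : set C) (x y z : C).

Lemma nbhs_disc A x : nbhs (x : R[i]^o) (A : set R[i]^o) <-> exists2 r : R, 0 < r & disc x r `<=` A.
Proof.
split=> [/nbhs_ballP[e /= e0 He]|[r r0 Hr]]; last first.
  apply/nbhs_ballP; exists (r%:C : R[i]^o); first by rewrite /= ltcR.
  by move=> z; rewrite /ball/= distrC normrE_normc ltcR => /Hr.
have eE : e = (complex.Re e)%:C by move: e0; case: (e) => a b; rewrite ltcE/= => /andP[/eqP-> _].
exists (complex.Re e); first by move: e0; rewrite eE ltcR.
by move=> z hz; apply: He; rewrite /ball/= distrC normrE_normc eE ltcR.
Qed.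

Lemma closed_openC A : @closed R[i]^o A -> openC (~` A).
Proof.
move=> cA z zA; have : nbhs (z : R[i]^o) (~` A : set R[i]^o).
  by apply: open_nbhs_nbhs; split=> //; exact: topology_structure.closed_openC.
move=> /nbhs_disc[r r0 Hr]; exists (r / 2); first by rewrite divr_gt0.
move=> h hr; apply: Hr; rewrite /disc/= addrC addKr.
by apply: (le_lt_trans hr); rewrite ltr_pdivrMr// ltr_pMr// ltr1n.
Qed.

Lemma openC_closed A : openC (~` A) -> @closed R[i]^o A.
Proof.
move=> oA z cz; apply: contrapT => zA; have [d d0 Hd] := oA z zA.
have nb : nbhs (z : R[i]^o) (disc z d : set R[i]^o) by apply/nbhs_disc; exists d.
have [y [Ay yz]] := cz _ nb.
by apply: (Hd (y - z) (ltW yz)); rewrite addrC subrK.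
Qed.

Lemma closed_measSet A : @closed R[i]^o A -> measSet A.
Proof.
move=> /closed_openC/openC_measurable h; rewrite /measSet.
by rewrite -[X in measurable X]setCK; exact: measurableC.
Qed.

Lemma compact_in_disc A : @compact R[i]^o A -> exists2 r : R, 0 < r & A `<=` disc 0 r.
Proof.
move=> cA; apply: contrapT => H.
have : forall n : nat, exists z, A z /\ n.+1%:R <= normc z.
  move=> n; apply: contrapT => /forallNP Hn; apply: H; exists n.+1%:R => //.
  move=> z Az; rewrite /disc/= subr0 ltNge; apply/negP => h; exact: (Hn z).
move=> /choice[u Hu].
have FA : (u @ \oo) (A : set R[i]^o) by exists 0%N => // n _; have [] := Hu n.
have [p [_ cp]] := cA (u @ \oo) _ FA.
have nb : nbhs (p : R[i]^o) (disc p 1 : set R[i]^o) by apply/nbhs_disc; exists 1.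
pose B : set R[i]^o := [set z | normc p + 1 <= normc z].
have FB : (u @ \oo) B.
  exists (Num.bound (normc p + 1)) => // n /= hn; have [_] := Hu n; apply: le_trans.
  apply/ltW; apply: lt_le_trans (archi_boundP _) _; first by rewrite addr_ge0 ?normc_ge0.
  by rewrite ler_nat leqW.
have [z [Bz Dz]] := cp B _ FB nb.
have : normc z < normc p + 1.
  rewrite -[z](subrK p) addrC; apply: (le_lt_trans (le_normcD _ _)); rewrite ltrD2l//.
by rewrite ltNge Bz.
Qed.

Definition convexC A := forall x y (t : R), A x -> A y -> 0 <= t -> t <= 1 ->
  A (t%:C * x + (1 - t)%:C * y).

Lemma convex_setP A : @convex_set R (Rcomplex R) A <-> convexC A.
Proof.
have convE (x y : C) (k : {i01 R}) : @conv R (convex_lmodType (Rcomplex R)) k x y =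
    (k%:num)%:C * x + (1 - k%:num)%:C * y.
  case: x => a b; case: y => a' b'; apply: complex_eq; rewrite /conv/= /unstable.onem; ring.
split=> [cA x y t Ax Ay t0 t1|cA x y k].
  have := cA x y (Itv01 t0 t1); rewrite convE /= => h.
  by apply/set_mem/h; exact/mem_set.
by rewrite convE !inE => Ax Ay; exact: cA.
Qed.

Lemma hull_sub A : A `<=` closed_convex_hull A.
Proof. exact: sub_smallest. Qed.

Lemma hull_convexC A : convexC (closed_convex_hull A).
Proof.
move=> x y t hx hy t0 t1 B hB; have [[_ /convex_setP cB] _] := hB.
exact: (cB x y t (hx B hB) (hy B hB) t0 t1).
Qed.

Lemma hull_closed A : @closed R[i]^o (closed_convex_hull A).
Proof. by apply: closed_bigI => B [[]]. Qed.

Lemma hull_in_disc A (r : R) : A `<=` disc 0 r -> closed_convex_hull A `<=` [set z | normc z <= r].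
Proof.
move=> Ar; apply: smallest_sub; last by move=> z /Ar; rewrite /disc/= subr0 => /ltW.
split.
  apply: openC_closed => z /= /negP; rewrite -ltNge => zr.
  exists ((normc z - r) / 2); first by rewrite divr_gt0// subr_gt0.
  move=> h hh; apply/negP; rewrite -ltNge.
  have : normc z <= normc (z + h) + normc h.
    by rewrite -{1}[z](addrK h) ; exact: le_normcB.
  lra.
apply/convex_setP => x y t /= hx hy t0 t1; apply: (le_trans (le_normcD _ _)).
rewrite !normcM !normc_real !ger0_norm ?subr_ge0//.
have := ler_wpM2l t0 hx; have h1 : 0 <= 1 - t by rewrite subr_ge0.
have := ler_wpM2l h1 hy; lra.
Qed.

(** Bounded minimising sequences converge along an ultrafilter, and closedness keeps the limits in
    [A] and [B]. *)
Lemma closed_min_distance A B (r : R) : @closed R[i]^o A -> @closed R[i]^o B ->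
  A !=set0 -> B !=set0 -> (forall z, A z -> normc z <= r) -> (forall z, B z -> normc z <= r) ->
  exists x y, [/\ A x, B y & forall x' y', A x' -> B y' -> normc (x - y) <= normc (x' - y')].
Proof.
move=> cA cB [x0 Ax0] [y0 By0] Ar Br.
pose E := [set t | exists x y, [/\ A x, B y & t = normc (x - y)]].
have E0 t : E t -> 0 <= t by move=> [x [y [_ _ ->]]]; exact: normc_ge0.
have hE : has_inf E.
  by split; [exists (normc (x0 - y0)), x0, y0|exists 0 => t /E0].
have : forall k : nat, exists p : C * C, [/\ A p.1, B p.2 & normc (p.1 - p.2) < inf E + k.+1%:R^-1].
  move=> k; have k0 : (0 : R) < k.+1%:R^-1 by rewrite invr_gt0.
  by have [_ [x [y [Ax By ->]]] h] := inf_adherent k0 hE; exists (x, y).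
move=> /choice[u Hu].
have [G [UG sG]] := ultraFilterLemma (@eventually_filter : ProperFilter \oo).
have PG : ProperFilter G by exact: ultra_proper.
have limit (v : nat -> C) : (forall k, normc (v k) <= r) ->
    exists p : C, forall e, 0 < e -> \forall k \near G, normc (v k - p) <= e.
  move=> vr.
  have [p hp] := ultra_cvg UG (fun k => le_trans (Re_le_normc (v k)) (vr k)).
  have [q hq] := ultra_cvg UG (fun k => le_trans (Im_le_normc (v k)) (vr k)).
  exists (p +i* q) => e e0; have e20 : 0 < e / 2 by rewrite divr_gt0.
  apply: filterS2 (hp _ e20) (hq _ e20) => k h1 h2.
  by apply: le_trans (normc_le_ReIm _) _; rewrite [e]splitr !ReImE /= lerD.
have in_closed D (v : nat -> C) p : @closed R[i]^o D -> (forall k, D (v k)) ->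
    (forall e, 0 < e -> \forall k \near G, normc (v k - p) <= e) -> D p.
  move=> cD Dv vp; apply: cD => U /nbhs_disc[d d0 Hd].
  have d20 : 0 < d / 2 by rewrite divr_gt0.
  have [k hk] := @filter_ex _ G _ _ (vp _ d20).
  exists (v k); split; first exact: Dv.
  by apply: Hd; apply: (le_lt_trans hk); rewrite ltr_pdivrMr// ltr_pMr// ltr1n.
have [x hx] := limit (fun k => (u k).1) (fun k => let: And3 h _ _ := Hu k in Ar _ h).
have [y hy] := limit (fun k => (u k).2) (fun k => let: And3 _ h _ := Hu k in Br _ h).
exists x, y; split.
- by apply: (in_closed A (fun k => (u k).1)) => // k; have [] := Hu k.
- by apply: (in_closed B (fun k => (u k).2)) => // k; have [] := Hu k.
move=> x' y' Ax' By'; apply: (@le_trans _ _ (inf E)); last first.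
  by apply: ge_inf; [case: hE|exists x', y'].
apply/ler_addgt0Pl => e e0; have e30 : 0 < e / 3 by rewrite divr_gt0.
have large : \forall k \near \oo, k.+1%:R^-1 <= e / 3.
  exists (Num.bound (e / 3)^-1) => // k /= hk.
  rewrite -[leRHS]invrK lef_pV2 ?posrE ?invr_gt0//; apply: ltW.
  apply: lt_le_trans (archi_boundP _) _; first by rewrite invr_ge0 ltW.
  by rewrite ler_nat leqW.
have [k [[h1 h2] h3]] := @filter_ex _ G _ _ (filterI (filterI (hx _ e30) (hy _ e30)) (sG _ large)).
have [_ _ h4] := Hu k.
have -> : x - y = ((u k).1 - (u k).2) - (((u k).1 - x) - ((u k).2 - y)) by ring.
apply: (le_trans (le_normcB _ _)).
have := le_normcB ((u k).1 - x) ((u k).2 - y).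
move: h1 h2 h3 h4 => /=; set t := k.+1%:R^-1; lra.
Qed.

Lemma nearest_point_angle x y z : (forall t : R, 0 <= t -> t <= 1 ->
    normc (x - y) <= normc (t%:C * z + (1 - t)%:C * x - y)) ->
  0 <= complex.Re ((x - y)^* * (z - x)).
Proof.
move=> H; set w := x - y; rewrite leNgt; apply/negP => neg.
set a := complex.Re _ in neg; pose b := normc (z - x) ^+ 2.
have b0 : 0 <= b by exact: sqr_ge0.
(* Small enough for the linear gain 2 t a, with a < 0, to outweigh t^2 b: moving from x towards z by
   t would come closer to y. *)
pose t := Num.min 1 (- a / (b + 1)).
have b1 : 0 < b + 1 by rewrite ltr_wpDl.
have t0 : 0 < t by rewrite lt_min ltr01 divr_gt0// oppr_gt0.
have t1 : t <= 1 by rewrite ge_min lexx.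
have h := H t (ltW t0) t1.
have E : t%:C * z + (1 - t)%:C * x - y = w + t%:C * (z - x).
  by rewrite /w rmorphB rmorph1; ring.
have h2 : normc w ^+ 2 <= normc (w + t%:C * (z - x)) ^+ 2.
  by rewrite -E; apply: lerXn2r; rewrite ?nnegrE ?normc_ge0.
have expand : normc (w + t%:C * (z - x)) ^+ 2 = normc w ^+ 2 + 2 * t * a + t ^+ 2 * b.
  rewrite /b /a !sqr_normc_ReIm ReD ImD !ReM !ImM Re_conj Im_conj /=; ring.
have tb : t * (b + 1) <= - a by rewrite -ler_pdivlMr// ge_min lexx orbT.
move: h2; rewrite expand; nra.
Qed.

(** The line is the perpendicular bisector of the segment between nearest points x and y of the
    hulls: [al] is the conjugate of x - y, [be] puts the zero at the midpoint, and eps = |x - y|^2 /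
    2 is the value at x. [nearest_point_angle] at x and at y extends the bounds to the two sets. *)
Lemma separating_line A B : @compact R[i]^o A -> @compact R[i]^o B -> A !=set0 -> B !=set0 ->
  closed_convex_hull A `&` closed_convex_hull B = set0 ->
  exists al be : C, exists2 eps : R, 0 < eps &
    (forall z, A z -> eps <= complex.Re (al * z + be)) /\
    (forall z, B z -> complex.Re (al * z + be) <= - eps).
Proof.
move=> kA kB [a0 Aa0] [b0 Bb0] disj.
have [r1 r10 Ar] := compact_in_disc kA; have [r2 r20 Br] := compact_in_disc kB.
have rA z : closed_convex_hull A z -> normc z <= r1 + r2.
  by move=> /(hull_in_disc Ar)/= h; apply: (le_trans h); rewrite lerDl ltW.
have rB z : closed_convex_hull B z -> normc z <= r1 + r2.
  by move=> /(hull_in_disc Br)/= h; apply: (le_trans h); rewrite lerDr ltW.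
have [x [y [Ax By xy]]] := closed_min_distance (@hull_closed A) (@hull_closed B)
  (ex_intro _ a0 (hull_sub Aa0)) (ex_intro _ b0 (hull_sub Bb0)) rA rB.
pose w := x - y.
have w0 : 0 < normc w.
  rewrite lt0r normc_ge0 andbT; apply/negP => /eqP/eq0_normc/eqP; rewrite subr_eq0 => /eqP E.
  by have : (closed_convex_hull A `&` closed_convex_hull B) x; [split; rewrite // E|rewrite disj].
exists w^*, (- (w^* * ((x + y) / 2%:R))), (normc w ^+ 2 / 2); first by rewrite divr_gt0// exprn_gt0.
have c2 : (2%:R : C) != 0 by rewrite pnatr_eq0.
have wx : w^* * x - w^* * ((x + y) / 2%:R) = ((normc w ^+ 2 / 2)%:C : C).
  rewrite -mulrBr; have -> : x - (x + y) / 2%:R = w / 2%:R by rewrite /w; field.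
  by rewrite mulrA [w^* * w]mulrC mulc_conj fmorph_div rmorph_nat.
have wy : w^* * y - w^* * ((x + y) / 2%:R) = (- (normc w ^+ 2 / 2))%:C.
  rewrite -mulrBr; have -> : y - (x + y) / 2%:R = - (w / 2%:R) by rewrite /w; field.
  by rewrite mulrN mulrA [w^* * w]mulrC mulc_conj rmorphN fmorph_div rmorph_nat.
split=> z hz.
  have hzA := hull_sub hz.
  have := @nearest_point_angle x y z (fun t t0 t1 => xy _ _ (hull_convexC hzA Ax t0 t1) By).
  rewrite -/w => h.
  have -> : w^* * z - w^* * ((x + y) / 2%:R) = w^* * (z - x) + (w^* * x - w^* * ((x + y) / 2%:R)) by ring.
  by rewrite wx ReD /= lerDr.
have hzB := hull_sub hz.
have := @nearest_point_angle y x z.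
have -> : (forall t : R, 0 <= t -> t <= 1 ->
    normc (y - x) <= normc (t%:C * z + (1 - t)%:C * y - x)) <-> True.
  split=> // _ t t0 t1; rewrite normc_distC [leRHS]normc_distC.
  exact: xy Ax (hull_convexC hzB By t0 t1).
move=> /(_ I) h.
have -> : w^* * z - w^* * ((x + y) / 2%:R) = - ((y - x)^* * (z - y)) + (w^* * y - w^* * ((x + y) / 2%:R)).
  by rewrite -[y - x]opprB -/w rmorphN; ring.
by rewrite wy ReD ReN /= gerDr oppr_le0.
Qed.

End plane_topology.

(** * Changing the symbol on a null set *)

Section reduction_to_borel_symbols.
Variable R : realType.
Notation C := R[i].

Lemma ae_imply (P Q : measurableTypeR R * measurableTypeR R -> Prop) :
  (forall p, P p -> Q p) -> {ae (@dm R), forall p, P p} -> {ae (@dm R), forall p, Q p}.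
Proof. exact: (@filterS _ _ (ae_filter_ringOfSetsType (@dm R))). Qed.

(** A change on a null set alters no inner product, so both projections are chosen by [xget] from
    the same set of candidates and are the same function. *)
Lemma toeplitz_ae (V W : C -> R) : {ae (@dm R), forall p, V (plane p) = W (plane p)} ->
  toeplitz V = toeplitz W.
Proof.
move=> VW; apply/funext => f; rewrite /toeplitz /fock_proj; congr xget.
have E g k : inner (fun z => (V z)%:C * f z - g z) k = inner (fun z => (W z)%:C * f z - g z) k.
  rewrite /inner /integralC; congr (_ +i* _); rewrite /Rintegral; congr fine;
    by apply: integral_ae_congr; apply: ae_imply VW => p ->.
by apply/seteqP; split=> g [Fg h]; split=> // k Fk; [rewrite -E|rewrite E]; exact: h.
Qed.

Lemma lambda_plus_ae (V W : C -> R) : {ae (@dm R), forall p, V (plane p) = W (plane p)} ->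
  lambda_plus V = lambda_plus W.
Proof. by move=> /toeplitz_ae E; rewrite /lambda_plus E. Qed.

(** Clamping the Borel representative to [c, M] makes the bounds hold everywhere, and changes
    nothing at points of Omega where it agrees with v. *)
Lemma borel_representative (Omega : set C) (v : C -> R) (c M : R) : measSet Omega ->
  lebesgue_measurable v -> (forall z, Omega z -> c <= v z) -> (forall z, v z <= M) -> c <= M ->
  exists u : C -> R, [/\ measR u, forall z, c <= u z <= M &
    {ae (@dm R), forall p, Omega (plane p) -> v (plane p) = u (plane p)}].
Proof.
move=> mO [w [mw vw]] cv vM cM.
pose clamp x := Num.min M (Num.max c x).
exists (fun z => clamp (w (complex.Re z, complex.Im z))); split.
- rewrite /measR (_ : (fun p => _) = clamp \o w); last by apply/funext => -[x y].
  apply: measurable_minr; first exact: measurable_cst.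
  by apply: measurable_maxr; first exact: measurable_cst.
- by move=> z; rewrite /clamp ge_min lexx le_min cM le_max lexx.
apply: ae_imply vw => -[x y] /= E zO.
by rewrite /clamp -E max_r ?cv// min_r.
Qed.

End reduction_to_borel_symbols.

Theorem theorem1p2 (R : realType) (Omega_p Omega_m : set R[i])
  (v_p v_m : R[i] -> R)
  (dom_p : compact_domain Omega_p) (dom_m : compact_domain Omega_m)
  (lip_p : lipschitz_boundary Omega_p) (lip_m : lipschitz_boundary Omega_m)
  (hull_disj :
    closed_convex_hull Omega_p `&` closed_convex_hull Omega_m = set0)
  (meas_p : lebesgue_measurable v_p) (meas_m : lebesgue_measurable v_m)
  (v_p_ge0 : forall z, 0 <= v_p z) (v_m_ge0 : forall z, 0 <= v_m z)
  (v_p_bnd : exists M, forall z, v_p z <= M)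
  (v_m_bnd : exists M, forall z, v_m z <= M)
  (v_p_inf : 0 < inf (v_p @` Omega_p)) (v_m_inf : 0 < inf (v_m @` Omega_m)) :
  let V := fun z => v_p z * \1_Omega_p z - v_m z * \1_Omega_m z in
  eq_exp_nlogn (singular_value V) /\
  exists delta_p Delta_p delta_m Delta_m : R,
    [/\ [/\ 0 < delta_p, delta_p <= Delta_p & Delta_p < 1],
        [/\ 0 < delta_m, delta_m <= Delta_m & Delta_m < 1],
        delta_p + Delta_m = 1 /\ delta_m + Delta_p = 1,
        exp_nlogn_le delta_p (lambda_plus V) /\
        le_exp_nlogn Delta_p (lambda_plus V) &
        exp_nlogn_le delta_m (lambda_minus V) /\
        le_exp_nlogn Delta_m (lambda_minus V)].
Proof.
move=> V.
have [kp [zp /nbhs_disc[rp rp0 Hp]] _ clp] := dom_p.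
have [km [zm /nbhs_disc[rm rm0 Hm]] _ clm] := dom_m.
have mp : measSet Omega_p by apply: closed_measSet; rewrite -clp; exact: closed_closure.
have mm : measSet Omega_m by apply: closed_measSet; rewrite -clm; exact: closed_closure.
have zpO : Omega_p zp by apply: Hp; rewrite /disc/= subrr normc0.
have zmO : Omega_m zm by apply: Hm; rewrite /disc/= subrr normc0.
have disj z : Omega_p z -> Omega_m z -> False.
  move=> hp hm; have : (closed_convex_hull Omega_p `&` closed_convex_hull Omega_m) z.
    by split; exact: hull_sub.
  by rewrite hull_disj.
have inf_le (v : R[i] -> R) (A : set R[i]) z : (forall z, 0 <= v z) -> A z -> inf (v @` A) <= v z.
  by move=> v0 Az; apply: ge_inf; [exists 0 => _ [y _ <-]|exists z].
have [Mp vpM] := v_p_bnd; have [Mm vmM] := v_m_bnd.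
pose c := Num.min (inf (v_p @` Omega_p)) (inf (v_m @` Omega_m)).
have c0 : 0 < c by rewrite lt_min v_p_inf.
have cp z : Omega_p z -> c <= v_p z.
  by move=> zO; rewrite ge_min inf_le.
have cm z : Omega_m z -> c <= v_m z.
  by move=> zO; rewrite ge_min inf_le// orbT.
pose M := Num.max Mp Mm.
have cM : c <= M by rewrite le_max (le_trans (cp _ zpO) (vpM zp)).
have vpM' z : v_p z <= M by rewrite le_max vpM.
have vmM' z : v_m z <= M by rewrite le_max vmM orbT.
have [up [mup ub up_ae]] := borel_representative mp meas_p cp vpM' cM.
have [um [mum vb um_ae]] := borel_representative mm meas_m cm vmM' cM.
(* The Borel symbol that stands for V. The domains are disjoint because their hulls are, so W equals
   [up] on one and -[um] on the other, with the common lower bound [c]. *)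
pose W z := up z * \1_Omega_p z - um z * \1_Omega_m z.
have VW : {ae (@dm R), forall p, V (plane p) = W (plane p)}.
  apply: (@filterS2 _ _ (ae_filter_ringOfSetsType (@dm R)) _ _ _ _ up_ae um_ae) => p h1 h2; rewrite /V /W !indicE.
  by congr (_ - _); case: (boolP (_ \in _)) => [/set_mem|_]; rewrite ?mulr0// => h; rewrite ?h1 ?h2.
have NVW : {ae (@dm R), forall p, - V (plane p) = - W (plane p)}.
  by apply: ae_imply VW => p ->.
have [rho1 rho10 Hrho1] := compact_in_disc kp; have [rho2 rho20 Hrho2] := compact_in_disc km.
have [al [be [eps eps0 [linp linm]]]] := separating_line kp km (ex_intro _ zp zpO) (ex_intro _ zm zmO) hull_disj.
have Wp z : Omega_p z -> W z = up z.
  move=> zO; rewrite /W !indicE mem_set// memNset ?mulr1 ?mulr0 ?subr0//.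
  exact: disj.
have Wm z : Omega_m z -> W z = - um z.
  move=> zO; rewrite /W !indicE [z \in Omega_m]mem_set// memNset ?mulr1 ?mulr0 ?sub0r//.
  by move=> /disj; apply.
have S : separated W M Omega_p Omega_m (rho1 + rho2) c al be eps zp zm (Num.min rp rm).
  split=> //.
  - split.
    + exact: (measRB (measRM mup (measR_indic mp)) (measRM mum (measR_indic mm))).
    + exact: lt_le_trans c0 cM.
    + by rewrite addr_ge0// ltW.
    + exact: measurableU.
    + by move=> z [/Hrho1|/Hrho2]; rewrite /disc/= !subr0 => h; apply: (lt_le_trans h); rewrite ?lerDl ?lerDr ltW.
    + move=> z; rewrite indicE; case: (boolP (z \in _)) => [|zN].
        have c0' := ltW c0.
        rewrite inE mulr1 => -[zO|zO]; [rewrite Wp//|rewrite Wm// normrN];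
          [have /andP[h1 h2] := ub z|have /andP[h1 h2] := vb z];
          by rewrite ger0_norm// (le_trans c0').
      move: zN; rewrite in_setU negb_or => /andP[zp' zm'].
      by rewrite /W !indicE (negbTE zp') (negbTE zm') !mulr0 subrr normr0.
  - by move=> z zO; rewrite Wp//; have /andP[] := ub z.
  - by move=> z zO; rewrite Wm// lerN2; have /andP[] := vb z.
  - by rewrite lt_min rp0.
  - by move=> z hz; apply: Hp; rewrite /disc/=; apply: (lt_le_trans hz); rewrite ge_min lexx.
  - by move=> z hz; apply: Hm; rewrite /disc/=; apply: (lt_le_trans hz); rewrite ge_min lexx orbT.
have := separated_asymptotics S.
by rewrite /singular_value /lambda_minus (lambda_plus_ae VW) (@lambda_plus_ae R (fun z => - V z) (fun z => - W z) NVW).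
Qed.
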